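(* Let $n\ge 1$ and let $w=(w_{ijk})$ be a $2\times2\times n$ tensor of variables, where $i,j\in[2]$ and $k\in[n]$. The principal $A$-determinant for the Segre embedding of $\mathbb{P}^1\times\mathbb{P}^1\times\mathbb{P}^{n-1}$ is (up to a nonzero scalar) the product of all $2$-minors arising from all slices of $w$ together with all $2\times2\times2$ and $2\times2\times3$ hyperdeterminants of $w$, i.e. the hyperdeterminants of the subtensors $(w_{ijk})_{i,j\in[2],\,k\in K}$ for $K\subseteq[n]$ with $|K|=2$ or $|K|=3$.
   Context: Let $A=(a_1\ \cdots\ a_N)$ be an integer matrix with columns $a_i\in\mathbb{Z}^d$ whose row span contains the all-ones vector. Put $f_w=\sum_{i=1}^N w_i\theta^{a_i}$ and let $\nabla_A$ be the closure in $(\mathbb{C}^* )^N$ of the set of $w\in(\mathbb{C}^* )^N$ for which there is $\theta\in(\mathbb{C}^* )^d$ with $f_w(\theta)=\frac{\partial f_w}{\partial\theta_i}(\theta)=0$ for all $i$. If $\nabla_A$ has codimension one, the $A$-discriminant $\Delta_A$ is the irreducible polynomial (unique up to scalar) vanishing on $\nabla_A$; otherwise $\Delta_A=1$ (the trivial discriminant). For smooth $X_A$ (as is the case here), the principal $A$-determinant is $E_A(w)=\prod_{\Gamma}\Delta_{\Gamma\cap A}$, the product over all nonempty faces $\Gamma$ of $P=\operatorname{conv}(a_1,\dots,a_N)$, including $P$, where $\Gamma\cap A$ is the matrix whose columns are the lattice points of $\Gamma$ (the discriminant $\Delta_{\Gamma\cap A}$ is in the corresponding variables $w$). For $\mathbb{P}^1\times\mathbb{P}^1\times\mathbb{P}^{n-1}$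 the columns of $A$ are the vectors $e_i\oplus e_j\oplus f_k\in\mathbb{R}^2\oplus\mathbb{R}^2\oplus\mathbb{R}^n$ ($i,j\in[2]$, $k\in[n]$; $e_i$, $f_k$ standard unit vectors), with coefficient $w_{ijk}$, so $P=\Delta_1\times\Delta_1\times\Delta_{n-1}$. A slice of $w$ is a matrix obtained by fixing one of the three indices $i$, $j$ or $k$; its $2$-minors are its $2\times 2$ subdeterminants. The hyperdeterminant of format $2\times2\times k$ ($k=2,3$) is the irreducible polynomial, unique up to scalar, defining the projective dual variety of the Segre variety $\mathbb{P}^1\times\mathbb{P}^1\times\mathbb{P}^{k-1}\subset\mathbb{P}^{4k-1}$, i.e. vanishing exactly at the tensors $w$ for which the trilinear form $\sum w_{ijk}x_iy_jz_k$ and all its partial derivatives vanish at some $(x,y,z)$ with $x,y,z$ all nonzero vectors. *)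

(* Defs.v *)
From HB Require Import structures.
From mathcomp Require Import all_boot all_order all_algebra.
From mathcomp Require Import boolp classical_sets reals.
From mathcomp Require Import complex.
From mathcomp Require Import mpoly.
From mathcomp Require Import zify.
Set Implicit Arguments.
Unset Strict Implicit.
Unset Printing Implicit Defensive.
Import Order.TTheory GRing.Theory Num.Theory.
Local Open Scope ring_scope.

(* The complex numbers are R[i] with R : realType. *)

Definition irreducible_elt (D : idomainType) (p : D) : Prop :=
  [/\ p != 0, p \isn't a GRing.unit &
      forall a b : D, p = a * b -> a \is a GRing.unit \/ b \is a GRing.unit].

(** * Zariski topology and codimension in the torus (F^* )^N *)

Definition torus (F : fieldType) (N : nat) : set ('I_N -> F) :=
  [set w | forall m, w m != 0]%classic.

(* On the torus, Laurent polynomials and polynomials have the same zero loci,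
   so polynomials suffice. *)
Definition zclosure (F : fieldType) (N : nat) (Y : set ('I_N -> F)) :
    set ('I_N -> F) :=
  [set w | torus w /\ forall p : {mpoly F[N]},
             (forall v, Y v -> p.@[v] = 0) -> p.@[w] = 0]%classic.

Definition zclosed (F : fieldType) (N : nat) (Z : set ('I_N -> F)) : Prop :=
  zclosure Z = Z.

Definition zirreducible (F : fieldType) (N : nat) (Z : set ('I_N -> F)) : Prop :=
  [/\ zclosed Z, (exists w, Z w) &
      forall Z1 Z2, zclosed Z1 -> zclosed Z2 -> Z = (Z1 `|` Z2)%classic ->
        Z = Z1 \/ Z = Z2].

(* A strictly increasing chain Z = W 0 < W 1 < ... < W c of irreducible closed
   subsets of the torus. *)
Definition zchain (F : fieldType) (N : nat) (Z : set ('I_N -> F)) (c : nat) : Prop :=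
  exists W : nat -> set ('I_N -> F),
    [/\ W 0%N = Z,
        forall i, (i <= c)%N -> zirreducible (W i) &
        forall i, (i < c)%N -> (W i `<` W i.+1)%classic].

Definition zcodim_irr (F : fieldType) (N : nat) (Z : set ('I_N -> F)) (c : nat) :
    Prop :=
  zchain Z c /\ forall c', zchain Z c' -> (c' <= c)%N.

(* The least codimension of an irreducible closed subset; the empty set has no
   (finite) codimension. *)
Definition zcodim (F : fieldType) (N : nat) (Y : set ('I_N -> F)) (c : nat) : Prop :=
  (exists Z, [/\ zirreducible Z, (Z `<=` Y)%classic & zcodim_irr Z c]) /\
  (forall Z c', zirreducible Z -> (Z `<=` Y)%classic -> zcodim_irr Z c' ->
     (c <= c')%N).

(** * A-discriminants *)

Definition monom_val (F : fieldType) (d : nat) (a : 'cV[int]_d) (t : 'I_d -> F) : F :=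
  \prod_r t r ^ a r 0.

(* Value at t of the partial derivative with respect to t_s of the Laurent
   monomial t^a. *)
Definition monom_dval (F : fieldType) (d : nat) (s : 'I_d) (a : 'cV[int]_d)
    (t : 'I_d -> F) : F :=
  (a s 0)%:~R * t s ^ (a s 0 - 1) * \prod_(r | r != s) t r ^ a r 0.

Definition nabla0 (F : fieldType) (d N : nat) (A : 'M[int]_(d, N)) : set ('I_N -> F) :=
  [set w | torus w /\ exists t : 'I_d -> F,
     [/\ torus t,
         \sum_m w m * monom_val (col m A) t = 0 &
         forall s, \sum_m w m * monom_dval s (col m A) t = 0]]%classic.
Arguments nabla0 F {d N} A.

Definition nabla (F : fieldType) (d N : nat) (A : 'M[int]_(d, N)) : set ('I_N -> F) :=
  zclosure (nabla0 F A).
Arguments nabla F {d N} A.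

(* The discriminant is unique only up to a nonzero scalar: xget selects one
   (and would return 0 if there were none). *)
Definition Adisc (F : fieldType) (d N : nat) (A : 'M[int]_(d, N)) : {mpoly F[N]} :=
  if `[< zcodim (nabla F A) 1 >] then
    xget 0 [set D : {mpoly F[N]} | irreducible_elt D /\
              forall w, nabla F A w -> D.@[w] = 0]%classic
  else 1.

(** * Faces of P = conv(a_1, ..., a_N) *)

Definition rcol (R : realType) (d N : nat) (A : 'M[int]_(d, N)) (m : 'I_N) : 'cV[R]_d :=
  map_mx intr (col m A).

Definition conv_cols (R : realType) (d N : nat) (A : 'M[int]_(d, N)) : set 'cV[R]_d :=
  [set x | exists l : 'I_N -> R,
     [/\ forall m, 0 <= l m, \sum_m l m = 1 &
         x = \sum_m l m *: rcol R A m]]%classic.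
Arguments conv_cols R {d N} A.

(* Nonempty faces of a polytope, P itself being obtained for u = 0, c = 0. *)
Definition is_face (R : realType) (d : nat) (P G : set 'cV[R]_d) : Prop :=
  (exists x, G x) /\
  exists (u : 'rV[R]_d) (c : R),
    (forall x, P x -> (u *m x) 0 0 <= c) /\
    G = [set x | P x /\ (u *m x) 0 0 = c]%classic.

Definition face_cols (R : realType) (d N : nat) (A : 'M[int]_(d, N))
    (G : set 'cV[R]_d) : {set 'I_N} :=
  [set m | `[< G (rcol R A m) >]].

Definition face_colset (R : realType) (d N : nat) (A : 'M[int]_(d, N))
    (S : {set 'I_N}) : Prop :=
  exists G : set 'cV[R]_d, is_face (conv_cols R A) G /\ S = face_cols A G.

(* A face is determined by the columns it contains, so a product over the faces
   may be indexed by the sets of columns S with face_colset R A S. *)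
Lemma face_cols_inj (R : realType) (d N : nat) (A : 'M[int]_(d, N))
    (G1 G2 : set 'cV[R]_d) :
  is_face (conv_cols R A) G1 -> is_face (conv_cols R A) G2 ->
  face_cols A G1 = face_cols A G2 -> G1 = G2.
Proof.
suff H G G' : is_face (conv_cols R A) G -> is_face (conv_cols R A) G' ->
    face_cols A G = face_cols A G' -> (G `<=` G')%classic.
  by move=> f1 f2 e; apply/seteqP; split; apply: H.
move=> [_ [u [c [ule ->]]]] [_ [u' [c' [_ ->]]]] eqS x /=.
have colP m : conv_cols R A (rcol R A m).
  exists (fun m' => (m' == m)%:R); split=> [m'|| ]; first exact: ler0n.
    by rewrite (bigD1 m) //= eqxx big1 ?addr0 // => i /negPf->.
  by rewrite (bigD1 m) //= eqxx scale1r big1 ?addr0 // => i /negPf->; rewrite scale0r.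
move=> [Px ux]; split=> //; case: Px => l [l0 l1 ex].
have val v : (v *m x) 0 0 = \sum_m l m * (v *m rcol R A m) 0 0.
  by rewrite ex mulmx_sumr summxE; apply: eq_bigr => m _; rewrite -scalemxAr mxE.
have l_face m : l m != 0 -> (u *m rcol R A m) 0 0 = c.
  move=> lm; have d0 : \sum_m l m * (c - (u *m rcol R A m) 0 0) = 0.
    under eq_bigr do rewrite mulrBr.
    by rewrite sumrB -val ux -mulr_suml l1 mul1r subrr.
  have /(_ m isT)/eqP : forall i, true -> l i * (c - (u *m rcol R A i) 0 0) = 0.
    apply/psumr_eq0P => // i _; rewrite mulr_ge0 // subr_ge0; exact/ule/colP.
  by rewrite mulf_eq0 (negPf lm) subr_eq0 => /eqP.
rewrite val -[RHS]mul1r -l1 mulr_suml; apply: eq_bigr => m _.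
have [->|/l_face um] := eqVneq (l m) 0; first by rewrite !mul0r.
have /asboolP [_ ->] // : `[< [set x | conv_cols R A x /\ (u' *m x) 0 0 = c']%classic
                              (rcol R A m) >].
have : m \in face_cols A [set x | conv_cols R A x /\ (u *m x) 0 0 = c]%classic.
  by rewrite inE; apply/asboolP.
by rewrite eqS inE.
Qed.

(** * Principal A-determinant *)

Definition sub_cols (d N : nat) (A : 'M[int]_(d, N)) (S : {set 'I_N}) :
    'M[int]_(d, #|S|) :=
  colsub (fun m : 'I_#|S| => enum_val m) A.

(* The substitution 'X_(enum_val m) for 'X_m puts the discriminant of a face
   back into the variables of the columns of A it contains. *)
Definition principal_Adet (R : realType) (d N : nat) (A : 'M[int]_(d, N)) :
    {mpoly R[i][N]} :=
  \prod_(S : {set 'I_N} | `[< face_colset R A S >])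
    (Adisc R[i] (sub_cols A S) \mPo [tuple 'X_(enum_val m) | m < #|S|]).

(** * The Segre embedding of P^1 x P^1 x P^(n-1) *)

Definition tidx (n : nat) : finType := ('I_2 * 'I_2 * 'I_n)%type.

Definition tpos (n : nat) (i j : 'I_2) (k : 'I_n) : 'I_#|tidx n| :=
  enum_rank ((i, j, k) : tidx n).

Definition segre_col (n : nat) (t : tidx n) : 'cV[int]_(2 + 2 + n) :=
  col_mx (col_mx (delta_mx t.1.1 0) (delta_mx t.1.2 0)) (delta_mx t.2 0).

Definition segre (n : nat) : 'M[int]_(2 + 2 + n, #|tidx n|) :=
  \matrix_(r, m) segre_col (enum_val m) r 0.

(* Every lattice point of P is a column, so face_cols misses no lattice point of
   a face. *)
Lemma segre_lattice_points (R : realType) (n : nat) (x : 'cV[int]_(2 + 2 + n)) :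
  conv_cols R (segre n) (map_mx intr x) -> exists m, x = col m (segre n).
Proof.
move=> [l [l0 l1 ex]].
have exr r : (x r 0)%:~R = \sum_m l m * (segre n r m)%:~R :> R.
  have := congr1 (fun M : 'cV[R]_(2 + 2 + n) => M r 0) ex; rewrite mxE => ->.
  by rewrite summxE; apply: eq_bigr => m _; rewrite !mxE.
have s01 r m : 0 <= segre n r m <= 1.
  rewrite mxE /segre_col mxE; case: split => k; last by rewrite mxE ler0n lern1 leq_b1.
  by rewrite mxE; case: split => k'; rewrite mxE ler0n lern1 leq_b1.
have x01 r : x r 0 = 0 \/ x r 0 = 1.
  have h0 : (0 : R) <= (x r 0)%:~R.
    rewrite exr sumr_ge0 // => m _; rewrite mulr_ge0 // ler0z.
    by case/andP: (s01 r m).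
  have h1 : (x r 0)%:~R <= (1 : R).
    rewrite exr -[leRHS]l1 ler_sum // => m _; rewrite ler_piMr // lerz1.
    by case/andP: (s01 r m).
  by rewrite ler0z in h0; rewrite lerz1 in h1; lia.
have [m lm] : exists m, 0 < l m.
  apply/existsP; apply: contraT => /existsPn h; have := l1.
  rewrite big1 => [/esym/eqP|m _]; first by rewrite oner_eq0.
  by apply/eqP; rewrite eq_le l0 andbT leNgt h.
exists m; apply/colP => r; rewrite [RHS]mxE.
have [xr|xr] := x01 r; have := exr r; rewrite xr.
  move/esym/eqP; rewrite psumr_eq0 => [|i _]; last first.
    by rewrite mulr_ge0 // ler0z; case/andP: (s01 r i).
  by move/allP/(_ m (mem_index_enum _)); rewrite mulf_eq0 gt_eqF //= intr_eq0 => /eqP.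
move/eqP; rewrite -[X in X == _]l1 -subr_eq0 -sumrB psumr_eq0 => [|i _]; last first.
  by rewrite subr_ge0 ler_piMr // lerz1; case/andP: (s01 r i).
move/allP/(_ m (mem_index_enum _)); rewrite -{1}[l m]mulr1 -mulrBr mulf_eq0.
by rewrite gt_eqF //= subr_eq0 -[X in X == _]/(1%:~R) eqr_int => /eqP.
Qed.

Definition wvar (F : fieldType) (n : nat) (i j : 'I_2) (k : 'I_n) :
    {mpoly F[#|tidx n|]} :=
  'X_(tpos i j k).

(** * Minors and hyperdeterminants *)

Definition prod_2minors (T : comNzRingType) (m n : nat) (M : 'M[T]_(m, n)) : T :=
  \prod_(r1 < m) \prod_(r2 < m | (r1 < r2)%N)
   \prod_(c1 < n) \prod_(c2 < n | (c1 < c2)%N)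
    (M r1 c1 * M r2 c2 - M r1 c2 * M r2 c1).

Definition prod_slice_minors (F : fieldType) (n : nat) : {mpoly F[#|tidx n|]} :=
  (\prod_(i < 2) prod_2minors (\matrix_(j < 2, k < n) wvar F i j k)) *
  (\prod_(j < 2) prod_2minors (\matrix_(i < 2, k < n) wvar F i j k)) *
  (\prod_(k < n) prod_2minors (\matrix_(i < 2, j < 2) wvar F i j k)).

(* w is a point of the projective dual variety: the trilinear form
   sum w_ijk x_i y_j z_k and its partial derivatives vanish at some (x, y, z). *)
Definition singular_tensor (F : fieldType) (k : nat) (w : 'I_#|tidx k| -> F) : Prop :=
  exists (x y : 'I_2 -> F) (z : 'I_k -> F),
    [/\ exists i, x i != 0, exists j, y j != 0 & exists l, z l != 0] /\
    [/\ \sum_i \sum_j \sum_l w (tpos i j l) * x i * y j * z l = 0,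
        forall i, \sum_j \sum_l w (tpos i j l) * y j * z l = 0,
        forall j, \sum_i \sum_l w (tpos i j l) * x i * z l = 0 &
        forall l, \sum_i \sum_j w (tpos i j l) * x i * y j = 0].

(* Unique up to a nonzero scalar for k = 2, 3, the only formats used. *)
Definition hyperdet (F : fieldType) (k : nat) : {mpoly F[#|tidx k|]} :=
  xget 0 [set H : {mpoly F[#|tidx k|]} | irreducible_elt H /\
            forall w, H.@[w] = 0 <-> singular_tensor w]%classic.

Definition sub_hyperdet (F : fieldType) (n : nat) (K : {set 'I_n}) :
    {mpoly F[#|tidx n|]} :=
  hyperdet F #|K| \mPo
    [tuple (let t : tidx #|K| := enum_val m in
            wvar F t.1.1 t.1.2 (enum_val t.2)) | m < #|tidx #|K| |].

(* Main.v *)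
(** The faces of the polytope are the products I x J x K of nonempty index sets,
    and critical points of f_w in the torus are points where all slice sums of
    w_ijk x_i y_j z_k vanish. If two of I, J, K are singletons then one such sum
    is a single nonzero term and nabla is empty. Otherwise nabla lies in a
    hypersurface H = 0 with H a 2-minor or a 2 x 2 x 2 or 2 x 2 x 3
    hyperdeterminant. Either nabla is dense in it and the discriminant is H, or K
    is larger and another polynomial of the same kind vanishes on nabla too, so
    nabla has codimension at least two.

    No factoriality of polynomial rings is used. A hypersurface H is parametrized
    by polynomials, and p vanishing on the image is shown to be a multiple of H by
    pseudo-division with respect to a variable in which H has degree at most two:
    a^e p = H g + r, the fibres of the projection along that variable generically
    have as many points as the degree of H, so r = 0, and a is a product of
    elements known to be prime which do not divide H. This gives both that H is
    prime, the parameter space being irreducible, and that it generates the ideal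
    of its singular tensors. *)
Require Import Defs.
From mathcomp Require Import all_boot all_order all_algebra.
From mathcomp Require Import boolp classical_sets reals.
From mathcomp Require Import complex.
From mathcomp Require Import mpoly.
From mathcomp Require Import ring lra.
Set Implicit Arguments.
Unset Strict Implicit.
Unset Printing Implicit Defensive.
Import Order.TTheory GRing.Theory Num.Theory.
Local Open Scope ring_scope.

(** * Polynomial functions and irreducibility *)

(** The two definitions make opposite demands on the same polynomial. A discriminant sees only
    tensors in the torus that are critical at torus points, so generic arguments suffice, but
    genericity has to be witnessed: each parametrization must reach the open set where all entries
    and all critical coordinates are nonzero, whence the explicit numerical points. A
    hyperdeterminant must vanish exactly on the singular tensors of the whole affine space, so every
    degenerate position (a zero coordinate, a pencil that vanishes at its double root, a flattening
    of rank below three) needs its own critical point.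

    The leading coefficients decide in which order primality is proved. A minor is linear in one
    entry with a variable as leading coefficient; the 2 x 2 x 2 hyperdeterminant is quadratic in [a]
    with leading coefficient [h ^+ 2]; the 2 x 2 x 3 one is quadratic in [a 0] with a product of two
    minors in front. So variables come first, then minors, then hyperdeterminants. Algebraic closure
    enters where both roots of such a quadratic must lie in the field. *)

Section PolynomialFunctions.
Variable F : numFieldType.

Lemma poly_fun0 (q : {poly F}) : (forall t, q.[t] = 0) -> q = 0.
Proof.
move=> h; apply/eqP; apply: contraT => q0.
have := max_poly_roots (rs := [seq i%:R | i <- iota 0 (size q)]) q0.
rewrite size_map size_iota ltnn => -> //.
  by apply/allP => x _; rewrite /root h.
by rewrite map_inj_uniq ?iota_uniq // => i j /eqP; rewrite eqr_nat => /eqP.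
Qed.

(** Induction on the number of variables: [muni] reads [p] as a polynomial in the last variable over
    the others, and each of its coefficients is again zero as a function. *)
Lemma mpoly_fun0 N (p : {mpoly F[N]}) : (forall v, p.@[v] = 0) -> p = 0.
Proof.
elim: N p => [|n IH] p hp.
  apply/mpolyP => m; rewrite mcoeff0; have := hp (fun=> 0).
  have e (m' : 'X_{1..0}) : m' = m by apply/mnmP => -[].
  have ep : p = p@_m *: 'X_[m].
    by apply/mpolyP => m'; rewrite mcoeffZ mcoeffX (e m') eqxx mulr1.
  by rewrite {1}ep mevalZ mevalX big_ord0 mulr1.
have ev (v : 'I_n.+1 -> F) :
    (map_poly (meval (fun i => v (widen_ord (leqnSn n) i))) (muni p)).[v ord_max]
    = p.@[v].
  rewrite muniE mevalE rmorph_sum /= horner_sum; apply: eq_bigr => m _.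
  rewrite !map_polyZ /= map_polyXn !hornerZ hornerXn mevalZ mevalX big_ord_recr /=.
  by rewrite mulrA; congr (_ * _ * _); apply: eq_bigr => i _; rewrite mnmE.
have q0 : muni p = 0.
  apply/polyP => k; rewrite coef0; apply: IH => v.
  have /(congr1 (fun q : {poly F} => q`_k)) : map_poly (meval v) (muni p) = 0.
    apply: poly_fun0 => t.
    pose v' (i : 'I_n.+1) := if unlift ord_max i is Some j then v j else t.
    have := ev v'; rewrite hp /v' unlift_none => <-; congr (_.[t]).
    apply: eq_map_poly => r; apply: meval_eq => i.
    have -> : widen_ord (leqnSn n) i = lift ord_max i.
      by apply: val_inj; rewrite /= /bump leqNgt ltn_ord.
    by rewrite liftK.
  by rewrite coef_map coef0.
apply/mpolyP => m; rewrite mcoeff0.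
have [|/memN_msupp_eq0 //] := boolP (m \in msupp p) => mp.
(* The exponent of the last variable together with the truncation [r m] determines [m], so exactly
   one term of [muni p] contributes to this coefficient. *)
pose r (m : 'X_{1..n.+1}) := [multinom m (widen_ord (leqnSn n) i) | i < n].
have := congr1 (fun q : {poly {mpoly F[n]}} => (q`_(m ord_max))@_(r m)) q0.
rewrite muniE coef_sum raddf_sum coef0 mcoeff0 /= (bigD1_seq m) ?msupp_uniq //=.
rewrite coefZ coefXn eqxx mulr1 mcoeffZ mcoeffX eqxx mulr1 big1 ?addr0 // => m' nm.
rewrite coefZ coefXn; have [e|] := eqVneq; last by rewrite mulr0 mcoeff0.
rewrite mulr1 mcoeffZ mcoeffX; case: eqP => [er|]; last by rewrite mulr0.
case/eqP: nm; apply/mnmP => i; case: (unliftP ord_max i) => [j ->|-> //].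
have -> : lift ord_max j = widen_ord (leqnSn n) j.
  by apply: val_inj; rewrite /= /bump leqNgt ltn_ord.
by move/mnmP/(_ j): er; rewrite !mnmE.
Qed.

Definition lerp (I : Type) (u v : I -> F) (t : F) : I -> F :=
  fun i => u i + t * (v i - u i).

(* Polynomial along every line: closed under the ring operations and under
   composition, and enough to see that two nonzero such functions have a common
   nonzero point. *)
Definition line_poly (I : Type) (f : (I -> F) -> F) : Prop :=
  forall u v, exists q : {poly F}, forall t, f (lerp u v t) = q.[t].

Section LinePoly.
Variable I : Type.
Implicit Types f g : (I -> F) -> F.

Lemma line_polyC c : line_poly (fun _ : I -> F => c).
Proof. by move=> u v; exists c%:P => t; rewrite hornerC. Qed.

Lemma line_polyX i : line_poly (fun u : I -> F => u i).
Proof.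
move=> u v; exists ((u i)%:P + 'X * (v i - u i)%:P) => t.
by rewrite /lerp !hornerE.
Qed.

Lemma line_polyD f g : line_poly f -> line_poly g -> line_poly (fun u => f u + g u).
Proof.
move=> hf hg u v; have [p ep] := hf u v; have [q eq] := hg u v.
by exists (p + q) => t; rewrite hornerD ep eq.
Qed.

Lemma line_polyM f g : line_poly f -> line_poly g -> line_poly (fun u => f u * g u).
Proof.
move=> hf hg u v; have [p ep] := hf u v; have [q eq] := hg u v.
by exists (p * q) => t; rewrite hornerM ep eq.
Qed.

Lemma line_polyN f : line_poly f -> line_poly (fun u => - f u).
Proof. by move=> hf u v; have [p ep] := hf u v; exists (- p) => t; rewrite hornerN ep. Qed.

Lemma line_poly_prod (J : finType) (f : J -> (I -> F) -> F) :
  (forall j, line_poly (f j)) -> line_poly (fun u => \prod_j f j u).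
Proof.
move=> hf u v; pose q j := sval (cid (hf j u v)).
exists (\prod_j q j) => t; rewrite horner_prod; apply: eq_bigr => j _.
exact: (svalP (cid (hf j u v))).
Qed.

Lemma line_poly_meval N (phi : (I -> F) -> 'I_N -> F) (p : {mpoly F[N]}) :
  (forall m, line_poly (fun u => phi u m)) -> line_poly (fun u => p.@[phi u]).
Proof.
move=> hphi; elim/mpolyind: p => [|c m p _ _ IH] u v.
  by exists 0 => t; rewrite meval0 horner0.
have [q eq] := IH u v; pose r i := sval (cid (hphi i u v)).
exists (c%:P * \prod_i r i ^+ m i + q) => t.
rewrite mevalD mevalZ mevalX !hornerE eq horner_prod; congr (_ * _ + _).
apply: eq_bigr => i _; rewrite horner_exp; congr (_ ^+ _).
exact: (svalP (cid (hphi i u v))).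
Qed.

(** This is the irreducibility of the parameter space. On the line joining the two witnesses both
    functions restrict to nonzero polynomials in [t], and the product of these is nonzero. *)
Lemma line_poly_common f g : line_poly f -> line_poly g ->
  (exists u, f u != 0) -> (exists u, g u != 0) ->
  exists u, f u != 0 /\ g u != 0.
Proof.
move=> hf hg [u fu] [v gv]; have [p ep] := hf u v; have [q eq] := hg u v.
apply: contrapT => /forallNP h.
have : p * q = 0.
  apply: poly_fun0 => t; rewrite hornerM -ep -eq.
  apply/eqP; rewrite mulf_eq0; apply: contrapT => /negP; rewrite negb_or => /andP[].
  by move=> a b; apply: (h (lerp u v t)).
have e0 : lerp u v 0 = u by apply: funext => i; rewrite /lerp mul0r addr0.
have e1 : lerp u v 1 = v by apply: funext => i; rewrite /lerp mul1r addrC subrK.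
move/eqP; rewrite mulf_eq0 => /orP[] /eqP e.
  by have := ep 0; rewrite e horner0 e0 => /eqP; rewrite (negPf fu).
by have := eq 1; rewrite e horner0 e1 => /eqP; rewrite (negPf gv).
Qed.

End LinePoly.

End PolynomialFunctions.

(** * Divisibility by pseudo-division *)

Section Elimination.
Variables (F : numFieldType) (N : nat).
Implicit Types (p q H a b c r g : {mpoly F[N]}) (v : 'I_N -> F) (T : set ('I_N -> F)).

Definition mdvd H p : Prop := exists g, p = H * g.

Definition vanishes T p : Prop := forall v, T v -> p.@[v] = 0.

Definition prime_mpoly H : Prop :=
  [/\ H != 0, H \isn't a GRing.unit &
      forall p q, mdvd H (p * q) -> mdvd H p \/ mdvd H q].

Lemma prime_irreducible H : prime_mpoly H -> irreducible_elt H.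
Proof.
move=> [H0 HU Hp]; split=> // a b e.
have [] := Hp a b; first by exists 1; rewrite mulr1.
  move=> [g eg]; right; apply/unitrP; exists g; suff: H * (g * b) = H * 1.
    by move/(mulfI H0) => gb; rewrite [b * g]mulrC.
  by rewrite mulrA -eg mulr1 e.
move=> [g eg]; left; apply/unitrP; exists g; suff: H * (g * a) = H * 1.
  by move/(mulfI H0) => gb; rewrite [a * g]mulrC.
by rewrite mulrA -eg mulr1 e mulrC.
Qed.

Lemma mpoly_unit_scalar p : p \is a GRing.unit -> exists2 c : F, c != 0 & p = c%:MP.
Proof.
move=> /andP[/eqP e u]; exists p@_0 => //.
by rewrite -unitfE.
Qed.

(** Identifies a polynomial selected by [xget], known only through its irreducibility and its zeros,
    with an explicit [H]. *)
Lemma mdvd_irreducible H D : H \isn't a GRing.unit -> irreducible_elt D ->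
  mdvd H D -> exists2 c : F, c != 0 & D = c *: H.
Proof.
move=> HU [D0 DU Di] [g e]; have [|gU] := Di _ _ e; first by rewrite (negPf HU).
have [c c0 ec] := mpoly_unit_scalar gU.
by exists c => //; rewrite e ec mulrC mul_mpolyC.
Qed.

(** Writing [q * p = H * g], the prime [q] must divide [g] and cancels. The primality used is that
    of [q], so this can serve in the proof that [H] is prime. *)
Lemma cancel_prime H q : prime_mpoly q -> ~ mdvd q H ->
  forall p, mdvd H (q * p) -> mdvd H p.
Proof.
move=> [q0 _ qp] nqH p [g e]; have [//|[g' eg]] : mdvd q H \/ mdvd q g.
  by apply: qp; exists p.
by exists g'; apply: (mulfI q0); rewrite e eg mulrCA.
Qed.

Lemma mdvd_meval H p v : mdvd H p -> H.@[v] = 0 -> p.@[v] = 0.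
Proof. by move=> [g ->] e; rewrite mevalM e mul0r. Qed.

(* rem is the set of remainders of degree less than that of H in some variable
   with leading coefficient a. *)
Section Remainders.
Variables (H a : {mpoly F[N]}) (rem : {mpoly F[N]} -> Prop).
Hypothesis remD : forall r r', rem r -> rem r' -> rem (r + r').
Hypothesis rema : forall r, rem r -> rem (a * r).
Hypothesis remC : forall c : F, rem c%:MP.

Let red p := exists (e : nat) r g, rem r /\ a ^+ e * p = H * g + r.

Hypothesis remM : forall r r', rem r -> rem r' -> red (r * r').
Hypothesis remX : forall m, red 'X_m.

(** The polynomials with property [red] contain the constants and the variables and are closed under
    sums and products, hence exhaust the ring. No degree is ever computed: what a remainder looks
    like enters only through [remM] and [remX]. *)
Lemma pseudo_division p : exists (e : nat) r g, rem r /\ a ^+ e * p = H * g + r.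
Proof.
have rem_exp k r : rem r -> rem (a ^+ k * r).
  by move=> hr; elim: k => [|k IH]; rewrite ?mul1r // exprS -mulrA; apply: rema.
have redD s t : red s -> red t -> red (s + t).
  move=> [e [r [g [hr eg]]]] [e' [r' [g' [hr' eg']]]].
  exists (e + e')%N, (a ^+ e' * r + a ^+ e * r'), (a ^+ e' * g + a ^+ e * g').
  split; first by apply: remD; apply: rem_exp.
  transitivity (a ^+ e' * (a ^+ e * s) + a ^+ e * (a ^+ e' * t)); last first.
    by rewrite eg eg'; ring.
  by rewrite exprD; ring.
have redM s t : red s -> red t -> red (s * t).
  move=> [e [r [g [hr eg]]]] [e' [r' [g' [hr' eg']]]].
  have [k [r2 [g2 [hr2 eg2]]]] := remM hr hr'.
  exists (k + (e + e'))%N, r2, (a ^+ k * (g * (H * g' + r') + r * g') + g2).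
  split=> //; transitivity (a ^+ k * ((a ^+ e * s) * (a ^+ e' * t))).
    by rewrite !exprD; ring.
  transitivity (a ^+ k * (r * r') + H * (a ^+ k * (g * (H * g' + r') + r * g'))).
    by rewrite eg eg'; ring.
  by rewrite eg2; ring.
have redC (c : F) : red c%:MP by exists 0%N, c%:MP, 0; split=> //; rewrite mulr0 add0r mul1r.
elim/mpolyind: p => [|c m p _ _ IH]; first by rewrite -mpolyC0; apply: redC.
apply: redD => //; rewrite -mul_mpolyC; apply: (redM) => //.
rewrite mpolyXE_id; apply: (big_ind red) => [|s t|i _]; first by rewrite -mpolyC1; apply: redC.
  exact: (redM).
elim: (m i) => [|k hk]; first by rewrite expr0 -mpolyC1; apply: redC.
by rewrite exprS; apply: (redM).
Qed.

End Remainders.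

Variable x : 'I_N.

Definition upd v (t : F) : 'I_N -> F := fun m => if m == x then t else v m.

(** Independence of the variable [x], phrased through values: closure under the ring operations is
    then immediate, and so is evaluation along a fibre of the projection that forgets [x]. *)
Definition free_of p : Prop := forall v t, p.@[upd v t] = p.@[v].

Lemma free_ofC (c : F) : free_of c%:MP.
Proof. by move=> v t; rewrite !mevalC. Qed.

Lemma free_ofX m : m != x -> free_of 'X_m.
Proof. by move=> mx v t; rewrite !mevalXU /upd (negPf mx). Qed.

Lemma free_ofD p q : free_of p -> free_of q -> free_of (p + q).
Proof. by move=> hp hq v t; rewrite !mevalD hp hq. Qed.

Lemma free_ofN p : free_of p -> free_of (- p).
Proof. by move=> hp v t; rewrite !mevalN hp. Qed.

Lemma free_ofM p q : free_of p -> free_of q -> free_of (p * q).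
Proof. by move=> hp hq v t; rewrite !mevalM hp hq. Qed.

Lemma mdvd_cancel_exp H a : (forall p, mdvd H (a * p) -> mdvd H p) ->
  forall e p, mdvd H (a ^+ e * p) -> mdvd H p.
Proof.
move=> h; elim=> [|e IH] p; first by rewrite mul1r.
by rewrite exprS -mulrA => /h /IH.
Qed.

Lemma vanishes_generic r g : g != 0 -> (forall v, g.@[v] != 0 -> r.@[v] = 0) -> r = 0.
Proof.
move=> g0 h; have : r * g = 0.
  apply: mpoly_fun0 => v; rewrite mevalM.
  by have [->|/h->] := eqVneq g.@[v] 0; rewrite ?mulr0 ?mul0r.
by move/eqP; rewrite mulf_eq0 (negPf g0) orbF => /eqP.
Qed.

Lemma linear_vanishes H a b g T :
  H = a * 'X_x + b -> free_of a -> free_of b -> g != 0 ->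
  (forall v, g.@[v] != 0 -> exists t, T (upd v t)) -> vanishes T H ->
  (forall p, mdvd H (a * p) -> mdvd H p) ->
  forall p, vanishes T p -> mdvd H p.
Proof.
move=> eH fa fb g0 gT TH Ha p Tp.
have [||c||m|e [r [h [fr er]]]] := @pseudo_division H a free_of _ _ _ _ _ p.
- exact: free_ofD.
- by move=> r; apply: free_ofM.
- exact: free_ofC.
- move=> r r' fr fr'; exists 0%N, (r * r'), 0; split; first exact: free_ofM.
  by rewrite mulr0 add0r mul1r.
- have [->|mx] := eqVneq m x; last first.
    by exists 0%N, 'X_m, 0; split; [apply: free_ofX|rewrite mulr0 add0r mul1r].
  by exists 1%N, (- b), 1; split; [apply: free_ofN|rewrite eH; ring].
have r0 : r = 0.
  apply: (vanishes_generic g0) => v /gT[t Tt]; rewrite -(fr v t).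
  have := congr1 (meval (upd v t)) er.
  by rewrite mevalM mevalD mevalM (Tp _ Tt) (TH _ Tt) mul0r mulr0 add0r => /esym.
by apply: (mdvd_cancel_exp Ha (e := e)); exists h; rewrite er r0 addr0.
Qed.

Lemma quadratic_vanishes H a b c g T :
  H = a * 'X_x ^+ 2 + b * 'X_x + c -> free_of a -> free_of b -> free_of c -> g != 0 ->
  (forall v, g.@[v] != 0 ->
     exists t t', [/\ t != t', T (upd v t) & T (upd v t')]) ->
  vanishes T H ->
  (forall p, mdvd H (a * p) -> mdvd H p) ->
  forall p, vanishes T p -> mdvd H p.
Proof.
move=> eH fa fb fc g0 gT TH Ha p Tp.
pose rem r := exists r0 r1, [/\ free_of r0, free_of r1 & r = r0 + r1 * 'X_x].
have f0 : free_of 0 by rewrite -mpolyC0; apply: free_ofC.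
have [||c'||m|e [r [h [[r0 [r1 [f0' f1' ->]]] er]]]] :=
  @pseudo_division H a rem _ _ _ _ _ p.
- move=> r r' [r0 [r1 [fr0 fr1 ->]]] [s0 [s1 [fs0 fs1 ->]]].
  exists (r0 + s0), (r1 + s1); split; [exact: free_ofD|exact: free_ofD|ring].
- move=> r [r0 [r1 [fr0 fr1 ->]]]; exists (a * r0), (a * r1).
  by split; [exact: free_ofM|exact: free_ofM|ring].
- by exists c'%:MP, 0; split; [exact: free_ofC| |rewrite mul0r addr0].
- move=> r r' [r0 [r1 [fr0 fr1 ->]]] [s0 [s1 [fs0 fs1 ->]]].
  (* One multiplication by [a] lets [a * 'X_x ^+ 2] be replaced by [H - b * 'X_x - c]; its
     coefficient [r1 * s1] becomes the quotient. *)
  exists 1%N, (a * (r0 * s0) - r1 * s1 * c + (a * (r0 * s1 + r1 * s0) - r1 * s1 * b) * 'X_x),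
    (r1 * s1); split; last by rewrite eH; ring.
  exists (a * (r0 * s0) - r1 * s1 * c), (a * (r0 * s1 + r1 * s0) - r1 * s1 * b).
  by split=> //; do !(apply: free_ofD || apply: free_ofN || apply: free_ofM).
- exists 0%N, 'X_m, 0; split; last by rewrite mulr0 add0r mul1r.
  have [->|mx] := eqVneq m x; last by exists 'X_m, 0; split=> //; [apply: free_ofX|ring].
  by exists 0, 1; split=> //; [rewrite -mpolyC1; apply: free_ofC|ring].
have r01 v : g.@[v] != 0 -> r0.@[v] = 0 /\ r1.@[v] = 0.
  move=> /gT[t [t' [tt' Tt Tt']]].
  have ev s : T (upd v s) -> r0.@[v] + r1.@[v] * s = 0.
    move=> Ts; have := congr1 (meval (upd v s)) er.
    rewrite mevalM mevalD mevalM (Tp _ Ts) (TH _ Ts) mul0r mulr0 add0r => /esym.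
    by rewrite mevalD mevalM mevalXU {3}/upd eqxx f0' f1'.
  have r10 : r1.@[v] = 0.
    have : r1.@[v] * (t - t') = 0.
      by rewrite mulrBr -[X in X - _](addKr r0.@[v]) -[X in _ - X](addKr r0.@[v]) !ev // subrr.
    by move/eqP; rewrite mulf_eq0 subr_eq0 (negPf tt') orbF => /eqP.
  by split=> //; have := ev _ Tt; rewrite r10 mul0r addr0.
have e0 : r0 = 0 by apply: (vanishes_generic g0) => v /r01[].
have e1 : r1 = 0 by apply: (vanishes_generic g0) => v /r01[].
by apply: (mdvd_cancel_exp Ha (e := e)); exists h; rewrite er e0 e1 mul0r !addr0.
Qed.

End Elimination.

(** * Hypersurfaces that are images of polynomial maps *)

Section ParametrizedHypersurface.
Variables (F : numFieldType) (N : nat) (I : Type) (phi : (I -> F) -> 'I_N -> F).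
Hypothesis phi_poly : forall m, line_poly (fun u => phi u m).

(** [G] records the open conditions (nonzero entries and critical coordinates) under which a
    parameter lands in [T]; such parameters are dense, so vanishing spreads to the whole image. *)
Lemma vanishes_param (G : (I -> F) -> F) (T : set ('I_N -> F)) p :
  line_poly G -> (exists u, G u != 0) -> (forall u, G u != 0 -> T (phi u)) ->
  vanishes T p -> vanishes (range phi) p.
Proof.
move=> G_poly G_nz GT Tp _ [u _ <-]; apply/eqP; apply: contraT => pu.
have [|w [pw Gw]] := line_poly_common (line_poly_meval p phi_poly) G_poly _ G_nz.
  by exists u.
by move: pw; rewrite Tp ?eqxx //; apply: GT.
Qed.

Lemma param_prime H : H != 0 -> vanishes (range phi) H ->
  (forall p, vanishes (range phi) p -> mdvd H p) -> prime_mpoly H.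
Proof.
move=> H0 RH hH; pose u0 : I -> F := fun=> 0.
have Hu0 : H.@[phi u0] = 0 by apply: RH; exists u0.
split=> //.
  apply/negP => /mpoly_unit_scalar[c c0 e]; case/eqP: c0.
  by rewrite -(mevalC (phi u0) c) -e.
move=> p q Hpq; apply: contrapT => /not_orP[np nq].
have nv r : ~ mdvd H r -> exists u, r.@[phi u] != 0.
  move=> nr; apply: contrapT => /forallNP h; apply: nr; apply: hH => _ [u _ <-].
  by apply/eqP; have /negP := h u; rewrite negbK.
have [u [pu qu]] := line_poly_common (line_poly_meval p phi_poly)
  (line_poly_meval q phi_poly) (nv _ np) (nv _ nq).
have : (p * q).@[phi u] = 0 by apply: (mdvd_meval Hpq); apply: RH; exists u.
by rewrite mevalM => /eqP; rewrite mulf_eq0 (negPf pu) (negPf qu).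
Qed.

End ParametrizedHypersurface.

(** * Prime minors *)

Section Overwrite.
Variables (N : nat) (T : Type).

(** For [vals] as long as [s], a position off [s] has index [size s], where [nth] falls back on the
    default [d m]. *)
Definition overwrite (s : seq 'I_N) (vals : seq T) (d : 'I_N -> T) : 'I_N -> T :=
  fun m => nth (d m) vals (index m s).

Lemma overwrite_nth s vals d x0 y0 i : uniq s -> size vals = size s ->
  (i < size s)%N -> overwrite s vals d (nth x0 s i) = nth y0 vals i.
Proof.
move=> us e i_s; rewrite /overwrite index_uniq //; apply: set_nth_default.
by rewrite e.
Qed.

Lemma overwrite_id s vals (d : 'I_N -> T) : size vals = size s ->
  (forall i x0 y0, (i < size s)%N -> nth y0 vals i = d (nth x0 s i)) ->
  overwrite s vals d = d.
Proof.
move=> e h; apply: funext => m; rewrite /overwrite.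
have [ms|nms] := boolP (m \in s).
  by rewrite (h _ m) ?index_mem // nth_index.
by rewrite nth_default // e memNindex.
Qed.

Lemma uniq_nth (x0 : 'I_N) s (r : seq nat) : uniq s -> uniq r ->
  all (fun i => (i < size s)%N) r -> uniq [seq nth x0 s i | i <- r].
Proof.
move=> us ur /allP r_s; rewrite map_inj_in_uniq // => i j ir jr /eqP.
by rewrite nth_uniq ?r_s // => /eqP.
Qed.

End Overwrite.

Ltac line_poly_tac :=
  repeat match goal with
  | |- line_poly (fun u => @?f u + @?g u) => apply: line_polyD
  | |- line_poly (fun u => - @?f u) => apply: line_polyN
  | |- line_poly (fun u => @?f u * @?g u) => apply: line_polyM
  | |- line_poly (fun u => u ?i) => apply: line_polyX
  | |- line_poly (fun u => ?c) => apply: line_polyC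
  end.

Ltac free_of_tac :=
  repeat match goal with
  | |- free_of _ (_ + _) => apply: free_ofD
  | |- free_of _ (- _) => apply: free_ofN
  | |- free_of _ (_ * _) => apply: free_ofM
  | |- free_of _ 'X__ => apply: free_ofX
  | |- free_of _ 1 => rewrite -mpolyC1; apply: free_ofC
  | |- free_of _ 0 => rewrite -mpolyC0; apply: free_ofC
  end.

Definition zeros (F : fieldType) N (H : {mpoly F[N]}) : set ('I_N -> F) :=
  [set w | H.@[w] = 0]%classic.

Definition det2 (R : pzRingType) (a b c d : R) : R := a * d - b * c.

Lemma rmorph_det2 (R S : pzRingType) (f : {rmorphism R -> S}) a b c d :
  f (det2 a b c d) = det2 (f a) (f b) (f c) (f d).
Proof. by rewrite /det2 rmorphB !rmorphM. Qed.

Section Det2.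
Variables (F : numFieldType) (N : nat).

Lemma nz_at (p : {mpoly F[N]}) v : p.@[v] != 0 -> p != 0.
Proof. by apply: contraNneq => ->; rewrite meval0. Qed.

Lemma not_mdvd_at (p q : {mpoly F[N]}) v : p.@[v] = 0 -> q.@[v] != 0 -> ~ mdvd p q.
Proof. by move=> pv qv /mdvd_meval/(_ pv)/eqP; apply/negP. Qed.

Lemma prime_variable (x : 'I_N) : prime_mpoly ('X_x : {mpoly F[N]}).
Proof.
pose phi (u : 'I_N -> F) := upd x u 0.
have phi_poly m : line_poly (fun u => phi u m).
  by rewrite /phi /upd; case: eqP => _; line_poly_tac.
apply: (@param_prime _ _ _ phi) => //.
- by apply: (@nz_at _ (fun=> 1)); rewrite mevalXU oner_eq0.
- by move=> _ [u _ <-]; rewrite mevalXU /phi /upd eqxx.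
apply: (@linear_vanishes _ _ x _ 1 0 1); rewrite ?mul1r ?addr0 ?oner_neq0 //.
- by free_of_tac.
- by free_of_tac.
- by move=> v _; exists 0; exists v.
- by move=> _ [u _ <-]; rewrite mevalXU /phi /upd eqxx.
- by move=> p; rewrite mul1r.
Qed.

Variables ia ib ic id : 'I_N.
Hypothesis us : uniq [:: ia; ib; ic; id].

Let s := [:: ia; ib; ic; id].
Let H : {mpoly F[N]} := det2 'X_ia 'X_ib 'X_ic 'X_id.
(** The 2 x 2 matrices whose second row is [l] times the first, with [l] stored at [None]. Among the
    singular matrices this misses only those whose first row alone is zero. *)
Let phi (u : option 'I_N -> F) : 'I_N -> F :=
  let l := u None in let a := u (Some ia) in let b := u (Some ib) in
  overwrite s [:: a; b; l * a; l * b] (fun m => u (Some m)).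

Let phiE u : [/\ phi u ia = u (Some ia), phi u ib = u (Some ib),
  phi u ic = u None * u (Some ia) & phi u id = u None * u (Some ib)].
Proof.
by split; [apply: (overwrite_nth _ ia 0 (i := 0))|apply: (overwrite_nth _ ia 0 (i := 1))
  |apply: (overwrite_nth _ ia 0 (i := 2))|apply: (overwrite_nth _ ia 0 (i := 3))].
Qed.

Let phi_poly m : line_poly (fun u => phi u m).
Proof.
rewrite /phi /overwrite; move: (index m s) => i.
by case: i => [|[|[|[|[|i]]]]] /=; line_poly_tac.
Qed.

Let HE v : H.@[v] = det2 (v ia) (v ib) (v ic) (v id).
Proof. by rewrite rmorph_det2 /= !mevalXU. Qed.

Let H_phi : vanishes (range phi) H.
Proof. by move=> _ [u _ <-]; rewrite HE; have [-> -> -> ->] := phiE u; rewrite /det2; ring. Qed.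

Let pt (vals : seq F) := overwrite s vals (fun=> 1).
Let ptE a b c d : let v := pt [:: a; b; c; d] in
  [/\ v ia = a, v ib = b, v ic = c & v id = d].
Proof.
by split; [apply: (overwrite_nth _ ia 0 (i := 0))|apply: (overwrite_nth _ ia 0 (i := 1))
  |apply: (overwrite_nth _ ia 0 (i := 2))|apply: (overwrite_nth _ ia 0 (i := 3))].
Qed.

Let id_distinct : [/\ ia != id, ib != id & ic != id].
Proof. by move: us; rewrite /= !inE !negb_or => /and4P[/and3P[_ _ ->] /andP[_ ->] ->]. Qed.

Let vanish_dvd p : vanishes (range phi) p -> mdvd H p.
Proof.
have [na nb nc] := id_distinct.
apply: (@linear_vanishes _ _ id _ 'X_ia (- ('X_ib * 'X_ic)) 'X_ia).
- by rewrite /H /det2; ring.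
- by free_of_tac.
- by free_of_tac.
- by apply: (@nz_at _ (fun=> 1)); rewrite mevalXU oner_eq0.
(* Where [a != 0], the equation [a d = b c] has one solution [d]; it lies in the image, with ratio
   [l = c / a]. *)
- move=> v; rewrite mevalXU => va; exists (v ib * v ic / v ia).
  exists (fun o => if o is Some m then upd id v (v ib * v ic / v ia) m else v ic / v ia) => //.
  rewrite /phi /=; set w := upd _ _ _.
  have [ea eb ec ed] : [/\ w ia = v ia, w ib = v ib, w ic = v ic &
      w id = v ib * v ic / v ia].
    by rewrite /w /upd (negPf na) (negPf nb) (negPf nc) eqxx.
  apply: overwrite_id => // i x0 y0.
  by do 4?[case: i => [_|i] /=]; rewrite ?ea ?eb ?ec ?ed //; field.
- exact: H_phi.
apply: cancel_prime; first exact: prime_variable.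
(* At [a = d = 0], [b = c = 1] the leading coefficient vanishes and [H] equals [-1]. *)
have [ea eb ec ed] := ptE 0 1 1 0.
apply: (@not_mdvd_at _ _ (pt [:: 0; 1; 1; 0])); rewrite ?mevalXU ?HE ?ea //.
by rewrite eb ec ed /det2 mul0r sub0r mulr1 oppr_eq0 oner_eq0.
Qed.

Lemma det2_prime : prime_mpoly H.
Proof.
apply: (@param_prime _ _ _ phi) => //.
apply: (@nz_at _ (pt [:: 1; 0; 0; 1])); rewrite HE; have [-> -> -> ->] := ptE 1 0 0 1.
  by rewrite /det2 mulr0 subr0 mulr1 oner_eq0.
Qed.

Lemma det2_vanishes p : vanishes (@torus F N `&` zeros H)%classic p -> mdvd H p.
Proof.
move=> Tp; apply: vanish_dvd.
apply: (vanishes_param phi_poly (G := fun u => \prod_m phi u m) _ _ _ Tp).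
- exact: line_poly_prod.
(* With all parameters 1, every entry is 1. *)
- exists (fun=> 1); apply/prodf_neq0 => m _; rewrite /phi /overwrite mulr1.
  by move: (index m s) => i; do 5?[case: i => [|i] /=]; rewrite ?mulr1 oner_eq0.
- move=> u /prodf_neq0 h; split; first by move=> m; apply: h.
  by apply: H_phi; exists u.
Qed.

End Det2.

(** * The 2 x 2 x 2 hyperdeterminant *)

Lemma quadratic_formula (F : numFieldType) (a b c r : F) : a != 0 ->
  r ^+ 2 = b ^+ 2 - 4%:R * a * c ->
  a * ((- b + r) / (2%:R * a)) ^+ 2 + b * ((- b + r) / (2%:R * a)) + c = 0.
Proof.
move=> a0 r2.
transitivity ((r ^+ 2 - (b ^+ 2 - 4%:R * a * c)) / (4%:R * a)); first by field.
by rewrite r2 subrr mul0r.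
Qed.

Lemma quadratic_roots (F : numClosedFieldType) (a b c : F) :
  a != 0 -> b ^+ 2 - 4%:R * a * c != 0 ->
  exists t t', [/\ t != t', a * t ^+ 2 + b * t + c = 0 &
                   a * t' ^+ 2 + b * t' + c = 0].
Proof.
move=> a0 D0; pose r := sqrtC (b ^+ 2 - 4%:R * a * c).
have r0 : r != 0 by rewrite sqrtC_eq0.
exists ((- b + r) / (2%:R * a)), ((- b - r) / (2%:R * a)).
split; try by apply: quadratic_formula; rewrite ?sqrrN ?sqrtCK.
have -> : (- b + r) / (2%:R * a) = (- b - r) / (2%:R * a) + r / a by field.
by rewrite eq_sym -subr_eq0 opprD addrA subrr sub0r oppr_eq0 mulf_neq0 ?invr_eq0.
Qed.

(* The tensor has slices [[a, b], [c, d]] and [[e, f], [g, h]]; this is the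
   discriminant of the determinant of the pencil they span. *)
Definition h222 (R : pzRingType) (a b c d e f g h : R) : R :=
  (a * h + d * e - b * g - c * f) ^+ 2 - 4%:R * det2 a b c d * det2 e f g h.

Lemma rmorph_h222 (R S : pzRingType) (u : {rmorphism R -> S}) a b c d e f g h :
  u (h222 a b c d e f g h) = h222 (u a) (u b) (u c) (u d) (u e) (u f) (u g) (u h).
Proof.
by rewrite /h222 rmorphB rmorphXn !rmorphB rmorphD !rmorphM !rmorph_det2 rmorph_nat.
Qed.

(* The coefficients of h222 as a quadratic polynomial in a are h ^+ 2 and these. *)
Definition h222_lin (R : pzRingType) (b c d e f g h : R) : R :=
  2%:R * h * (d * e - b * g - c * f) - 4%:R * d * det2 e f g h.
Definition h222_cst (R : pzRingType) (b c d e f g h : R) : R :=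
  (d * e - b * g - c * f) ^+ 2 + 4%:R * b * c * det2 e f g h.

Lemma rmorph_h222_lin (R S : pzRingType) (u : {rmorphism R -> S}) b c d e f g h :
  u (h222_lin b c d e f g h) = h222_lin (u b) (u c) (u d) (u e) (u f) (u g) (u h).
Proof.
by rewrite /h222_lin rmorphB !rmorphM rmorph_det2 !rmorphB !rmorphM !rmorph_nat.
Qed.

Lemma rmorph_h222_cst (R S : pzRingType) (u : {rmorphism R -> S}) b c d e f g h :
  u (h222_cst b c d e f g h) = h222_cst (u b) (u c) (u d) (u e) (u f) (u g) (u h).
Proof.
by rewrite /h222_cst rmorphD rmorphXn !rmorphM rmorph_det2 !rmorphB !rmorphM rmorph_nat.
Qed.

Lemma h222E (R : comPzRingType) (a b c d e f g h : R) :
  h222 a b c d e f g h = h ^+ 2 * a ^+ 2 + h222_lin b c d e f g h * a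
                         + h222_cst b c d e f g h.
Proof. by rewrite /h222 /h222_lin /h222_cst /det2; ring. Qed.

(** When [C != 0], the pencil determinant [A + B r + C r^2] has the double root [r = - B / (2 C)].
    The singular matrix found there has kernels spanned by [(1, s)] and [(1, t)], obtained by
    dividing by its entry [d + h r]. Up to the factor [-4 C] that entry is the derivative of [h222]
    in [a], which is the last hypothesis. *)
Lemma h222_singular_point (F : numFieldType) (a b c d e f g h : F) :
  h222 a b c d e f g h = 0 -> det2 e f g h != 0 ->
  2%:R * h ^+ 2 * a + h222_lin b c d e f g h != 0 ->
  exists s t r, [/\ a + b * t + e * r + f * t * r = 0, b + d * s + f * r + h * s * r = 0,
    c + d * t + g * r + h * t * r = 0 & e + f * t + g * s + h * s * t = 0].
Proof.
move=> H0 C0 D0.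
pose B := a * h + d * e - b * g - c * f; pose C := det2 e f g h.
have {}D0 : 2%:R * C * d - B * h != 0.
  apply: contraNneq D0 => D0; apply/eqP; transitivity (- 2%:R * (2%:R * C * d - B * h)).
    by rewrite /B /C /h222_lin /det2; ring.
  by rewrite D0 mulr0.
have C0' : e * h - f * g != 0 by [].
exists (- (2%:R * C * b - B * f) / (2%:R * C * d - B * h)),
  (- (2%:R * C * c - B * g) / (2%:R * C * d - B * h)), (- B / (2%:R * C)).
move: D0 C0'; rewrite /B /C /det2 => D0 C0'; split.
- transitivity (- h222 a b c d e f g h / (2%:R * (2%:R * C * d - B * h))).
    by rewrite /h222 /B /C /det2; field; rewrite ?D0 ?C0'.
  by rewrite H0 oppr0 mul0r.
- by field; rewrite ?D0 ?C0'.
- by field; rewrite ?D0 ?C0'.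
- transitivity (h * C * h222 a b c d e f g h / (2%:R * C * d - B * h) ^+ 2).
    by rewrite /h222 /B /C /det2; field; rewrite ?D0 ?C0'.
  by rewrite H0 mulr0 mul0r.
Qed.

(** Solving the equations for [a], [b], [c] and [e] turns the claim into a polynomial identity in
    the remaining letters. *)
Lemma h222_eq0_of_point (R : comPzRingType) (a b c d e f g h s t r : R) :
  a + b * t + e * r + f * t * r = 0 -> b + d * s + f * r + h * s * r = 0 ->
  c + d * t + g * r + h * t * r = 0 -> e + f * t + g * s + h * s * t = 0 ->
  h222 a b c d e f g h = 0.
Proof.
move=> ea eb ec ee.
have -> : a = - (b * t + e * r + f * t * r).
  by apply/eqP; rewrite -addr_eq0 -ea; apply/eqP; ring.
have -> : b = - (d * s + f * r + h * s * r).
  by apply/eqP; rewrite -addr_eq0 -eb; apply/eqP; ring.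
have -> : c = - (d * t + g * r + h * t * r).
  by apply/eqP; rewrite -addr_eq0 -ec; apply/eqP; ring.
have -> : e = - (f * t + g * s + h * s * t).
  by apply/eqP; rewrite -addr_eq0 -ee; apply/eqP; ring.
by rewrite /h222 /det2; ring.
Qed.

Section H222.
Variables (F : numClosedFieldType) (N : nat) (ia ib ic id ie jf ig ih : 'I_N).
Let s := [:: ia; ib; ic; id; ie; jf; ig; ih].
Hypothesis us : uniq s.

Let H : {mpoly F[N]} := h222 'X_ia 'X_ib 'X_ic 'X_id 'X_ie 'X_jf 'X_ig 'X_ih.

(** Critical points are normalized to [(1, s)], [(1, t)], [(1, r)]. Of the six partial derivatives
    four are listed; those in the first [y] and the first [z] coordinate follow by Euler's
    relation. *)
Definition singular222 : set ('I_N -> F) :=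
  [set w | torus w /\ exists s t r, [/\ s != 0, t != 0, r != 0 &
     [/\ w ia + w ib * t + w ie * r + w jf * t * r = 0,
         w ib + w id * s + w jf * r + w ih * s * r = 0,
         w ic + w id * t + w ig * r + w ih * t * r = 0 &
         w ie + w jf * t + w ig * s + w ih * s * t = 0]]]%classic.

(* The tensors critical at ((1, s), (1, t), (1, r)), solved for four entries. *)
Let phi (u : 'I_N + 'I_3 -> F) : 'I_N -> F :=
  let s_ := u (inr 0) in let t := u (inr 1) in let r := u (inr 2) in
  let d := u (inl id) in let f := u (inl jf) in
  let g := u (inl ig) in let h := u (inl ih) in
  let b := - (d * s_ + f * r + h * s_ * r) in
  let c := - (d * t + g * r + h * t * r) in
  let e := - (f * t + g * s_ + h * s_ * t) in
  overwrite s [:: - (b * t + e * r + f * t * r); b; c; d; e; f; g; h]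
    (fun m => u (inl m)).

Let phi_poly m : line_poly (fun u => phi u m).
Proof.
rewrite /phi /overwrite; move: (index m s) => i.
by case: i => [|[|[|[|[|[|[|[|[|i]]]]]]]]] /=; line_poly_tac.
Qed.

Let HE v : H.@[v] =
  h222 (v ia) (v ib) (v ic) (v id) (v ie) (v jf) (v ig) (v ih).
Proof. by rewrite rmorph_h222 /= !mevalXU. Qed.

Let ovE vals (d : 'I_N -> F) i : size vals = 8 -> (i < 8)%N ->
  overwrite s vals d (nth ia s i) = vals`_i.
Proof. by move=> e l; apply: overwrite_nth. Qed.

Let phi_eqs u : let w := phi u in let s_ := u (inr 0) in let t := u (inr 1) in
  let r := u (inr 2) in
  [/\ w ia + w ib * t + w ie * r + w jf * t * r = 0,
      w ib + w id * s_ + w jf * r + w ih * s_ * r = 0,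
      w ic + w id * t + w ig * r + w ih * t * r = 0 &
      w ie + w jf * t + w ig * s_ + w ih * s_ * t = 0].
Proof.
rewrite /= /phi; set vals := [:: _; _; _; _; _; _; _; _]; set d := fun _ => _.
rewrite (ovE d (vals := vals) (i := 0) erefl erefl)
 (ovE d (vals := vals) (i := 1) erefl erefl) (ovE d (vals := vals) (i := 2) erefl erefl)
 (ovE d (vals := vals) (i := 3) erefl erefl) (ovE d (vals := vals) (i := 4) erefl erefl)
 (ovE d (vals := vals) (i := 5) erefl erefl) (ovE d (vals := vals) (i := 6) erefl erefl)
 (ovE d (vals := vals) (i := 7) erefl erefl) /=.
by split; ring.
Qed.

Let range_phi w s_ t r : w ia + w ib * t + w ie * r + w jf * t * r = 0 ->
  w ib + w id * s_ + w jf * r + w ih * s_ * r = 0 ->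
  w ic + w id * t + w ig * r + w ih * t * r = 0 ->
  w ie + w jf * t + w ig * s_ + w ih * s_ * t = 0 -> range phi w.
Proof.
move=> ea eb ec ee.
exists (fun o : 'I_N + 'I_3 => match o with inl m => w m | inr i => nth 0 [:: s_; t; r] i end) => //.
apply: overwrite_id => // i x0 y0 /=.
have solve (x y : F) : x + y = 0 -> - y = x by move=> e; apply: (addIr y); rewrite e addNr.
have eb' : - (w id * s_ + w jf * r + w ih * s_ * r) = w ib.
  by apply: solve; rewrite -eb; ring.
have ec' : - (w id * t + w ig * r + w ih * t * r) = w ic.
  by apply: solve; rewrite -ec; ring.
have ee' : - (w jf * t + w ig * s_ + w ih * s_ * t) = w ie.
  by apply: solve; rewrite -ee; ring.
case: i => [|[|[|[|[|[|[|[|i]]]]]]]] //= _.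
by rewrite eb' ee'; apply: solve; rewrite -ea; ring.
Qed.

Let H_phi : vanishes (range phi) H.
Proof.
move=> _ [u _ <-]; rewrite HE; have [ea eb ec ee] := phi_eqs u.
exact: (h222_eq0_of_point ea eb ec ee).
Qed.

Let pt (vals : seq F) := overwrite s vals (fun=> 1).
Let ptE vals : size vals = 8 ->
  [/\ pt vals ia = vals`_0, pt vals ib = vals`_1, pt vals ic = vals`_2 &
      [/\ pt vals id = vals`_3, pt vals ie = vals`_4, pt vals jf = vals`_5,
          pt vals ig = vals`_6 & pt vals ih = vals`_7]].
Proof.
move=> e; split; [exact: (ovE (fun=> 1) (i := 0) e isT)|exact: (ovE (fun=> 1) (i := 1) e isT)|exact: (ovE (fun=> 1) (i := 2) e isT)|].
by split; [exact: (ovE (fun=> 1) (i := 3) e isT)|exact: (ovE (fun=> 1) (i := 4) e isT)|exact: (ovE (fun=> 1) (i := 5) e isT)|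
  exact: (ovE (fun=> 1) (i := 6) e isT)|exact: (ovE (fun=> 1) (i := 7) e isT)].
Qed.

Let neq_ia i : (0 < i < 8)%N -> nth ia s i != ia.
Proof.
by move=> /andP[i0 i8]; rewrite -[X in _ != X]/(nth ia s 0) nth_uniq // -lt0n.
Qed.

Let vanish_dvd p : vanishes (range phi) p -> mdvd H p.
Proof.
have nb : ib != ia := @neq_ia 1 isT.
have nc : ic != ia := @neq_ia 2 isT.
have nd : id != ia := @neq_ia 3 isT.
have ne : ie != ia := @neq_ia 4 isT.
have nf : jf != ia := @neq_ia 5 isT.
have ng : ig != ia := @neq_ia 6 isT.
have nh : ih != ia := @neq_ia 7 isT.
pose X i : {mpoly F[N]} := 'X_i.
pose C := det2 (X ie) (X jf) (X ig) (X ih).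
pose B := h222_lin (X ib) (X ic) (X id) (X ie) (X jf) (X ig) (X ih).
pose D := h222_cst (X ib) (X ic) (X id) (X ie) (X jf) (X ig) (X ih).
pose disc := B ^+ 2 - 4%:R * X ih ^+ 2 * D.
have CE v : C.@[v] = det2 (v ie) (v jf) (v ig) (v ih).
  by rewrite rmorph_det2 /= !mevalXU.
have BE v : B.@[v] = h222_lin (v ib) (v ic) (v id) (v ie) (v jf) (v ig) (v ih).
  by rewrite rmorph_h222_lin /= !mevalXU.
have DE v : D.@[v] = h222_cst (v ib) (v ic) (v id) (v ie) (v jf) (v ig) (v ih).
  by rewrite rmorph_h222_cst /= !mevalXU.
have discE v : disc.@[v] = B.@[v] ^+ 2 - 4%:R * v ih ^+ 2 * D.@[v].
  by rewrite mevalB rmorphXn /= !mevalM rmorph_nat /= !mevalXU.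
have updE := (negPf nb, negPf nc, negPf nd, negPf ne, negPf nf, negPf ng, negPf nh).
apply: (@quadratic_vanishes _ _ ia _ (X ih ^+ 2) B D (X ih * (C * disc))).
- exact: h222E.
- by move=> v t; rewrite !rmorphXn /= !mevalXU /upd updE.
- by move=> v t; rewrite !BE /upd !updE.
- by move=> v t; rewrite !DE /upd !updE.
(* Here [C = 1], [B = 0] and [D = 4], so [disc = -16]. *)
- apply: (@nz_at _ _ _ (pt [:: 1; 1; 1; 0; 1; 0; 0; 1])).
  have [|ea eb ec [ed ee ef eg eh]] := ptE (vals := [:: 1; 1; 1; 0; 1; 0; 0; 1]) => //.
  rewrite !mevalM mevalXU discE CE BE DE eb ec ed ee ef eg eh /=.
  rewrite (_ : _ * _ = - 16%:R) ?oppr_eq0 ?pnatr_eq0 //.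
  by rewrite /h222_lin /h222_cst /det2; ring.
- move=> v; rewrite !mevalM mevalXU !mulf_eq0 !negb_or discE => /and3P[h0 C0 disc0].
  have [t [t' [tt' et et']]] : exists t t', [/\ t != t',
      v ih ^+ 2 * t ^+ 2 + B.@[v] * t + D.@[v] = 0 &
      v ih ^+ 2 * t' ^+ 2 + B.@[v] * t' + D.@[v] = 0].
    by apply: quadratic_roots; rewrite ?expf_neq0.
  have mem y : v ih ^+ 2 * y ^+ 2 + B.@[v] * y + D.@[v] = 0 -> range phi (upd ia v y).
    move=> ey; set w := upd _ _ _.
    have [wa wb wc wd] : [/\ w ia = y, w ib = v ib, w ic = v ic & w id = v id].
      by rewrite /w /upd eqxx !updE.
    have [we wf wg wh] : [/\ w ie = v ie, w jf = v jf, w ig = v ig & w ih = v ih].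
      by rewrite /w /upd !updE.
    have [|||s_ [t0 [r [e1 e2 e3 e4]]]] := @h222_singular_point F (w ia) (w ib) (w ic)
        (w id) (w ie) (w jf) (w ig) (w ih).
    - by rewrite h222E wa wb wc wd we wf wg wh -BE -DE.
    - by rewrite we wf wg wh -CE.
    (* At a root [y] of the quadratic, the discriminant is the square of the derivative at [y]. *)
    - rewrite wa wb wc wd we wf wg wh -BE; apply: contraNneq disc0 => e.
      apply/eqP; transitivity ((2%:R * v ih ^+ 2 * y + B.@[v]) ^+ 2
                    - 4%:R * v ih ^+ 2 * (v ih ^+ 2 * y ^+ 2 + B.@[v] * y + D.@[v])).
        by ring.
      by rewrite e ey expr0n mulr0 subrr.
    exact: (range_phi e1 e2 e3 e4).
  by exists t, t'; split=> //; apply: mem.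
- exact: H_phi.
have Xh q : mdvd H (X ih * q) -> mdvd H q.
  apply: cancel_prime; first exact: prime_variable.
  (* With only [d = e = 1] nonzero, [h] vanishes while [H = (d e)^2 = 1]. *)
  have [|ea eb ec [ed ee ef eg eh]] := ptE (vals := [:: 0; 0; 0; 1; 1; 0; 0; 0]) => //.
  apply: (@not_mdvd_at _ _ _ _ (pt [:: 0; 0; 0; 1; 1; 0; 0; 0])).
    by rewrite mevalXU eh.
  rewrite HE ea eb ec ed ee ef eg eh (_ : h222 _ _ _ _ _ _ _ _ = 1) ?oner_eq0 //.
  by rewrite /h222 /det2 /=; ring.
by move=> q; rewrite expr2 -mulrA => /Xh/Xh.
Qed.

Lemma h222_prime : prime_mpoly H.
Proof.
apply: (param_prime phi_poly) => //.
apply: (@nz_at _ _ H (pt [:: 0; 0; 0; 1; 1; 0; 0; 0])); rewrite HE.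
have [|ea eb ec [ed ee ef eg eh]] := ptE (vals := [:: 0; 0; 0; 1; 1; 0; 0; 0]) => //.
rewrite ea eb ec ed ee ef eg eh (_ : h222 _ _ _ _ _ _ _ _ = 1) ?oner_eq0 // /h222 /det2 /=; ring.
Qed.

Lemma h222_vanishes p : vanishes singular222 p -> mdvd H p.
Proof.
move=> Tp; apply: vanish_dvd.
apply: (vanishes_param phi_poly
  (G := fun u => u (inr 0) * u (inr 1) * u (inr 2) * \prod_m phi u m) _ _ _ Tp).
- by apply: line_polyM; [line_poly_tac|exact: line_poly_prod].
(* With all parameters 1, the solved entries are [b = c = e = -3] and [a = 5], nonzero in
   characteristic zero. *)
- exists (fun=> 1); rewrite !mulr1 mul1r; apply/prodf_neq0 => m _.
  rewrite /phi /overwrite !mulr1; move: (index m s) => i.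
  have n3 : - (1 + 1 + 1) != 0 :> F.
    have -> : - (1 + 1 + 1) = - 3%:R :> F by ring.
    by rewrite oppr_eq0 pnatr_eq0.
  have n5 : - (- (1 + 1 + 1) + - (1 + 1 + 1) + 1) != 0 :> F.
    have -> : - (- (1 + 1 + 1) + - (1 + 1 + 1) + 1) = 5%:R :> F by ring.
    by rewrite pnatr_eq0.
  by case: i => [|[|[|[|[|[|[|[|[|i]]]]]]]]] /=; rewrite ?oner_eq0.
- move=> u; rewrite !mulf_eq0 !negb_or => /andP[/andP[/andP[s0 t0] r0] /prodf_neq0 h].
  split; first by move=> m; apply: h.
  by exists (u (inr 0)), (u (inr 1)), (u (inr 2)); split=> //; apply: phi_eqs.
Qed.

End H222.

(** * The 2 x 2 x 3 hyperdeterminant *)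

Lemma forall_I2 (P : 'I_2 -> Prop) : P 0 -> P 1 -> forall i, P i.
Proof.
move=> p0 p1 [[|[|i]] li] //.
  by rewrite (_ : Ordinal li = 0) //; apply: val_inj.
by rewrite (_ : Ordinal li = 1) //; apply: val_inj.
Qed.

Lemma sum_I2 (V : nmodType) (f : 'I_2 -> V) : \sum_i f i = f 0 + f 1.
Proof.
by rewrite !big_ord_recl big_ord0 addr0; congr (f _ + f _); apply: val_inj.
Qed.

Lemma forall_I3 (P : 'I_3 -> Prop) : P 0 -> P 1 -> P 2 -> forall k, P k.
Proof.
move=> p0 p1 p2 [[|[|[|k]]] lk] //.
- by rewrite (_ : Ordinal lk = 0) //; apply: val_inj.
- by rewrite (_ : Ordinal lk = 1) //; apply: val_inj.
- by rewrite (_ : Ordinal lk = 2) //; apply: val_inj.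
Qed.

Lemma sum_I3 (V : nmodType) (f : 'I_3 -> V) : \sum_k f k = f 0 + f 1 + f 2.
Proof.
rewrite !big_ord_recl big_ord0 addr0 addrA.
by congr (f _ + f _ + f _); apply: val_inj.
Qed.

Definition det3 (R : pzRingType) (u v w : 'I_3 -> R) : R :=
  u 0 * det2 (v 1) (v 2) (w 1) (w 2) - u 1 * det2 (v 0) (v 2) (w 0) (w 2)
  + u 2 * det2 (v 0) (v 1) (w 0) (w 1).

(* a, b, c, d are the rows (i, j) = (0, 0), (0, 1), (1, 0), (1, 1) of the 4 x 3
   flattening. Its signed maximal minors form a 2 x 2 matrix spanning its left
   kernel, and h223 is the determinant of that matrix. *)
Definition h223 (R : pzRingType) (a b c d : 'I_3 -> R) : R :=
  det3 a c d * det3 a b d - det3 b c d * det3 a b c.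

Lemma rmorph_det3 (R S : pzRingType) (f : {rmorphism R -> S}) u v w :
  f (det3 u v w) = det3 (f \o u) (f \o v) (f \o w).
Proof. by rewrite /det3 rmorphD rmorphB !rmorphM !rmorph_det2. Qed.

Lemma rmorph_h223 (R S : pzRingType) (f : {rmorphism R -> S}) a b c d :
  f (h223 a b c d) = h223 (f \o a) (f \o b) (f \o c) (f \o d).
Proof. by rewrite /h223 rmorphB !rmorphM !rmorph_det3. Qed.

Section H223Coefficients.
Variable R : comPzRingType.
Implicit Types a b c d v w : 'I_3 -> R.

(* det3 a v w = a 0 * det3_lin v w + det3_cst a v w, the last term not involving
   a 0, and h223 is likewise expanded as a quadratic polynomial in a 0. *)
Definition det3_lin v w : R := det2 (v 1) (v 2) (w 1) (w 2).
Definition det3_cst a v w : R :=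
  a 2 * det2 (v 0) (v 1) (w 0) (w 1) - a 1 * det2 (v 0) (v 2) (w 0) (w 2).

Definition h223_lead b c d : R := det3_lin c d * det3_lin b d.
Definition h223_lin a b c d : R :=
  det3_lin c d * det3_cst a b d + det3_lin b d * det3_cst a c d
  - det3 b c d * det3_lin b c.
Definition h223_cst a b c d : R :=
  det3_cst a c d * det3_cst a b d - det3 b c d * det3_cst a b c.

Lemma h223E a b c d :
  h223 a b c d = h223_lead b c d * a 0 ^+ 2 + h223_lin a b c d * a 0
                 + h223_cst a b c d.
Proof.
by rewrite /h223 /h223_lead /h223_lin /h223_cst /det3_lin /det3_cst /det3 /det2; ring.
Qed.

Lemma h223_eq0_of_point a b c d s t :
  (forall k, a k + b k * t + c k * s + d k * s * t = 0) -> h223 a b c d = 0.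
Proof.
move=> h; have ea k : a k = - (b k * t + c k * s + d k * s * t).
  by apply/eqP; rewrite -addr_eq0 -(h k); apply/eqP; ring.
by rewrite /h223 /det3 /det2 !ea; ring.
Qed.

End H223Coefficients.

(** The signed maximal minors form a left kernel vector of the flattening. Divided by its first
    entry [det3 b c d] it reads [(1, t, s, q)], and [h223 = 0] says exactly that [q = s t]. *)
Lemma h223_singular_point (F : fieldType) (a b c d : 'I_3 -> F) :
  h223 a b c d = 0 -> det3 b c d != 0 ->
  forall k, a k + b k * (- det3 a c d / det3 b c d) + c k * (det3 a b d / det3 b c d)
    + d k * (det3 a b d / det3 b c d) * (- det3 a c d / det3 b c d) = 0.
Proof.
move=> H0 P0 k.
have kernel : a k * det3 b c d - b k * det3 a c d + c k * det3 a b d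
    - d k * det3 a b c = 0.
  by elim/forall_I3: k; rewrite /det3 /det2; ring.
transitivity ((a k * det3 b c d - b k * det3 a c d + c k * det3 a b d
    - d k * det3 a b c) / det3 b c d - d k * h223 a b c d / det3 b c d ^+ 2).
  by rewrite /h223; field.
by rewrite kernel H0 mulr0 !mul0r subrr.
Qed.

Section H223Morphism.
Variables (R S : comPzRingType) (f : {rmorphism R -> S}).
Implicit Types a b c d v w : 'I_3 -> R.

Lemma rmorph_det3_cst a v w : f (det3_cst a v w) = det3_cst (f \o a) (f \o v) (f \o w).
Proof. by rewrite /det3_cst rmorphB !rmorphM !rmorph_det2. Qed.

Lemma rmorph_h223_lead b c d :
  f (h223_lead b c d) = h223_lead (f \o b) (f \o c) (f \o d).
Proof. by rewrite /h223_lead rmorphM !rmorph_det2. Qed.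

Lemma rmorph_h223_lin a b c d :
  f (h223_lin a b c d) = h223_lin (f \o a) (f \o b) (f \o c) (f \o d).
Proof.
by rewrite /h223_lin rmorphB rmorphD !rmorphM !rmorph_det3_cst rmorph_det3 !rmorph_det2.
Qed.

Lemma rmorph_h223_cst a b c d :
  f (h223_cst a b c d) = h223_cst (f \o a) (f \o b) (f \o c) (f \o d).
Proof. by rewrite /h223_cst rmorphB !rmorphM !rmorph_det3_cst rmorph_det3. Qed.

End H223Morphism.

Section H223.
Variables (F : numClosedFieldType) (N : nat) (ja jb jc jd : 'I_3 -> 'I_N).
Let sa := [:: ja 0; ja 1; ja 2].
Let s := sa ++ [:: jb 0; jb 1; jb 2; jc 0; jc 1; jc 2; jd 0; jd 1; jd 2].
Hypothesis us : uniq s.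

Let X (j : 'I_3 -> 'I_N) : 'I_3 -> {mpoly F[N]} := fun k => 'X_(j k).
Let H := h223 (X ja) (X jb) (X jc) (X jd).

(** The derivatives in the first [x] and the first [y] coordinate are left out: summing the
    equations for the [a k] against [z] expresses them through the two sums listed. *)
Definition singular223 : set ('I_N -> F) :=
  [set w | torus w /\ exists (s t : F) (z : 'I_3 -> F),
     [/\ s != 0, t != 0, forall k, z k != 0 &
     [/\ forall k, w (ja k) + w (jb k) * t + w (jc k) * s + w (jd k) * s * t = 0,
         \sum_k (w (jb k) + w (jd k) * s) * z k = 0 &
         \sum_k (w (jc k) + w (jd k) * t) * z k = 0]]]%classic.

(* The 2 x 2 slices orthogonal to (1, s) x (1, t), solved for the entries a k. A
   critical z then exists, generically the cross product below. *)
Let phi (u : 'I_N + 'I_2 -> F) : 'I_N -> F :=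
  let s_ := u (inr 0) in let t := u (inr 1) in
  let a k := - (u (inl (jb k)) * t + u (inl (jc k)) * s_ + u (inl (jd k)) * s_ * t) in
  overwrite sa [:: a 0; a 1; a 2] (fun m => u (inl m)).

Let phi_poly m : line_poly (fun u => phi u m).
Proof.
rewrite /phi /overwrite; move: (index m sa) => i.
by case: i => [|[|[|[|i]]]] /=; line_poly_tac.
Qed.

Let XE v j : meval v \o X j = v \o j.
Proof. by apply: funext => k; rewrite /= mevalXU. Qed.

Let HE v : H.@[v] = h223 (v \o ja) (v \o jb) (v \o jc) (v \o jd).
Proof. by rewrite rmorph_h223 /= !XE. Qed.

Let notin_sa k : [/\ jb k \notin sa, jc k \notin sa & jd k \notin sa].
Proof.
move: us; rewrite cat_uniq => /and3P[_ /hasPn h _].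
by elim/forall_I3: k; split; apply: h; rewrite !inE eqxx ?orbT.
Qed.

Let overwrite_notin vals (d : 'I_N -> F) m : size vals = 3 -> m \notin sa ->
  overwrite sa vals d m = d m.
Proof. by move=> e /memNindex im; rewrite /overwrite im nth_default // e. Qed.

Let phi_other u k : [/\ phi u (jb k) = u (inl (jb k)), phi u (jc k) = u (inl (jc k)) &
  phi u (jd k) = u (inl (jd k))].
Proof. by have [nb nc nd] := notin_sa k; rewrite /phi !overwrite_notin. Qed.

Let phi_eq u k : phi u (ja k) + phi u (jb k) * u (inr 1) + phi u (jc k) * u (inr 0)
  + phi u (jd k) * u (inr 0) * u (inr 1) = 0.
Proof.
have [-> -> ->] := phi_other u k.
have usa : uniq sa by move: us; rewrite cat_uniq => /and3P[].
suff -> : phi u (ja k) = - (u (inl (jb k)) * u (inr 1) + u (inl (jc k)) * u (inr 0)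
    + u (inl (jd k)) * u (inr 0) * u (inr 1)) by ring.
elim/forall_I3: k.
- exact: (overwrite_nth _ (ja 0) 0 (i := 0)).
- exact: (overwrite_nth _ (ja 0) 0 (i := 1)).
- exact: (overwrite_nth _ (ja 0) 0 (i := 2)).
Qed.

Let range_phi w s_ t :
  (forall k, w (ja k) + w (jb k) * t + w (jc k) * s_ + w (jd k) * s_ * t = 0) ->
  range phi w.
Proof.
move=> h.
exists (fun o : 'I_N + 'I_2 => match o with inl m => w m | inr i => nth 0 [:: s_; t] i end) => //.
have e k : - (w (jb k) * t + w (jc k) * s_ + w (jd k) * s_ * t) = w (ja k).
  by apply/eqP; rewrite eq_sym -addr_eq0 -(h k); apply/eqP; ring.
apply: overwrite_id => // i x0 y0 /=.
by case: i => [|[|[|i]]] //= _; rewrite e.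
Qed.

Let H_phi : vanishes (range phi) H.
Proof.
move=> _ [u _ <-]; rewrite HE.
exact: (h223_eq0_of_point (s := u (inr 0)) (t := u (inr 1)) (phi_eq u)).
Qed.

Let pt (a b c d : seq F) : 'I_N -> F :=
  overwrite s [:: a`_0; a`_1; a`_2; b`_0; b`_1; b`_2; c`_0; c`_1; c`_2;
                  d`_0; d`_1; d`_2] (fun=> 1).
Let ptE a b c d k : let v := pt a b c d in
  [/\ v (ja k) = a`_k, v (jb k) = b`_k, v (jc k) = c`_k & v (jd k) = d`_k].
Proof.
have ptE i : (i < 12)%N -> pt a b c d (nth (ja 0) s i) =
    [:: a`_0; a`_1; a`_2; b`_0; b`_1; b`_2; c`_0; c`_1; c`_2; d`_0; d`_1; d`_2]`_i.
  by move=> l; apply: overwrite_nth.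
elim/forall_I3: k; split.
- exact: (ptE 0).
- exact: (ptE 3).
- exact: (ptE 6).
- exact: (ptE 9).
- exact: (ptE 1).
- exact: (ptE 4).
- exact: (ptE 7).
- exact: (ptE 10).
- exact: (ptE 2).
- exact: (ptE 5).
- exact: (ptE 8).
- exact: (ptE 11).
Qed.

Let neq_ja0 : [/\ ja 1 != ja 0, ja 2 != ja 0 &
  forall k, [/\ jb k != ja 0, jc k != ja 0 & jd k != ja 0]].
Proof.
have [n1 n2] : ja 1 != ja 0 /\ ja 2 != ja 0.
  move: us; rewrite /= !inE !negb_or => /andP[/andP[h1 /andP[h2 _]] _].
  by rewrite eq_sym h1 eq_sym h2.
split=> // k; have [] := notin_sa k; rewrite !inE !negb_or.
by move=> /andP[-> _] /andP[-> _] /andP[-> _].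
Qed.

(** With [b = c] the value is the square of [det3 a b d], here [-1]. Both minors in [h223_lead]
    vanish, since [b] and [c] are zero in columns 1 and 2. So one point shows that [H] is nonzero
    and that neither minor divides it. *)
Let H_pt : H.@[pt [:: 0; 1; 0] [:: 1; 0; 0] [:: 1; 0; 0] [:: 0; 0; 1]] = 1.
Proof.
rewrite HE.
have vE := ptE [:: 0; 1; 0] [:: 1; 0; 0] [:: 1; 0; 0] [:: 0; 0; 1].
have [a0 b0 c0 d0] := vE 0; have [a1 b1 c1 d1] := vE 1; have [a2 b2 c2 d2] := vE 2.
rewrite /h223 /det3 /det2 /= a0 b0 c0 d0 a1 b1 c1 d1 a2 b2 c2 d2 /=; ring.
Qed.

Let cancel_minor j p : uniq [:: j 1; j 2; jd 1; jd 2] -> (j = jb \/ j = jc) ->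
  mdvd H (det2 (X j 1) (X j 2) (X jd 1) (X jd 2) * p) -> mdvd H p.
Proof.
move=> uj jE; apply: cancel_prime; first exact: det2_prime.
apply: (@not_mdvd_at _ _ _ _ (pt [:: 0; 1; 0] [:: 1; 0; 0] [:: 1; 0; 0] [:: 0; 0; 1])).
  have vE := ptE [:: 0; 1; 0] [:: 1; 0; 0] [:: 1; 0; 0] [:: 0; 0; 1].
  have [_ b1 c1 d1] := vE 1; have [_ b2 c2 d2] := vE 2.
  rewrite rmorph_det2 /= !mevalXU /det2.
  by case: jE => ->; [rewrite b1 b2 d1 d2|rewrite c1 c2 d1 d2]; rewrite /= !mul0r subrr.
by rewrite H_pt oner_eq0.
Qed.

Let vanish_dvd p : vanishes (range phi) p -> mdvd H p.
Proof.
have [na1 na2 nk] := neq_ja0.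
have [nb0 nc0 nd0] := nk 0; have [nb1 nc1 nd1] := nk 1; have [nb2 nc2 nd2] := nk 2.
have updE := (negPf na1, negPf na2, (negPf nb0, negPf nb1, negPf nb2),
  (negPf nc0, negPf nc1, negPf nc2), (negPf nd0, negPf nd1, negPf nd2)).
pose P := det3 (X jb) (X jc) (X jd).
pose A := h223_lead (X jb) (X jc) (X jd).
pose B := h223_lin (X ja) (X jb) (X jc) (X jd).
pose C := h223_cst (X ja) (X jb) (X jc) (X jd).
pose disc := B ^+ 2 - 4%:R * A * C.
have PE v : P.@[v] = det3 (v \o jb) (v \o jc) (v \o jd) by rewrite rmorph_det3 /= !XE.
have AE v : A.@[v] = h223_lead (v \o jb) (v \o jc) (v \o jd).
  by rewrite rmorph_h223_lead /= !XE.
have BE v : B.@[v] = h223_lin (v \o ja) (v \o jb) (v \o jc) (v \o jd).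
  by rewrite rmorph_h223_lin /= !XE.
have CE v : C.@[v] = h223_cst (v \o ja) (v \o jb) (v \o jc) (v \o jd).
  by rewrite rmorph_h223_cst /= !XE.
have discE v : disc.@[v] = B.@[v] ^+ 2 - 4%:R * A.@[v] * C.@[v].
  by rewrite mevalB rmorphXn /= 2!mevalM rmorph_nat.
have fP : free_of (ja 0) P.
  by move=> v t; rewrite !PE /det3 /= /upd !updE.
have fA : free_of (ja 0) A.
  by move=> v t; rewrite !AE /h223_lead /det3_lin /= /upd !updE.
have fB : free_of (ja 0) B.
  by move=> v t; rewrite !BE /h223_lin /det3_lin /det3_cst /det3 /= /upd !updE.
have fC : free_of (ja 0) C.
  by move=> v t; rewrite !CE /h223_cst /det3_cst /det3 /= /upd !updE.
apply: (@quadratic_vanishes _ _ (ja 0) _ A B C (P * (A * disc))) => //.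
- exact: h223E.
(* Here [P = A = 1], [B = 0] and [C = -1], so [disc = 4]. *)
- apply: (@nz_at _ _ _ (pt [:: 0; 0; 1] [:: 1; 1; 0] [:: 0; 1; 0] [:: 0; 0; 1])).
  have vE := ptE [:: 0; 0; 1] [:: 1; 1; 0] [:: 0; 1; 0] [:: 0; 0; 1].
  have [a0 b0 c0 d0] := vE 0; have [a1 b1 c1 d1] := vE 1; have [a2 b2 c2 d2] := vE 2.
  rewrite 2!mevalM discE PE !AE BE CE /h223_lead /h223_lin /h223_cst /det3_lin /det3_cst.
  rewrite /det3 /det2 /= b0 c0 d0 a1 b1 c1 d1 a2 b2 c2 d2 /=.
  set e := (X in X != 0); have -> : e = 4%:R by rewrite /e; ring.
  by rewrite pnatr_eq0.
- move=> v; rewrite 2!mevalM !mulf_eq0 !negb_or discE => /and3P[P0 A0 disc0].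
  have [t [t' [tt' et et']]] := quadratic_roots A0 disc0.
  have mem y : A.@[v] * y ^+ 2 + B.@[v] * y + C.@[v] = 0 -> range phi (upd (ja 0) v y).
    move=> ey; set w := upd _ _ _.
    have wa : w (ja 0) = y by rewrite /w /upd eqxx.
    apply: range_phi (h223_singular_point (a := w \o ja) (b := w \o jb) (c := w \o jc)
      (d := w \o jd) _ _).
      by rewrite h223E -AE -BE -CE fA fB fC /= wa.
    by rewrite -PE fP.
  by exists t, t'; split=> //; apply: mem.
- move=> q; rewrite /A /h223_lead -mulrA.
  have un r := @uniq_nth _ (ja 0) s r us.
  move=> h; apply: (cancel_minor (j := jb)); [|by left|].
    (* In [s] the rows [ja], [jb], [jc], [jd] occupy positions 0 to 2, 3 to 5, 6 to 8 and 9 to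
       11. *)
    exact: (un [:: 4; 5; 10; 11]).
  apply: (cancel_minor (j := jc)) h; last by right.
  exact: (un [:: 7; 8; 10; 11]).
Qed.

Lemma h223_prime : prime_mpoly H.
Proof.
apply: (param_prime phi_poly) => //.
by apply: (@nz_at _ _ _ (pt [:: 0; 1; 0] [:: 1; 0; 0] [:: 1; 0; 0] [:: 0; 0; 1])); rewrite H_pt oner_eq0.
Qed.

Let cross (u : 'I_N + 'I_2 -> F) : 'I_3 -> F :=
  let P k := u (inl (jb k)) + u (inl (jd k)) * u (inr 0) in
  let Q k := u (inl (jc k)) + u (inl (jd k)) * u (inr 1) in
  nth 0 [:: P 1 * Q 2 - P 2 * Q 1; P 2 * Q 0 - P 0 * Q 2; P 0 * Q 1 - P 1 * Q 0].

Lemma h223_vanishes p : vanishes singular223 p -> mdvd H p.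
Proof.
move=> Tp; apply: vanish_dvd.
apply: (vanishes_param phi_poly
  (G := fun u => u (inr 0) * u (inr 1) * \prod_k cross u k * \prod_m phi u m) _ _ _ Tp).
- apply: line_polyM; last exact: line_poly_prod.
  apply: line_polyM; first by line_poly_tac.
  by apply: line_poly_prod; apply: forall_I3; rewrite /cross /=; line_poly_tac.
(* Chosen so that at [s = t = 1] the vectors [b + d = (-2, -2, 4)] and [c + d = (-2, 2, 0)] have
   cross product [(-8, -8, -8)], while the entries solved for are 1, 1 and -1. *)
- pose v := pt [:: 1; 1; 1] [:: 1; - 3%:R; 1] [:: 1; 1; - 3%:R] [:: - 3%:R; 1; 3%:R].
  have vE := ptE [:: 1; 1; 1] [:: 1; - 3%:R; 1] [:: 1; 1; - 3%:R] [:: - 3%:R; 1; 3%:R].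
  have [_ b0 c0 d0] := vE 0; have [_ b1 c1 d1] := vE 1; have [_ b2 c2 d2] := vE 2.
  have v_nz m : v m != 0.
    rewrite /v /pt /overwrite; move: (index m s) => i.
    by case: i => [|[|[|[|[|[|[|[|[|[|[|[|[|i]]]]]]]]]]]]] /=;
      rewrite ?oppr_eq0 ?oner_eq0 ?pnatr_eq0.
  exists (fun o => if o is inl m then v m else 1).
  rewrite !mulf_neq0 ?oner_eq0 //; apply/prodf_neq0.
    have n8 : - 8%:R != 0 :> F by rewrite oppr_eq0 pnatr_eq0.
    move=> k _; suff -> : cross (fun o => if o is inl m then v m else 1) k = - 8%:R by [].
    by elim/forall_I3: k; rewrite /cross /= /v ?b0 ?c0 ?d0 ?b1 ?c1 ?d1 ?b2 ?c2 ?d2 /=; ring.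
  move=> m _; rewrite /phi /overwrite; move: (index m sa) => i.
  case: i => [|[|[|[|i]]]] //=;
    rewrite /v ?b0 ?c0 ?d0 ?b1 ?c1 ?d1 ?b2 ?c2 ?d2 /=; set e := (X in X != 0).
  + by have -> : e = 1 by [rewrite /e; ring]; rewrite ?oppr_eq0 oner_eq0.
  + by have -> : e = 1 by [rewrite /e; ring]; rewrite ?oppr_eq0 oner_eq0.
  + by have -> : e = - 1 by [rewrite /e; ring]; rewrite ?oppr_eq0 oner_eq0.
- move=> u; rewrite !mulf_eq0 !negb_or => /andP[/andP[/andP[s0 t0]]].
  move=> /prodf_neq0 z0 /prodf_neq0 h.
  split; first by move=> m; apply: h.
  exists (u (inr 0)), (u (inr 1)), (cross u); split=> //; first by move=> k; apply: z0.
  have [eb0 ec0 ed0] := phi_other u 0; have [eb1 ec1 ed1] := phi_other u 1.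
  have [eb2 ec2 ed2] := phi_other u 2.
  split; first exact: phi_eq.
    by rewrite sum_I3 eb0 ed0 eb1 ed1 eb2 ed2 /cross /=; ring.
  by rewrite sum_I3 ec0 ed0 ec1 ed1 ec2 ed2 /cross /=; ring.
Qed.

End H223.

(** * Codimension and discriminants *)

Section Codimension.
Variables (F : numFieldType) (N : nat).
Implicit Types (p q H : {mpoly F[N]}) (Y Z S : set ('I_N -> F)).

Lemma zclosure_torus Y : (zclosure Y `<=` @torus F N)%classic.
Proof. by move=> w []. Qed.

Lemma sub_zclosure Y : (Y `<=` @torus F N)%classic -> (Y `<=` zclosure Y)%classic.
Proof. by move=> Yt w Yw; split=> [|p]; [exact: Yt|exact]. Qed.

Lemma vanishes_zclosure Y p : vanishes Y p -> vanishes (zclosure Y) p.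
Proof. by move=> Yp w [_]; apply. Qed.

Lemma zclosure_closed Y : zclosed (zclosure Y).
Proof.
apply/seteqP; split=> [w [tw h]|]; last exact/sub_zclosure/zclosure_torus.
by split=> // p Yp; apply: h; apply: vanishes_zclosure.
Qed.

Lemma zclosed_zeros Z p : zclosed Z -> zclosed (Z `&` zeros p)%classic.
Proof.
move=> cZ; apply/seteqP; split=> [w [tw h]|]; last first.
  by apply: sub_zclosure => w []; rewrite -cZ => /zclosure_torus.
split; last by apply: h => v [].
by rewrite -cZ; split=> // q Zq; apply: h => v [Zv _]; apply: Zq.
Qed.

Lemma zclosed_separate Z w : zclosed Z -> torus w -> ~ Z w ->
  exists2 p, vanishes Z p & p.@[w] != 0.
Proof.
move=> cZ tw nZw; apply: contrapT => h; apply: nZw; rewrite -cZ; split=> // p Zp.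
by apply/eqP; apply: contraT => pw; case: h; exists p.
Qed.

Lemma zirreducible_vanishes Z p q : zirreducible Z -> vanishes Z (p * q) ->
  vanishes Z p \/ vanishes Z q.
Proof.
move=> [cZ _ iZ] Zpq.
have [||| ->|->] := iZ (Z `&` zeros p)%classic (Z `&` zeros q)%classic.
- exact: zclosed_zeros.
- exact: zclosed_zeros.
- apply/seteqP; split=> w; last by case=> -[].
  move=> Zw; have /eqP := Zpq w Zw; rewrite mevalM mulf_eq0.
  by case/orP=> /eqP; [left|right].
- by left=> w [].
- by right=> w [].
Qed.

(** Each of two proper closed pieces is cut out by a polynomial that does not vanish on [S]; if they
    covered the closure, the product would vanish on [S]. *)
Lemma zirreducible_zclosure S : (S `<=` @torus F N)%classic -> (exists w, S w) ->
  (forall p q, vanishes S (p * q) -> vanishes S p \/ vanishes S q) ->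
  zirreducible (zclosure S).
Proof.
move=> St [w0 Sw0] irr; split; first exact: zclosure_closed.
  by exists w0; apply: sub_zclosure.
move=> Z1 Z2 cZ1 cZ2 e; apply: contrapT => /not_orP[n1 n2].
have sep Z' : zclosed Z' -> (Z' `<=` zclosure S)%classic -> zclosure S <> Z' ->
    exists2 p, vanishes Z' p & ~ vanishes S p.
  move=> cZ' sub ne; have [w [Sw nw]] : exists w, zclosure S w /\ ~ Z' w.
    apply: contrapT => /forallNP h; apply: ne; apply/seteqP; split=> // w Sw.
    by apply: contrapT => nw; apply: (h w).
  have [p Zp pw] := zclosed_separate cZ' (zclosure_torus Sw) nw.
  by exists p => // Sp; case/eqP: pw; apply: vanishes_zclosure Sw.
have [||p1 Zp1 Sp1] := sep Z1 cZ1 => //; first by rewrite e => w; left.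
have [||p2 Zp2 Sp2] := sep Z2 cZ2 => //; first by rewrite e => w; right.
have [w Sw|//|//] := irr p1 p2.
have : zclosure S w by apply: sub_zclosure.
by rewrite e mevalM => -[/Zp1|/Zp2] ->; rewrite ?mul0r ?mulr0.
Qed.

Lemma vanishes_torus p : vanishes (@torus F N) p -> p = 0.
Proof.
move=> tp; apply: (@vanishes_generic _ _ _ (\prod_m 'X_m)).
  apply: (@nz_at _ _ _ (fun=> 1)); rewrite rmorph_prod /=.
  by apply/prodf_neq0 => m _; rewrite mevalXU oner_eq0.
move=> v; rewrite rmorph_prod /= => /prodf_neq0 h; apply: tp => m.
by have := h m isT; rewrite mevalXU.
Qed.

Lemma zirreducible_torus : zirreducible (@torus F N).
Proof.
have e : zclosure (@torus F N) = @torus F N.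
  by apply/seteqP; split; [exact: zclosure_torus|exact: sub_zclosure].
rewrite -e; apply: zirreducible_zclosure => //.
  by exists (fun=> 1) => m; rewrite oner_eq0.
move=> p q /vanishes_torus/eqP; rewrite mulf_eq0.
by case/orP=> /eqP->; [left|right] => w _; rewrite meval0.
Qed.

Lemma torus_not_vanishes p : p != 0 -> exists w, torus w /\ p.@[w] != 0.
Proof.
move=> p0; apply: contrapT => /forallNP h; case/eqP: p0; apply: vanishes_torus => w tw.
by apply/eqP; apply: contraT => pw; case: (h w).
Qed.

Lemma zchain1_torus Z p : zirreducible Z -> vanishes Z p -> p != 0 -> zchain Z 1.
Proof.
move=> iZ Zp p0; exists (fun i => if i is 0%N then Z else @torus F N); split=> //.
  by case=> [|i] _ //; apply: zirreducible_torus.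
case=> // _; split.
  by case: iZ => <- _ _; apply: zclosure_torus.
move=> sub; have [w [tw /eqP]] := torus_not_vanishes p0; apply; apply: Zp; exact: sub.
Qed.

(* S is Zariski dense in the hypersurface H = 0 of the torus. *)
Definition dense_zeros S H : Prop :=
  [/\ (S `<=` @torus F N)%classic, vanishes S H & forall p, vanishes S p -> mdvd H p].

Lemma dense_zeros_irreducible S H : prime_mpoly H -> dense_zeros S H ->
  zirreducible (zclosure S).
Proof.
move=> [H0 HU Hp] [St SH SHp]; apply: zirreducible_zclosure => //.
  apply: contrapT => /forallNP h; case/negP: HU; apply/unitrP.
  have [g e] : mdvd H 1 by apply: SHp => w /h.
  by exists g; rewrite {1}mulrC -e.
have vd p : mdvd H p -> vanishes S p by move=> d w Sw; apply: (mdvd_meval d); apply: SH.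
by move=> p q /SHp/Hp[]/vd; [left|right].
Qed.

(* Krull's height one bound for the prime ideal (H): an irreducible set
   containing {H = 0} lies on a hypersurface, whose equation of least degree can
   only be H. *)
Lemma zirreducible_above S H W : prime_mpoly H -> dense_zeros S H ->
  zirreducible W -> (zclosure S `<=` W)%classic -> (W `<` @torus F N)%classic ->
  (W `<=` zclosure S)%classic.
Proof.
move=> [H0 HU Hp] [St SH SHp] iW SW [Wt tW].
have [p Wp p0] : exists2 p, vanishes W p & p != 0.
  have [w [tw nw]] : exists w, torus w /\ ~ W w.
    by apply: contrapT => /forallNP h; apply: tW => w tw; apply: contrapT => nw; apply: (h w).
  have [cW _ _] := iW; have [p Wp pw] := zclosed_separate cW tw nw.
  by exists p => //; apply: contraNneq pw => ->; rewrite meval0.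
have WH : vanishes W H.
  have [n] := ubnP (msize p); elim: n p Wp p0 => // n IH p Wp p0 pn.
  have [g e] : mdvd H p by apply: SHp => w Sw; apply: Wp; apply: SW; apply: sub_zclosure.
  have g0 : g != 0 by apply: contraNneq p0 => g0; rewrite e g0 mulr0.
  have [//|Wg] : vanishes W H \/ vanishes W g.
    by apply: zirreducible_vanishes; rewrite -?e.
  apply: (IH g) => //; rewrite ltnS in pn; apply: leq_trans pn; rewrite e msizeM //.
  have : (1 < msize H)%N.
    rewrite ltnNge; apply: contra HU => /msize1_polyC eH.
    rewrite eH; apply/unitrP; exists (H@_0%MM)^-1%:MP.
    have c0 : H@_0%MM != 0 by apply: contraNneq H0 => c0; rewrite eH c0 mpolyC0.
    by rewrite -!mpolyCM mulVf // mulfV.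
  by case: (msize H) => [|[|m]] // _; rewrite !addSn /= ltnS leq_addl.
move=> w Ww; split; first exact: Wt.
by move=> q /SHp d; apply: (mdvd_meval d); apply: WH.
Qed.

(** A chain of length two would have a term strictly between the closure and the torus, against
    [zirreducible_above]. *)
Lemma zcodim_dense_zeros S H : prime_mpoly H -> dense_zeros S H -> zcodim (zclosure S) 1.
Proof.
move=> pH dS; have [H0 _ _] := pH; have [St SH _] := dS.
have iS := dense_zeros_irreducible pH dS.
split.
  exists (zclosure S); split=> //; split.
    by apply: (zchain1_torus iS _ H0); apply: vanishes_zclosure.
  move=> c [W [W0 iW Wlt]]; rewrite leqNgt; apply/negP => c1.
  have [W01 nW01] := Wlt 0%N (ltnW c1); have [W12 nW12] := Wlt 1%N c1.
  rewrite W0 in W01 nW01; apply: nW01.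
  apply: (zirreducible_above pH dS) => //; first by apply: iW; apply: ltnW.
  have W2t : (W 2 `<=` @torus F N)%classic.
    by have [<- _ _] := iW 2 c1; apply: zclosure_torus.
  split; first exact: subset_trans W12 W2t.
  by move=> tW1; apply: nW12; apply: subset_trans tW1.
move=> Z c iZ ZS [_ hc]; apply: hc; apply: (zchain1_torus iZ _ H0) => w /ZS.
exact: (vanishes_zclosure SH).
Qed.

(** An irreducible [Z] inside the closure of [Y] lies in that of [S], and properly, because [q]
    vanishes on [Z] but not on [S]. Then [Z], the closure of [S] and the torus form a chain of
    length two. *)
Lemma not_zcodim1 S H Y q : prime_mpoly H -> dense_zeros S H -> vanishes Y H ->
  vanishes Y q -> ~ mdvd H q -> ~ zcodim (zclosure Y) 1.
Proof.
move=> pH dS YH Yq nHq [[Z [iZ ZY [_ hc]]] _].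
have [H0 _ _] := pH; have [St SH SHp] := dS.
suff /hc : zchain Z 2 by [].
have iS := dense_zeros_irreducible pH dS.
have [W [W0 iW Wlt]] := zchain1_torus iS (vanishes_zclosure SH) H0.
exists (fun i => if i is j.+1 then W j else Z); split=> //.
  by case=> [|i] // i1; apply: iW.
case=> [|i] i1; last exact: Wlt.
rewrite W0; split.
  move=> w /ZY[tw h]; split=> // p /SHp d; apply: h => v Yv.
  by apply: (mdvd_meval d); apply: YH.
move=> sub; apply: nHq; apply: SHp => w Sw; apply: (vanishes_zclosure Yq).
by apply: ZY; apply: sub; apply: sub_zclosure.
Qed.

End Codimension.

(** * Discriminants read off from the critical set *)

Section Discriminants.
Variables (F : numFieldType) (d N : nat) (A : 'M[int]_(d, N)).

Lemma nabla0_torus : (nabla0 F A `<=` @torus F N)%classic.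
Proof. by move=> w []. Qed.

Lemma Adisc_hypersurface (H : {mpoly F[N]}) : prime_mpoly H -> vanishes (nabla0 F A) H ->
  (forall p, vanishes (nabla0 F A) p -> mdvd H p) ->
  exists2 c : F, c != 0 & Adisc F A = c *: H.
Proof.
move=> pH AH AHp; have dS : dense_zeros (nabla0 F A) H by split=> //; apply: nabla0_torus.
have codim1 := zcodim_dense_zeros pH dS.
rewrite /Adisc; case: asboolP => // _; case: xgetP => [D _ [iD nD]|none].
  have [_ HU _] := pH; apply: mdvd_irreducible => //; apply: AHp => w Aw; apply: nD.
  exact: (sub_zclosure nabla0_torus).
case: (none H); split; first exact: prime_irreducible.
exact: vanishes_zclosure.
Qed.

(** Here the critical set is not dense in [H = 0], so a separate [S] has to supply the hypersurface
    against which its codimension is measured. *)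
Lemma Adisc_thin (S : set ('I_N -> F)) (H q : {mpoly F[N]}) : prime_mpoly H ->
  dense_zeros S H -> vanishes (nabla0 F A) H -> vanishes (nabla0 F A) q ->
  ~ mdvd H q -> Adisc F A = 1.
Proof.
move=> pH dS AH Aq nHq; rewrite /Adisc; case: asboolP => // h.
by case: (not_zcodim1 pH dS AH Aq nHq).
Qed.

(** The constant 1 vanishes on the empty set, so the closure is empty and contains no irreducible
    set. *)
Lemma Adisc_empty : (forall w, ~ nabla0 F A w) -> Adisc F A = 1.
Proof.
move=> h; rewrite /Adisc; case: asboolP => // -[[Z [[_ [w Zw] _] ZA _]] _].
have [_ /(_ 1)] := ZA w Zw; rewrite meval1 => e.
by have /eqP := e (fun v Av => False_ind _ (h v Av)); rewrite oner_eq0.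
Qed.

End Discriminants.

(** * Singular tensors *)

Section RankOne.
Variable F : fieldType.
Implicit Types a b c d : F.

Lemma det2_kernel a b c d : det2 a b c d = 0 ->
  exists x y, [/\ (x != 0) || (y != 0), a * x + b * y = 0 & c * x + d * y = 0].
Proof.
rewrite /det2 => D0; have [a0|a0] := eqVneq a 0; last first.
  exists b, (- a); split; [by rewrite oppr_eq0 a0 orbT|ring|].
  by rewrite -oppr0 -D0; ring.
have [b0|b0] := eqVneq b 0; last first.
  exists b, (- a); split; [by rewrite b0|ring|].
  by rewrite -oppr0 -D0; ring.
have [d0|d0] := eqVneq d 0; last first.
  by exists d, (- c); split; [rewrite d0|rewrite a0 b0; ring|ring].
have [c0|c0] := eqVneq c 0; last first.
  by exists d, (- c); split; [rewrite oppr_eq0 c0 orbT|rewrite a0 b0; ring|ring].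
by exists 1, 0; split; [rewrite oner_eq0|rewrite a0 b0; ring|rewrite c0 d0; ring].
Qed.

(** Take for [x] and [y] the column and the row through a nonzero entry; that entry is the factor
    [k]. The final equations keep the proportionality of rows and columns in a form free of
    division. *)
Lemma rank_one a b c d : det2 a b c d = 0 ->
  [|| a != 0, b != 0, c != 0 | d != 0] ->
  exists k x0 x1 y0 y1,
    [/\ (x0 != 0) || (x1 != 0), (y0 != 0) || (y1 != 0),
      [/\ x0 * y0 = k * a, x0 * y1 = k * b, x1 * y0 = k * c & x1 * y1 = k * d],
      d * x0 = b * x1 /\ c * x0 = a * x1 & d * y0 = c * y1 /\ b * y0 = a * y1].
Proof.
move=> /eqP; rewrite subr_eq0 => /eqP e /or4P[] h.
- exists a, a, c, a, b; rewrite h; split=> //; split; rewrite -?e; ring: e.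
- exists b, b, d, a, b; rewrite h ?orbT; split=> //; split; ring: e.
- exists c, a, c, c, d; rewrite h ?orbT; split=> //; split; ring: e.
- exists d, b, d, c, d; rewrite h ?orbT; split=> //; split; ring: e.
Qed.

Lemma det_mx33 (V : 'M[F]_3) : \det V = det3 (V 0) (V 1) (V 2).
Proof.
pose v m n := V (inord m) (inord n).
have VE i j : V i j = v (val i) (val j) by rewrite /v !inord_val.
rewrite (expand_det_row _ 0) sum_I3 /cofactor !(expand_det_row _ 0) !big_ord_recl !big_ord0.
rewrite /cofactor !det_mx11 !mxE /det3 /det2 !VE /= /bump /=.
ring.
Qed.

End RankOne.

Section LeftKernel.
Variable F : numClosedFieldType.
Implicit Types a b c d u v w : 'I_3 -> F.

Lemma det3_swap12 u v w : det3 v u w = - det3 u v w.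
Proof. by rewrite /det3 /det2; ring. Qed.

Lemma det3_swap23 u v w : det3 u w v = - det3 u v w.
Proof. by rewrite /det3 /det2; ring. Qed.

Lemma det3_dup12 u w : det3 u u w = 0.
Proof. by rewrite /det3 /det2; ring. Qed.

Lemma det3_dup23 u w : det3 w u u = 0.
Proof. by rewrite /det3 /det2; ring. Qed.

Lemma det3_dup13 u w : det3 u w u = 0.
Proof. by rewrite /det3 /det2; ring. Qed.

(** Full rank would provide three independent rows; their determinant either repeats a row or is, up
    to sign, one of the four minors. *)
Lemma minors_eq0_rank a b c d :
  det3 b c d = 0 -> det3 a c d = 0 -> det3 a b d = 0 -> det3 a b c = 0 ->
  (\rank (\matrix_(i < 4, k < 3) nth (fun=> 0%R) [:: a; b; c; d] i k) < 3)%N.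
Proof.
move=> ea eb ec ed; set W := matrix_of_fun _ _; rewrite ltn_neqAle rank_leq_col andbT.
apply/negP => fW; pose f := fullrankfun fW.
have : rowsub f W \in unitmx by rewrite -row_full_unit; apply: fullrowsub_full.
rewrite unitmxE det_mx33 unitfE => /eqP; apply.
have rowE i : rowsub f W i = nth (fun=> 0%R) [:: a; b; c; d] (f i).
  by apply: funext => k; rewrite !mxE.
rewrite !rowE; move: (f 0) (f 1) (f 2).
have zero u v w : det3 u v w = 0 ->
    [/\ det3 u w v = 0, det3 v u w = 0, det3 w v u = 0, det3 v w u = 0 & det3 w u v = 0].
  move=> e; split.
  - by rewrite det3_swap23 e oppr0.
  - by rewrite det3_swap12 e oppr0.
  - by rewrite det3_swap12 det3_swap23 det3_swap12 e !oppr0.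
  - by rewrite det3_swap23 det3_swap12 e !oppr0.
  - by rewrite det3_swap12 det3_swap23 e !oppr0.
have [? ? ? ? ?] := zero _ _ _ ea; have [? ? ? ? ?] := zero _ _ _ eb.
have [? ? ? ? ?] := zero _ _ _ ec; have [? ? ? ? ?] := zero _ _ _ ed.
move=> [[|[|[|[|i]]]] ?] [[|[|[|[|j]]]] ?] [[|[|[|[|k]]]] ?] //=;
  by rewrite ?det3_dup12 ?det3_dup13 ?det3_dup23.
Qed.

(** If some maximal minor is nonzero, the signed minors are the required vector, and [h223] is its
    determinant. If all vanish, [h223 = 0] carries no information and the rank drop has to provide
    the vector. *)
Lemma left_kernel_rank_one a b c d : h223 a b c d = 0 ->
  exists p q r s, [/\ det2 p q r s = 0, [|| p != 0, q != 0, r != 0 | s != 0] &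
    forall k, p * a k + q * b k + r * c k + s * d k = 0].
Proof.
move=> H0.
have [|] := boolP [|| det3 b c d != 0, - det3 a c d != 0, det3 a b d != 0 |
                      - det3 a b c != 0].
  exists (det3 b c d), (- det3 a c d), (det3 a b d), (- det3 a b c); split=> //.
    by rewrite -H0 /det2 /h223; ring.
  by elim/forall_I3; rewrite /det3 /det2; ring.
rewrite !oppr_eq0 !negb_or !negbK => /and4P[/eqP ea /eqP eb /eqP ec /eqP ed].
have := minors_eq0_rank ea eb ec ed; set W := matrix_of_fun _ _ => rW.
have rK : (1 < \rank (kermx W))%N by rewrite mxrank_ker ltn_subRL addnC.
have sum4 (g : 'I_4 -> F) : \sum_i g i = g 0 + g 1 + g 2 + g 3.
  rewrite !big_ord_recl big_ord0 addr0 !addrA.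
  by congr (g _ + g _ + g _ + g _); apply: val_inj.
have kerE (u : 'rV[F]_4) : (u <= kermx W)%MS -> forall k,
    u 0 0 * a k + u 0 1 * b k + u 0 2 * c k + u 0 3 * d k = 0.
  move=> /sub_kermxP/matrixP uW k; have := uW 0 k.
  by rewrite !mxE sum4 !mxE.
have ext (u : 'rV[F]_4) : u != 0 -> [|| u 0 0 != 0, u 0 1 != 0, u 0 2 != 0 | u 0 3 != 0].
  apply: contraNT; rewrite !negb_or !negbK => /and4P[/eqP u0 /eqP u1 /eqP u2 /eqP u3].
  apply/eqP/rowP; case=> [[|[|[|[|i]]]] li] //; rewrite mxE.
  - by rewrite -[RHS]u0; congr (u _ _); apply: val_inj.
  - by rewrite -[RHS]u1; congr (u _ _); apply: val_inj.
  - by rewrite -[RHS]u2; congr (u _ _); apply: val_inj.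
  - by rewrite -[RHS]u3; congr (u _ _); apply: val_inj.
have witness (u : 'rV[F]_4) : (u <= kermx W)%MS -> u != 0 ->
    det2 (u 0 0) (u 0 1) (u 0 2) (u 0 3) = 0 ->
    exists p q r s, [/\ det2 p q r s = 0, [|| p != 0, q != 0, r != 0 | s != 0] &
      forall k, p * a k + q * b k + r * c k + s * d k = 0].
  move=> uK u0 Du; exists (u 0 0), (u 0 1), (u 0 2), (u 0 3).
  by split=> //; [exact: ext|exact: kerE].
(* The left kernel is at least two-dimensional, so it meets the quadric of
   singular 2 x 2 matrices. *)
have [u uK u0] : exists2 u : 'rV[F]_4, (u <= kermx W)%MS & u != 0.
  by apply/rowV0Pn; rewrite -mxrank_eq0 -lt0n ltnW.
have [|Du] := eqVneq (det2 (u 0 0) (u 0 1) (u 0 2) (u 0 3)) 0; first exact: witness.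
have [v vK vu] : exists2 v : 'rV[F]_4, (v <= kermx W)%MS & ~~ (v <= u)%MS.
  have /row_subPn[i ni] : ~~ (kermx W <= u)%MS.
    apply: contraL rK => /mxrankS; rewrite -leqNgt => h; apply: leq_trans h _.
    exact: rank_leq_row.
  by exists (row i (kermx W)) => //; apply: row_sub.
(* [B] is the polar form of [det2]: on [t *: u + v] the determinant is [det2(u) t^2 + B t + C],
   which has a root. As [v] is not a multiple of [u], the combination is nonzero. *)
pose B := u 0 0 * v 0 3 + v 0 0 * u 0 3 - u 0 1 * v 0 2 - v 0 1 * u 0 2.
pose C := det2 (v 0 0) (v 0 1) (v 0 2) (v 0 3).
have := quadratic_formula Du (sqrtCK (B ^+ 2 - 4%:R * det2 (u 0 0) (u 0 1) (u 0 2) (u 0 3) * C)).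
set t := _ / _ => et; apply: (witness (t *: u + v)).
- by rewrite addmx_sub // scalemx_sub.
- apply: contraNneq vu => e; rewrite (_ : v = (- t) *: u) ?scalemx_sub //.
  by apply/eqP; rewrite scaleNr -addr_eq0 addrC e.
- by rewrite -et !mxE /B /C /det2; ring.
Qed.

End LeftKernel.

Section Singular222.
Variable F : numClosedFieldType.

Definition critical222 (a b c d e f g h x0 x1 y0 y1 z0 z1 : F) : Prop :=
  [/\ a * y0 * z0 + e * y0 * z1 + (b * y1 * z0 + f * y1 * z1) = 0 /\
      c * y0 * z0 + g * y0 * z1 + (d * y1 * z0 + h * y1 * z1) = 0,
      a * x0 * z0 + e * x0 * z1 + (c * x1 * z0 + g * x1 * z1) = 0 /\
      b * x0 * z0 + f * x0 * z1 + (d * x1 * z0 + h * x1 * z1) = 0 &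
      a * x0 * y0 + b * x0 * y1 + (c * x1 * y0 + d * x1 * y1) = 0 /\
      e * x0 * y0 + f * x0 * y1 + (g * x1 * y0 + h * x1 * y1) = 0].

(** If the first coordinates are nonzero, dividing by them normalizes the point. The other cases
    reduce to this one by exchanging the two slices in a direction, which leaves [h222]
    unchanged. *)
Lemma h222_eq0_of_critical a b c d e f g h x0 x1 y0 y1 z0 z1 :
  critical222 a b c d e f g h x0 x1 y0 y1 z0 z1 ->
  (x0 != 0) || (x1 != 0) -> (y0 != 0) || (y1 != 0) -> (z0 != 0) || (z1 != 0) ->
  h222 a b c d e f g h = 0.
Proof.
have pivot a' b' c' d' e' f' g' h' x y z x' y' z' :
    critical222 a' b' c' d' e' f' g' h' x x' y y' z z' ->
    x != 0 -> y != 0 -> z != 0 -> h222 a' b' c' d' e' f' g' h' = 0.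
  move=> [[e1 e2] [e3 e4] [e5 e6]] x_nz y_nz z_nz.
  apply: (h222_eq0_of_point (s := x' / x) (t := y' / y) (r := z' / z)).
  - by apply: (mulfI (mulf_neq0 y_nz z_nz)); rewrite mulr0 -e1; field; rewrite y_nz z_nz.
  - by apply: (mulfI (mulf_neq0 x_nz z_nz)); rewrite mulr0 -e4; field; rewrite x_nz z_nz.
  - by apply: (mulfI (mulf_neq0 y_nz z_nz)); rewrite mulr0 -e2; field; rewrite y_nz z_nz.
  - by apply: (mulfI (mulf_neq0 x_nz y_nz)); rewrite mulr0 -e6; field; rewrite x_nz y_nz.
have pivot_z a' b' c' d' e' f' g' h' x y z x' y' z' :
    critical222 a' b' c' d' e' f' g' h' x x' y y' z z' ->
    x != 0 -> y != 0 -> (z != 0) || (z' != 0) -> h222 a' b' c' d' e' f' g' h' = 0.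
  move=> cr x_nz y_nz /orP[]; first exact: (pivot _ _ _ _ _ _ _ _ _ _ _ _ _ _ cr).
  rewrite (_ : h222 _ _ _ _ _ _ _ _ = h222 e' f' g' h' a' b' c' d'); last first.
    by rewrite /h222 /det2; ring.
  apply: (pivot e' f' g' h' a' b' c' d' x y z' x' y' z) => //.
  case: cr => [[e1 e2] [e3 e4] [e5 e6]].
  by split; split=> //; [rewrite -e1|rewrite -e2|rewrite -e3|rewrite -e4]; ring.
have pivot_yz a' b' c' d' e' f' g' h' x y z x' y' z' :
    critical222 a' b' c' d' e' f' g' h' x x' y y' z z' ->
    x != 0 -> (y != 0) || (y' != 0) -> (z != 0) || (z' != 0) ->
    h222 a' b' c' d' e' f' g' h' = 0.
  move=> cr x_nz /orP[]; first by move=> y_nz; exact: (pivot_z _ _ _ _ _ _ _ _ _ _ _ _ _ _ cr).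
  rewrite (_ : h222 _ _ _ _ _ _ _ _ = h222 b' a' d' c' f' e' h' g'); last first.
    by rewrite /h222 /det2; ring.
  apply: (pivot_z b' a' d' c' f' e' h' g' x y' z x' y z') => //.
  case: cr => [[e1 e2] [e3 e4] [e5 e6]].
  by split; split=> //; [rewrite -e1|rewrite -e2|rewrite -e5|rewrite -e6]; ring.
move=> cr /orP[]; first by move=> x_nz; exact: (pivot_yz _ _ _ _ _ _ _ _ _ _ _ _ _ _ cr).
rewrite (_ : h222 _ _ _ _ _ _ _ _ = h222 c d a b g h e f); last first.
  by rewrite /h222 /det2; ring.
apply: (pivot_yz c d a b g h e f x1 y0 z0 x0 y1 z1) => //.
case: cr => [[e1 e2] [e3 e4] [e5 e6]].
by split; split=> //; [rewrite -e3|rewrite -e4|rewrite -e5|rewrite -e6]; ring.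
Qed.

(** [z] spans a kernel of the symmetric matrix [[[2 A, B], [B, 2 C]]], which makes sense even for a
    zero pencil determinant. The slice combination [[[p, q], [r, s]]] at [z] is singular: if
    nonzero, its kernels are [x] and [y]; if zero, the two slices are proportional. *)
Lemma critical222_of_h222_eq0 a b c d e f g h : h222 a b c d e f g h = 0 ->
  exists x0 x1 y0 y1 z0 z1,
    [/\ (x0 != 0) || (x1 != 0), (y0 != 0) || (y1 != 0), (z0 != 0) || (z1 != 0) &
        critical222 a b c d e f g h x0 x1 y0 y1 z0 z1].
Proof.
move=> H0.
pose B := a * h + d * e - b * g - c * f; pose A := det2 a b c d; pose C := det2 e f g h.
have BE : B ^+ 2 - 4%:R * A * C = 0 by [].
(* A double root of the pencil. *)
have [z0 [z1 [nz k1 k2]]] : exists z0 z1, [/\ (z0 != 0) || (z1 != 0),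
    2%:R * A * z0 + B * z1 = 0 & B * z0 + 2%:R * C * z1 = 0].
  have [|] := boolP ((2%:R * C != 0) || (- B != 0)) => [nz|].
    exists (2%:R * C), (- B); split=> //; last by ring.
    by rewrite -oppr0 -BE; ring.
  rewrite negb_or !negbK oppr_eq0 => /andP[/eqP C0 /eqP B0].
  by exists 0, 1; split; [rewrite oner_eq0 orbT|rewrite B0; ring|rewrite C0 B0; ring].
pose p := a * z0 + e * z1; pose q := b * z0 + f * z1.
pose r := c * z0 + g * z1; pose s := d * z0 + h * z1.
(* At a double root both partial derivatives of the pencil determinant vanish: the cofactor matrix
   of [[[p, q], [r, s]]] is orthogonal to each slice. That matrix is proportional to the product of
   [x] and [y]. *)
have adj1 : s * a - r * b - q * c + p * d = 0.
  by rewrite -k1 /A /B /p /q /r /s /det2; ring.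
have adj2 : s * e - r * f - q * g + p * h = 0.
  by rewrite -k2 /C /B /p /q /r /s /det2; ring.
have D0 : det2 s (- r) (- q) p = 0.
  suff : 2%:R * det2 s (- r) (- q) p = 0.
    by move/eqP; rewrite mulf_eq0 pnatr_eq0 => /eqP.
  transitivity (z0 * (2%:R * A * z0 + B * z1) + z1 * (B * z0 + 2%:R * C * z1)).
    by rewrite /A /B /C /p /q /r /s /det2; ring.
  by rewrite k1 k2 !mulr0 addr0.
have [M_nz|] := boolP [|| s != 0, - r != 0, - q != 0 | p != 0].
  have [k [x0 [x1 [y0 [y1 [nx ny [e00 e01 e10 e11] [u1 u2] [v1 v2]]]]]]] := rank_one D0 M_nz.
  exists x0, x1, y0, y1, z0, z1; split=> //; split; split.
  - transitivity (p * y0 - (- q) * y1); first by rewrite /p /q; ring.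
    by rewrite v1 subrr.
  - transitivity (s * y1 - (- r) * y0); first by rewrite /r /s; ring.
    by rewrite v2 subrr.
  - transitivity (p * x0 - (- r) * x1); first by rewrite /p /r; ring.
    by rewrite u1 subrr.
  - transitivity (s * x1 - (- q) * x0); first by rewrite /q /s; ring.
    by rewrite u2 subrr.
  - transitivity (a * (x0 * y0) + b * (x0 * y1) + c * (x1 * y0) + d * (x1 * y1)).
      by ring.
    rewrite e00 e01 e10 e11; transitivity (k * (s * a - r * b - q * c + p * d)).
      by ring.
    by rewrite adj1 mulr0.
  - transitivity (e * (x0 * y0) + f * (x0 * y1) + g * (x1 * y0) + h * (x1 * y1)).
      by ring.
    rewrite e00 e01 e10 e11; transitivity (k * (s * e - r * f - q * g + p * h)).
      by ring.
    by rewrite adj2 mulr0.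
rewrite !negb_or !negbK !oppr_eq0 => /and4P[/eqP s0 /eqP r0 /eqP q0 /eqP p0].
(* The combination at [z] is zero, so the first rows of the two slices share a kernel vector [y],
   and [x = (1, 0)] completes it. *)
have [|y0 [y1 [ny w1 w2]]] := @det2_kernel _ a b e f.
  case/orP: nz => nz; apply: (mulfI nz); rewrite mulr0.
    transitivity (p * f - q * e); first by rewrite /p /q /det2; ring.
    by rewrite p0 q0; ring.
  transitivity (q * a - p * b); first by rewrite /p /q /det2; ring.
  by rewrite p0 q0; ring.
exists 1, 0, y0, y1, z0, z1; rewrite oner_eq0; split=> //; split; split.
- by transitivity (p * y0 + q * y1); [rewrite /p /q; ring|rewrite p0 q0; ring].
- by transitivity (r * y0 + s * y1); [rewrite /r /s; ring|rewrite r0 s0; ring].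
- by transitivity p; [rewrite /p; ring|].
- by transitivity q; [rewrite /q; ring|].
- by transitivity (a * y0 + b * y1); [ring|].
- by transitivity (e * y0 + f * y1); [ring|].
Qed.

End Singular222.

Section Singular223.
Variable F : numClosedFieldType.
Implicit Types a b c d : 'I_3 -> F.

(** Again normalized by a nonzero pivot; each exchange of slices now changes the sign of [h223]. *)
Lemma h223_eq0_of_critical a b c d x0 x1 y0 y1 :
  (forall k, a k * x0 * y0 + b k * x0 * y1 + (c k * x1 * y0 + d k * x1 * y1) = 0) ->
  (x0 != 0) || (x1 != 0) -> (y0 != 0) || (y1 != 0) -> h223 a b c d = 0.
Proof.
have pivot a' b' c' d' x y x' y' :
    (forall k, a' k * x * y + b' k * x * y' + (c' k * x' * y + d' k * x' * y') = 0) ->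
    x != 0 -> y != 0 -> h223 a' b' c' d' = 0.
  move=> e x_nz y_nz; apply: (h223_eq0_of_point (s := x' / x) (t := y' / y)) => k.
  by apply: (mulfI (mulf_neq0 x_nz y_nz)); rewrite mulr0 -(e k); field; rewrite x_nz y_nz.
have pivot_y a' b' c' d' x y x' y' :
    (forall k, a' k * x * y + b' k * x * y' + (c' k * x' * y + d' k * x' * y') = 0) ->
    x != 0 -> (y != 0) || (y' != 0) -> h223 a' b' c' d' = 0.
  move=> e x_nz /orP[]; first exact: (pivot _ _ _ _ _ _ _ _ e).
  move=> y_nz; apply: oppr_inj; rewrite oppr0; transitivity (h223 b' a' d' c').
    by rewrite /h223 /det3 /det2; ring.
  by apply: (pivot b' a' d' c' x y' x' y) => // k; rewrite -(e k); ring.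
move=> e /orP[]; first by move=> x_nz; exact: (pivot_y _ _ _ _ _ _ _ _ e).
move=> x_nz y_nz; apply: oppr_inj; rewrite oppr0; transitivity (h223 c d a b).
  by rewrite /h223 /det3 /det2; ring.
by apply: (pivot_y c d a b x1 y0 x0 y1) => // k; rewrite -(e k); ring.
Qed.

Lemma two_forms_common_zero (P Q : 'I_3 -> F) : exists z : 'I_3 -> F,
  [/\ exists k, z k != 0, \sum_k P k * z k = 0 & \sum_k Q k * z k = 0].
Proof.
pose M := \matrix_(k < 3, i < 2) [:: P k; Q k]`_i.
have /rowV0Pn[z /sub_kermxP/matrixP zM z0] : kermx M != 0.
  by rewrite -mxrank_eq0 mxrank_ker subn_eq0 -ltnNge ltnS rank_leq_col.
exists (fun k => z 0 k); split.
- apply: contrapT => /forallNP h; case/eqP: z0; apply/rowP => k; rewrite mxE.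
  by apply/eqP; have /negP := h k; rewrite negbK.
- by have := zM 0 0; rewrite !mxE => e; rewrite -[RHS]e; apply: eq_bigr => k _; rewrite !mxE mulrC.
- by have := zM 0 1; rewrite !mxE => e; rewrite -[RHS]e; apply: eq_bigr => k _; rewrite !mxE mulrC.
Qed.

(** The relation passes to the two sums; the sum assumed zero is the one that leaves the other
    multiplied by a nonzero coefficient. *)
Lemma common_zero_of_relation (u v : 'I_3 -> F) x0 x1 (z : 'I_3 -> F) :
  (forall k, u k * x0 + v k * x1 = 0) -> \sum_k (if x0 == 0 then u k else v k) * z k = 0 ->
  (x0 != 0) || (x1 != 0) ->
  \sum_k u k * z k = 0 /\ \sum_k v k * z k = 0.
Proof.
move=> rel; have sum_rel : (\sum_k u k * z k) * x0 + (\sum_k v k * z k) * x1 = 0.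
  rewrite !mulr_suml -big_split big1 // => k _ /=.
  by transitivity ((u k * x0 + v k * x1) * z k); [ring|rewrite rel mul0r].
have [x00 e /= x10|x00 e _] := eqVneq x0 0; split=> //.
  by move/eqP: sum_rel; rewrite e mul0r add0r mulf_eq0 (negPf x10) orbF => /eqP.
by move/eqP: sum_rel; rewrite e mul0r addr0 mulf_eq0 (negPf x00) orbF => /eqP.
Qed.

(** A rank one kernel vector yields [x] and [y]. The four derivatives in [x] and [y] then impose
    only two independent conditions on the three coordinates of [z], one for each factor. *)
Lemma critical223_of_h223_eq0 a b c d : h223 a b c d = 0 ->
  exists x0 x1 y0 y1 (z : 'I_3 -> F),
    [/\ (x0 != 0) || (x1 != 0), (y0 != 0) || (y1 != 0), exists k, z k != 0 &
    [/\ forall k, a k * x0 * y0 + b k * x0 * y1 + (c k * x1 * y0 + d k * x1 * y1) = 0,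
        \sum_k (a k * y0 + b k * y1) * z k = 0 /\
        \sum_k (c k * y0 + d k * y1) * z k = 0 &
        \sum_k (a k * x0 + c k * x1) * z k = 0 /\
        \sum_k (b k * x0 + d k * x1) * z k = 0]].
Proof.
move=> /left_kernel_rank_one[p [q [r [s [D0 nz ker]]]]].
have [k [x0 [x1 [y0 [y1 [nx ny [e00 e01 e10 e11] _ _]]]]]] := rank_one D0 nz.
have tang l : a l * x0 * y0 + b l * x0 * y1 + (c l * x1 * y0 + d l * x1 * y1) = 0.
  transitivity (a l * (x0 * y0) + b l * (x0 * y1) + c l * (x1 * y0) + d l * (x1 * y1)).
    by ring.
  rewrite e00 e01 e10 e11.
  by transitivity (k * (p * a l + q * b l + r * c l + s * d l)); [ring|rewrite ker mulr0].
have [z [z0 zP zQ]] := two_forms_common_zero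
  (fun l => if x0 == 0 then a l * y0 + b l * y1 else c l * y0 + d l * y1)
  (fun l => if y0 == 0 then a l * x0 + c l * x1 else b l * x0 + d l * x1).
exists x0, x1, y0, y1, z; split=> //; split=> //.
- by apply: (common_zero_of_relation _ zP nx) => l; rewrite -(tang l); ring.
- by apply: (common_zero_of_relation _ zQ ny) => l; rewrite -(tang l); ring.
Qed.

End Singular223.

Section Hyperdeterminants.
Variable F : numClosedFieldType.

(** The last hypothesis stands in for the Nullstellensatz: any irreducible polynomial with the same
    zeros is then a multiple of [H]. *)
Lemma hyperdet_unique k (H : {mpoly F[#|tidx k|]}) : prime_mpoly H ->
  (forall w, H.@[w] = 0 <-> singular_tensor w) ->
  (forall p, vanishes (zeros H) p -> mdvd H p) ->
  exists2 c : F, c != 0 & hyperdet F k = c *: H.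
Proof.
move=> pH Hsing Hdvd; have [_ HU _] := pH.
rewrite /hyperdet; case: xgetP => [D _ [iD hD]|none].
  by apply: mdvd_irreducible => //; apply: Hdvd => w /Hsing/hD.
by case: (none H); split; first exact: prime_irreducible.
Qed.

Lemma exists_I2_neq0 (x : 'I_2 -> F) :
  (exists i, x i != 0) <-> (x 0 != 0) || (x 1 != 0).
Proof.
split=> [[k + ]|/orP[] h]; [|by exists 0|by exists 1].
by elim/forall_I2: k => ->; rewrite ?orbT.
Qed.

Lemma singular_tensor2 (w : 'I_#|tidx 2| -> F) :
  singular_tensor w <-> exists x0 x1 y0 y1 z0 z1,
    [/\ (x0 != 0) || (x1 != 0), (y0 != 0) || (y1 != 0), (z0 != 0) || (z1 != 0) &
      critical222 (w (tpos 0 0 0)) (w (tpos 0 1 0)) (w (tpos 1 0 0)) (w (tpos 1 1 0))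
        (w (tpos 0 0 1)) (w (tpos 0 1 1)) (w (tpos 1 0 1)) (w (tpos 1 1 1))
        x0 x1 y0 y1 z0 z1].
Proof.
split.
  move=> [x [y [z [[/exists_I2_neq0 nx /exists_I2_neq0 ny /exists_I2_neq0 nz]]]]].
  move=> [_ ex ey ez]; exists (x 0), (x 1), (y 0), (y 1), (z 0), (z 1); split=> //.
  split; split.
  - by have := ex 0; rewrite !sum_I2.
  - by have := ex 1; rewrite !sum_I2.
  - by have := ey 0; rewrite !sum_I2.
  - by have := ey 1; rewrite !sum_I2.
  - by have := ez 0; rewrite !sum_I2.
  - by have := ez 1; rewrite !sum_I2.
move=> [x0 [x1 [y0 [y1 [z0 [z1 [nx ny nz [[e1 e2] [e3 e4] [e5 e6]]]]]]]]].
exists (fun i => [:: x0; x1]`_i), (fun i => [:: y0; y1]`_i), (fun i => [:: z0; z1]`_i).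
split; first by split; apply/exists_I2_neq0.
split.
- rewrite !sum_I2 /=; transitivity
   (x0 * (w (tpos 0 0 0) * y0 * z0 + w (tpos 0 0 1) * y0 * z1 +
      (w (tpos 0 1 0) * y1 * z0 + w (tpos 0 1 1) * y1 * z1)) +
    x1 * (w (tpos 1 0 0) * y0 * z0 + w (tpos 1 0 1) * y0 * z1 +
      (w (tpos 1 1 0) * y1 * z0 + w (tpos 1 1 1) * y1 * z1))); first by ring.
  by rewrite e1 e2 !mulr0 addr0.
- by apply: forall_I2; rewrite !sum_I2.
- by apply: forall_I2; rewrite !sum_I2.
- by apply: forall_I2; rewrite !sum_I2.
Qed.

Lemma tpos_inj k : injective (fun t : tidx k => tpos t.1.1 t.1.2 t.2).
Proof. by move=> [[i j] l] [[i' j'] l'] /enum_rank_inj. Qed.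

(** The format is [#|K|] where this is applied, hence the equation [e] and the casts. *)
Lemma hyperdet222 k (e : 2 = k) : let t (i j l : 'I_2) := tpos i j (cast_ord e l) in
  exists2 c : F, c != 0 & hyperdet F k =
    c *: h222 'X_(t 0 0 0) 'X_(t 0 1 0) 'X_(t 1 0 0) 'X_(t 1 1 0)
              'X_(t 0 0 1) 'X_(t 0 1 1) 'X_(t 1 0 1) 'X_(t 1 1 1).
Proof.
case: k / e; rewrite /= !cast_ord_id.
have us : uniq [:: tpos 0 0 0; tpos 0 1 0; tpos 1 0 0; tpos 1 1 0;
                   tpos 0 0 1; tpos 0 1 1; tpos 1 0 1; tpos 1 1 (1 : 'I_2)].
  by apply: (etrans (map_inj_uniq (@tpos_inj 2) [:: (0, 0, 0); (0, 1, 0); (1, 0, 0); (1, 1, 0);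
    (0, 0, 1); (0, 1, 1); (1, 0, 1); (1, 1, 1)])).
apply: hyperdet_unique; first exact: h222_prime us.
  move=> w; rewrite rmorph_h222 /= !mevalXU singular_tensor2; split.
    exact: critical222_of_h222_eq0.
  by move=> [x0 [x1 [y0 [y1 [z0 [z1 [nx ny nz cr]]]]]]]; apply: h222_eq0_of_critical cr nx ny nz.
move=> p Hp; apply: (h222_vanishes us) => w [_ [s [t [r [_ _ _ [e1 e2 e3 e4]]]]]].
apply: Hp; rewrite /zeros /= rmorph_h222 /= !mevalXU.
exact: h222_eq0_of_point e1 e2 e3 e4.
Qed.

Lemma singular_tensor3 (w : 'I_#|tidx 3| -> F) :
  singular_tensor w <->
  h223 (fun k => w (tpos 0 0 k)) (fun k => w (tpos 0 1 k))
       (fun k => w (tpos 1 0 k)) (fun k => w (tpos 1 1 k)) = 0.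
Proof.
split.
  move=> [x [y [z [[/exists_I2_neq0 nx /exists_I2_neq0 ny _]]]]] [_ _ _ ez].
  by apply: (h223_eq0_of_critical _ nx ny) => k; have := ez k; rewrite !sum_I2.
move=> /critical223_of_h223_eq0[x0 [x1 [y0 [y1 [z [nx ny nz [ez [e1 e2] [e3 e4]]]]]]]].
exists (fun i => [:: x0; x1]`_i), (fun i => [:: y0; y1]`_i), z.
split; first by split=> //; apply/exists_I2_neq0.
have slice (u v : 'I_3 -> F) s t : \sum_k (u k * s + v k * t) * z k = 0 ->
    \sum_k u k * s * z k + \sum_k v k * t * z k = 0.
  by rewrite -big_split => h; rewrite -[RHS]h; apply: eq_bigr => k _; rewrite mulrDl.
have ex : forall i, \sum_j \sum_l w (tpos i j l) * [:: y0; y1]`_j * z l = 0.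
  by apply: forall_I2; rewrite sum_I2; [apply: slice e1|apply: slice e2].
split=> //.
- rewrite big1 // => i _; transitivity ([:: x0; x1]`_i *
    \sum_j \sum_l w (tpos i j l) * [:: y0; y1]`_j * z l); last by rewrite ex mulr0.
  rewrite mulr_sumr; apply: eq_bigr => j _; rewrite mulr_sumr; apply: eq_bigr => l _.
  by ring.
- by apply: forall_I2; rewrite sum_I2; [apply: slice e3|apply: slice e4].
- by move=> k; rewrite !sum_I2; apply: ez.
Qed.

Lemma hyperdet223 k (e : 3 = k) :
  let X i j l : {mpoly F[#|tidx k|]} := 'X_(tpos i j (cast_ord e l)) in
  exists2 c : F, c != 0 & hyperdet F k = c *: h223 (X 0 0) (X 0 1) (X 1 0) (X 1 1).
Proof.
case: k / e => X.
have XE i j : X i j = fun l => 'X_(tpos i j l).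
  by apply: funext => l; rewrite /X cast_ord_id.
have us : uniq ([:: tpos 0 0 0; tpos 0 0 1; tpos 0 0 2] ++
    [:: tpos 0 1 0; tpos 0 1 1; tpos 0 1 2; tpos 1 0 0; tpos 1 0 1; tpos 1 0 2;
        tpos 1 1 0; tpos 1 1 1; tpos 1 1 (2 : 'I_3)]).
  by apply: (etrans (map_inj_uniq (@tpos_inj 3) [:: (0, 0, 0); (0, 0, 1); (0, 0, 2);
    (0, 1, 0); (0, 1, 1); (0, 1, 2); (1, 0, 0); (1, 0, 1); (1, 0, 2);
    (1, 1, 0); (1, 1, 1); (1, 1, 2)])).
have ev (w : 'I_#|tidx 3| -> F) i j : meval w \o X i j = fun l => w (tpos i j l).
  by apply: funext => l; rewrite XE /= mevalXU.
rewrite !XE; apply: hyperdet_unique; first exact: (@h223_prime _ _ (tpos 0 0) (tpos 0 1) (tpos 1 0) (tpos 1 1) us).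
  by move=> w; rewrite -!XE rmorph_h223 /= !ev singular_tensor3.
move=> p Hp; apply: (@h223_vanishes _ _ (tpos 0 0) (tpos 0 1) (tpos 1 0) (tpos 1 1) us) => w [_ [s [t [z [_ _ _ [e1 _ _]]]]]].
apply: Hp; rewrite /zeros /= -!XE rmorph_h223 /= !ev.
exact: h223_eq0_of_point e1.
Qed.

End Hyperdeterminants.

(** * Faces of matrix and tensor type *)

(** A torus point needs nonzero coordinates outside the face as well; the filler is 1. *)
Lemma extend_family (F : fieldType) (T : finType) (I : finType) (k : I -> T) (v : I -> F) :
  injective k -> (forall i, v i != 0) ->
  exists z : T -> F, (forall i, z (k i) = v i) /\ forall t, z t != 0.
Proof.
move=> k_inj v0; exists (fun t => if [pick i | k i == t] is Some i then v i else 1).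
split=> [i|t]; last by case: pickP => [i _|_]; rewrite ?oner_eq0.
case: pickP => [j /eqP/k_inj-> //|/(_ i)]; by rewrite eqxx.
Qed.

(** One treatment for the faces on which [i], [j] or [k] is fixed: [T] is ['I_n] in the first two
    cases and ['I_2] in the third. *)
Section MatrixFace.
Variables (F : numClosedFieldType) (d N : nat) (A : 'M[int]_(d, N)).
Variables (T : finType) (K : {set T}) (r : 'I_2 -> T -> 'I_N).
Hypothesis r_inj : forall i i' k k', k \in K -> k' \in K -> r i k = r i' k' ->
  (i, k) = (i', k').
Hypothesis nablaP : forall w, nabla0 F A w <-> torus w /\
  exists (x : 'I_2 -> F) (z : T -> F),
    [/\ forall i, x i != 0, forall k, z k != 0,
        forall i, \sum_(k in K) w (r i k) * z k = 0 &
        forall k, k \in K -> \sum_i w (r i k) * x i = 0].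

Let minor k k' : {mpoly F[N]} := det2 'X_(r 0 k) 'X_(r 0 k') 'X_(r 1 k) 'X_(r 1 k').

Let minor_uniq k k' : k \in K -> k' \in K -> k != k' ->
  uniq [:: r 0 k; r 0 k'; r 1 k; r 1 k'].
Proof.
move=> kK kK' nk.
have ne i j l l' : l \in K -> l' \in K -> ((i != j) || (l != l')) -> r i l != r j l'.
  move=> lK lK'; apply: contraTneq => /r_inj-/(_ lK lK')[-> ->].
  by rewrite !eqxx.
by rewrite /= !inE !negb_or !ne // ?nk ?orbT // eq_sym.
Qed.

Let vanishes_minor k k' : k \in K -> k' \in K -> vanishes (nabla0 F A) (minor k k').
Proof.
move=> kK kK' w /nablaP[tw [x [z [x0 _ _ ez]]]].
rewrite rmorph_det2 /= !mevalXU /det2; apply: (mulfI (x0 0)); rewrite mulr0.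
have := ez k kK; have := ez k' kK'; rewrite !sum_I2 => e' e.
transitivity ((w (r 0 k) * x 0 + w (r 1 k) * x 1) * w (r 1 k')
  - (w (r 0 k') * x 0 + w (r 1 k') * x 1) * w (r 1 k)); first by ring.
by rewrite e e' !mul0r subrr.
Qed.

Lemma Adisc_matrix2 k k' : k != k' -> K = [set k; k'] ->
  exists2 c : F, c != 0 & Adisc F A = c *: minor k k'.
Proof.
move=> nk eK; have [kK kK'] : k \in K /\ k' \in K by rewrite eK !inE !eqxx orbT.
have us := minor_uniq kK kK' nk.
apply: Adisc_hypersurface; first exact: det2_prime us.
  exact: vanishes_minor.
move=> p Ap; apply: (det2_vanishes us) => w [tw]; rewrite /zeros /= rmorph_det2 /= !mevalXU.
rewrite /det2 => e; apply: Ap; apply/nablaP; split=> //.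
(* In a singular matrix with nonzero entries, [x] can be read off the column [k] and [z] off the row
   0. *)
have x_nz (i : 'I_2) : [:: w (r 1 k); - w (r 0 k)]`_i != 0.
  by case: i => [[|[|i]] li] //=; rewrite ?oppr_eq0.
have [z [ez z0]] : exists z : T -> F,
    (forall b, z (if b then k else k') = if b then w (r 0 k') else - w (r 0 k)) /\
    forall t, z t != 0.
  apply: extend_family => [[] [] //= /eqP|[]]; rewrite ?oppr_eq0 //.
    by rewrite (negPf nk).
  by rewrite eq_sym (negPf nk).
have zk : z k = w (r 0 k') := ez true.
have zk' : z k' = - w (r 0 k) := ez false.
exists (fun i => [:: w (r 1 k); - w (r 0 k)]`_i), z; split=> //.
  move=> i; rewrite eK big_setU1 ?inE //= big_set1 zk zk'.
  elim/forall_I2: i.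
  - by ring.
  - transitivity (- (w (r 0 k) * w (r 1 k') - w (r 0 k') * w (r 1 k))); [ring|by rewrite e oppr0].
move=> l; rewrite eK !inE => /orP[] /eqP->; rewrite sum_I2 /=; first by ring.
transitivity (- (w (r 0 k) * w (r 1 k') - w (r 0 k') * w (r 1 k))); [ring|by rewrite e oppr0].
Qed.

Lemma Adisc_matrix_trivial : (0 < #|K|)%N -> #|K| != 2 -> Adisc F A = 1.
Proof.
move=> K0 K2; have [K1|K1] := eqVneq #|K| 1.
  move/eqP/cards1P: K1 => [k eK]; apply: Adisc_empty => w /nablaP[tw [x [z [_ z0 ex _]]]].
  have := ex 0; rewrite eK big_set1 => /eqP.
  by rewrite mulf_eq0 (negPf (tw _)) (negPf (z0 _)).
have : (2 < #|K|)%N by move: K0 K1 K2; case: #|K| => [|[|[|m]]].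
move=> /card_gt2P[k1 [k2 [k3 [[k1K k2K k3K] [n12 n23 n31]]]]].
have us := minor_uniq k1K k2K n12.
apply: (@Adisc_thin _ _ _ _ (@torus F N `&` zeros (minor k1 k2))%classic
  (minor k1 k2) (minor k1 k3)).
- exact: det2_prime us.
- split; [by move=> w []|by move=> w []|exact: det2_vanishes us].
- exact: vanishes_minor.
- exact: vanishes_minor.
have ne i j l l' : l \in K -> l' \in K -> ((i != j) || (l != l')) -> (r i l == r j l') = false.
  move=> lK lK' h; apply/negbTE; apply: contraTneq h => /r_inj-/(_ lK lK')[-> ->].
  by rewrite !eqxx.
(* The column [k2] is zero, so [minor k1 k2] vanishes, while [minor k1 k3] is the determinant of the
   identity. *)
pose v m : F := ((m == r 0 k1) || (m == r 1 k3))%:R.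
have n21 : k2 != k1 by rewrite eq_sym.
have n13 : k1 != k3 by rewrite eq_sym.
have v01 : v (r 0 k1) = 1 by rewrite /v eqxx.
have v02 : v (r 0 k2) = 0 by rewrite /v !ne ?n21 ?n23 ?orbT.
have v03 : v (r 0 k3) = 0 by rewrite /v !ne ?n31 ?orbT.
have v11 : v (r 1 k1) = 0 by rewrite /v !ne ?n13 ?orbT.
have v12 : v (r 1 k2) = 0 by rewrite /v !ne ?n21 ?n23 ?orbT.
have v13 : v (r 1 k3) = 1 by rewrite /v eqxx orbT.
apply: (@not_mdvd_at _ _ _ _ v); rewrite rmorph_det2 /= !mevalXU /det2.
  by rewrite v01 v12 v02 v11; ring.
by rewrite v01 v13 v03 v11 !mulr1 mulr0 subr0 oner_eq0.
Qed.

End MatrixFace.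

Section TensorFace.
Variables (F : numClosedFieldType) (d N : nat) (A : 'M[int]_(d, N)).
Variables (n : nat) (K : {set 'I_n}) (r : 'I_2 -> 'I_2 -> 'I_n -> 'I_N).
Hypothesis r_inj : forall i i' j j' k k', k \in K -> k' \in K ->
  r i j k = r i' j' k' -> (i, j, k) = (i', j', k').
Hypothesis nablaP : forall w, nabla0 F A w <-> torus w /\
  exists (x y : 'I_2 -> F) (z : 'I_n -> F),
    [/\ forall i, x i != 0, forall j, y j != 0, forall k, z k != 0 &
    [/\ forall i, \sum_j \sum_(k in K) w (r i j k) * y j * z k = 0,
        forall j, \sum_i \sum_(k in K) w (r i j k) * x i * z k = 0 &
        forall k, k \in K -> \sum_i \sum_j w (r i j k) * x i * y j = 0]].

Let r_map m (kappa : 'I_m -> 'I_n) : injective kappa -> (forall l, kappa l \in K) ->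
  injective (fun t : tidx m => r t.1.1 t.1.2 (kappa t.2)).
Proof.
move=> k_inj kK [[i j] l] [[i' j'] l'] /= /r_inj-/(_ (kK _) (kK _)) [-> -> /k_inj->].
by [].
Qed.

Let uniq222 (kappa : 'I_2 -> 'I_n) : injective kappa -> (forall l, kappa l \in K) ->
  uniq [:: r 0 0 (kappa 0); r 0 1 (kappa 0); r 1 0 (kappa 0); r 1 1 (kappa 0);
           r 0 0 (kappa 1); r 0 1 (kappa 1); r 1 0 (kappa 1); r 1 1 (kappa 1)].
Proof.
move=> k_inj kK.
by apply: (etrans (map_inj_uniq (r_map k_inj kK) [:: (0, 0, 0); (0, 1, 0); (1, 0, 0);
  (1, 1, 0); (0, 0, 1); (0, 1, 1); (1, 0, 1); (1, 1, 1)])).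
Qed.

Let uniq223 (kappa : 'I_3 -> 'I_n) : injective kappa -> (forall l, kappa l \in K) ->
  uniq ([:: r 0 0 (kappa 0); r 0 0 (kappa 1); r 0 0 (kappa 2)] ++
    [:: r 0 1 (kappa 0); r 0 1 (kappa 1); r 0 1 (kappa 2);
        r 1 0 (kappa 0); r 1 0 (kappa 1); r 1 0 (kappa 2);
        r 1 1 (kappa 0); r 1 1 (kappa 1); r 1 1 (kappa 2)]).
Proof.
move=> k_inj kK.
by apply: (etrans (map_inj_uniq (r_map k_inj kK) [:: (0, 0, 0); (0, 0, 1); (0, 0, 2);
  (0, 1, 0); (0, 1, 1); (0, 1, 2); (1, 0, 0); (1, 0, 1); (1, 0, 2);
  (1, 1, 0); (1, 1, 1); (1, 1, 2)])).
Qed.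

Lemma Adisc_tensor2 (kappa : 'I_2 -> 'I_n) : injective kappa ->
  (forall f : 'I_n -> F, \sum_(k in K) f k = \sum_l f (kappa l)) ->
  (forall l, kappa l \in K) -> (forall k, k \in K -> exists l, k = kappa l) ->
  let X i j l : {mpoly F[N]} := 'X_(r i j (kappa l)) in
  exists2 c : F, c != 0 & Adisc F A =
    c *: h222 (X 0 0 0) (X 0 1 0) (X 1 0 0) (X 1 1 0)
              (X 0 0 1) (X 0 1 1) (X 1 0 1) (X 1 1 1).
Proof.
move=> k_inj sumK kK kS X; have us := uniq222 k_inj kK.
apply: Adisc_hypersurface; first exact: h222_prime us.
  move=> w /nablaP[_ [x [y [z [x0 y0 z0 [ex ey ez]]]]]].
  rewrite rmorph_h222 /= !mevalXU.
  apply: (@h222_eq0_of_critical _ _ _ _ _ _ _ _ _ (x 0) (x 1) (y 0) (y 1)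
    (z (kappa 0)) (z (kappa 1))); rewrite ?x0 ?y0 ?z0 //; split; split.
  - by have := ex 0; rewrite sum_I2 !sumK !sum_I2.
  - by have := ex 1; rewrite sum_I2 !sumK !sum_I2.
  - by have := ey 0; rewrite sum_I2 !sumK !sum_I2.
  - by have := ey 1; rewrite sum_I2 !sumK !sum_I2.
  - by have := ez _ (kK 0); rewrite !sum_I2.
  - by have := ez _ (kK 1); rewrite !sum_I2.
move=> p Ap; apply: (h222_vanishes us) => w [tw [s [t [q [s0 t0 q0 [e1 e2 e3 e4]]]]]].
apply: Ap; apply/nablaP; split=> //.
have [z [ez z0]] : exists z : 'I_n -> F,
    (forall l, z (kappa l) = [:: 1; q]`_l) /\ forall k, z k != 0.
  apply: extend_family => // -[[|[|l]] ll] //=; exact: oner_neq0.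
have zE0 : z (kappa 0) = 1 := ez 0.
have zE1 : z (kappa 1) = q := ez 1.
exists (fun i => [:: 1; s]`_i), (fun j => [:: 1; t]`_j), z; split=> //.
- by case=> [[|[|i]] li] //=; exact: oner_neq0.
- by case=> [[|[|i]] li] //=; exact: oner_neq0.
split.
- apply: forall_I2; rewrite sum_I2 !sumK !sum_I2 zE0 zE1 /=.
    by rewrite -[RHS]e1; ring.
  by rewrite -[RHS]e3; ring.
- apply: forall_I2; rewrite sum_I2 !sumK !sum_I2 zE0 zE1 /=; last first.
    by rewrite -[RHS]e2; ring.
  (* Euler's relation: [e1 + s e3] is the value of the trilinear form, and removing [t] times the
     derivative in the second [y] coordinate leaves the one in the first. *)
  transitivity (
    (w (r 0 0 (kappa 0)) + w (r 0 1 (kappa 0)) * t + w (r 0 0 (kappa 1)) * q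
      + w (r 0 1 (kappa 1)) * t * q)
    + s * (w (r 1 0 (kappa 0)) + w (r 1 1 (kappa 0)) * t + w (r 1 0 (kappa 1)) * q
      + w (r 1 1 (kappa 1)) * t * q)
    - t * (w (r 0 1 (kappa 0)) + w (r 1 1 (kappa 0)) * s + w (r 0 1 (kappa 1)) * q
      + w (r 1 1 (kappa 1)) * s * q)); first by ring.
  by rewrite e1 e2 e3; ring.
- move=> k /kS[l ->]; elim/forall_I2: l; rewrite !sum_I2 /=; last first.
    by rewrite -[RHS]e4; ring.
  (* The same relation, now between the [x] and the [z] derivatives. *)
  transitivity (
    (w (r 0 0 (kappa 0)) + w (r 0 1 (kappa 0)) * t + w (r 0 0 (kappa 1)) * q
      + w (r 0 1 (kappa 1)) * t * q)
    + s * (w (r 1 0 (kappa 0)) + w (r 1 1 (kappa 0)) * t + w (r 1 0 (kappa 1)) * q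
      + w (r 1 1 (kappa 1)) * t * q)
    - q * (w (r 0 0 (kappa 1)) + w (r 0 1 (kappa 1)) * t + w (r 1 0 (kappa 1)) * s
      + w (r 1 1 (kappa 1)) * s * t)); first by ring.
  by rewrite e1 e3 e4; ring.
Qed.

Let X (kappa : 'I_3 -> 'I_n) i j l : {mpoly F[N]} := 'X_(r i j (kappa l)).
Let hyp kappa := h223 (X kappa 0 0) (X kappa 0 1) (X kappa 1 0) (X kappa 1 1).

Let hypE kappa w : (hyp kappa).@[w] =
  h223 (fun l => w (r 0 0 (kappa l))) (fun l => w (r 0 1 (kappa l)))
       (fun l => w (r 1 0 (kappa l))) (fun l => w (r 1 1 (kappa l))).
Proof.
rewrite rmorph_h223 /=; have ev i j : meval w \o X kappa i j = fun l => w (r i j (kappa l)).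
  by apply: funext => l; rewrite /= mevalXU.
by rewrite !ev.
Qed.

Let vanishes_hyp kappa : (forall l, kappa l \in K) -> vanishes (nabla0 F A) (hyp kappa).
Proof.
move=> kK w /nablaP[_ [x [y [z [x0 y0 _ [_ _ ez]]]]]]; rewrite hypE.
apply: (@h223_eq0_of_critical _ _ _ _ _ (x 0) (x 1) (y 0) (y 1)); rewrite ?x0 ?y0 // => l.
by have := ez _ (kK l); rewrite !sum_I2.
Qed.

Lemma Adisc_tensor3 (kappa : 'I_3 -> 'I_n) : injective kappa ->
  (forall f : 'I_n -> F, \sum_(k in K) f k = \sum_l f (kappa l)) ->
  (forall l, kappa l \in K) -> (forall k, k \in K -> exists l, k = kappa l) ->
  exists2 c : F, c != 0 & Adisc F A = c *: hyp kappa.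
Proof.
move=> k_inj sumK kK kS; have us := uniq223 k_inj kK.
pose R i j l := r i j (kappa l).
apply: Adisc_hypersurface.
- exact: (@h223_prime _ _ (R 0 0) (R 0 1) (R 1 0) (R 1 1) us).
- exact: vanishes_hyp.
move=> p Ap; apply: (@h223_vanishes _ _ (R 0 0) (R 0 1) (R 1 0) (R 1 1) us).
move=> w [tw [s [t [z' [s0 t0 z'0 [e1 e2 e3]]]]]].
apply: Ap; apply/nablaP; split=> //.
have [z [ez z0]] := extend_family k_inj z'0.
exists (fun i => [:: 1; s]`_i), (fun j => [:: 1; t]`_j), z; split=> //.
- by case=> [[|[|i]] li] //=; exact: oner_neq0.
- by case=> [[|[|i]] li] //=; exact: oner_neq0.
split.
- apply: forall_I2; rewrite sum_I2 !sumK -big_split /=; last first.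
    by rewrite -[RHS]e3; apply: eq_bigr => l _; rewrite ez mulr1 mulrDl.
  (* The equations [e1], weighted by [z'], make the two [x] derivatives proportional. *)
  transitivity (- s * \sum_k (w (R 1 0 k) + w (R 1 1 k) * t) * z' k); last first.
    by rewrite e3 mulr0.
  rewrite mulr_sumr; apply: eq_bigr => l _; rewrite ez.
  transitivity ((w (R 0 0 l) + w (R 0 1 l) * t + w (R 1 0 l) * s + w (R 1 1 l) * s * t) * z' l
    - s * ((w (R 1 0 l) + w (R 1 1 l) * t) * z' l)); first by rewrite /R; ring.
  by rewrite e1; ring.
- apply: forall_I2; rewrite sum_I2 !sumK -big_split /=; last first.
    by rewrite -[RHS]e2; apply: eq_bigr => l _; rewrite ez mulr1 mulrDl.
  transitivity (- t * \sum_k (w (R 0 1 k) + w (R 1 1 k) * s) * z' k); last first.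
    by rewrite e2 mulr0.
  rewrite mulr_sumr; apply: eq_bigr => l _; rewrite ez.
  transitivity ((w (R 0 0 l) + w (R 0 1 l) * t + w (R 1 0 l) * s + w (R 1 1 l) * s * t) * z' l
    - t * ((w (R 0 1 l) + w (R 1 1 l) * s) * z' l)); first by rewrite /R; ring.
  by rewrite e1; ring.
- by move=> k /kS[l ->]; rewrite !sum_I2 /= -[RHS](e1 l) /R; ring.
Qed.

Lemma Adisc_tensor_trivial : (3 < #|K|)%N -> Adisc F A = 1.
Proof.
move=> K3; have [ks [us size_ks ksK]] : exists s : seq 'I_n,
    [/\ uniq s, size s = 4 & {subset s <= K}].
  exists (take 4 (enum K)); rewrite take_uniq ?enum_uniq //; split=> //.
    by rewrite size_takel -?cardE.
  by move=> k /mem_take; rewrite mem_enum.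
case: ks us size_ks ksK => [|k0 [|k1 [|k2 [|k3 [|? ?]]]]] // us _ ksK.
pose kap (s : seq 'I_n) (l : 'I_3) := nth k0 s l.
have kap_inj s : uniq s -> size s = 3 -> injective (kap s).
  move=> us' e l l' /eqP; rewrite nth_uniq ?e ?ltn_ord // => /eqP.
  exact: val_inj.
have kapK s : size s = 3 -> {subset s <= [:: k0; k1; k2; k3]} -> forall l, kap s l \in K.
  by move=> e sub l; apply: ksK; apply: sub; apply: mem_nth; rewrite e.
have sub1 : {subset [:: k0; k1; k2] <= [:: k0; k1; k2; k3]}.
  by move=> k; rewrite !inE => /or3P[]->; rewrite ?orbT.
have sub2 : {subset [:: k1; k2; k3] <= [:: k0; k1; k2; k3]}.
  by move=> k; rewrite !inE => /or3P[]->; rewrite ?orbT.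
have us1 : uniq [:: k0; k1; k2].
  by move: us; rewrite /= !inE !negb_or => /andP[/and3P[-> ->]] _ /andP[/andP[->]].
have kK1 := kapK [:: k0; k1; k2] erefl sub1.
have kK2 := kapK [:: k1; k2; k3] erefl sub2.
have us3 := uniq223 (kap_inj _ us1 erefl) kK1.
pose R i j l := r i j (kap [:: k0; k1; k2] l).
apply: (@Adisc_thin _ _ _ _ (singular223 (R 0 0) (R 0 1) (R 1 0) (R 1 1))
  (hyp (kap [:: k0; k1; k2])) (hyp (kap [:: k1; k2; k3]))).
- exact: (@h223_prime _ _ (R 0 0) (R 0 1) (R 1 0) (R 1 1) us3).
- split; first by move=> w [].
    move=> w [_ [s [t [z [_ _ _ [e1 _ _]]]]]]; rewrite hypE.
    exact: h223_eq0_of_point e1.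
  exact: (@h223_vanishes _ _ (R 0 0) (R 0 1) (R 1 0) (R 1 1) us3).
- exact: vanishes_hyp.
- exact: vanishes_hyp.
(* At v the slice k0 vanishes, while k1, k2, k3 have nonzero hyperdeterminant. *)
pose v m : F := [|| m == r 0 0 k2, m == r 0 1 k1, m == r 1 0 k1 | m == r 1 1 k3]%:R.
have [k0K k1K k2K k3K] : [/\ k0 \in K, k1 \in K, k2 \in K & k3 \in K].
  by split; apply: ksK; rewrite !inE eqxx ?orbT.
have rE i j k i' j' k' : k \in K -> k' \in K ->
    (r i j k == r i' j' k') = [&& i == i', j == j' & k == k'].
  move=> kK kK'; apply/eqP/and3P => [/r_inj-/(_ kK kK')[-> -> ->]//|].
  by move=> [/eqP-> /eqP-> /eqP->].
have [n01 n02 n03] : [/\ k0 != k1, k0 != k2 & k0 != k3].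
  by move: us; rewrite /= !inE !negb_or => /andP[/and3P[]].
have [n12 n13 n23] : [/\ k1 != k2, k1 != k3 & k2 != k3].
  by move: us; rewrite /= !inE !negb_or => /andP[_ /andP[/andP[-> ->]]] /andP[->].
have [n21 n31 n32] : [/\ k2 != k1, k3 != k1 & k3 != k2] by split; rewrite eq_sym.
have vE i j k : k \in K -> v (r i j k) =
    [|| [&& i == 0, j == 0 & k == k2], [&& i == 0, j == 1 & k == k1],
        [&& i == 1, j == 0 & k == k1] | [&& i == 1, j == 1 & k == k3]]%:R.
  by move=> kK; rewrite /v !rE.
have simp := (negPf n01, negPf n02, negPf n03, negPf n12, negPf n13, negPf n23,
  negPf n21, negPf n31, negPf n32, eqxx).
apply: (@not_mdvd_at _ _ _ _ v); rewrite hypE /h223 /det3 /det2 /kap /= !vE // !simp /=.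
  by ring.
by set e := (X in X != 0); have -> : e = 1 by [rewrite /e; ring]; rewrite oner_eq0.
Qed.

End TensorFace.

(** * Faces of the Segre polytope *)

Definition segre_face n (I J : {set 'I_2}) (K : {set 'I_n}) : {set 'I_#|tidx n|} :=
  [set m | [&& (enum_val m).1.1 \in I, (enum_val m).1.2 \in J & (enum_val m).2 \in K]].

Lemma tpos_face n (I J : {set 'I_2}) (K : {set 'I_n}) i j k :
  (tpos i j k \in segre_face I J K) = [&& i \in I, j \in J & k \in K].
Proof. by rewrite inE /tpos enum_rankK. Qed.

(** * Critical equations on a face *)

Section MonomialDerivative.
Variables (F : fieldType) (d : nat).

Lemma monom_dvalE (s : 'I_d) (a : 'cV[int]_d) (t : 'I_d -> F) : torus t ->
  monom_dval s a t = (a s 0)%:~R * monom_val a t / t s.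
Proof.
move=> tt; have ts := tt s; rewrite /monom_dval /monom_val [in RHS](bigD1 s) //=.
rewrite expfzDr // exprN1; set P := \prod_(_ | _) _.
by rewrite -!mulrA; congr (_ * (_ * _)); rewrite mulrC.
Qed.

Lemma prod_pow_delta m (x : 'I_m -> F) i0 :
  \prod_i x i ^ ((delta_mx i0 0 : 'cV[int]_m) i 0) = x i0.
Proof.
rewrite (bigD1 i0) //= mxE !eqxx expr1z big1 ?mulr1 // => i /negPf ne.
by rewrite mxE ne expr0z.
Qed.

End MonomialDerivative.

Section SegreFace.
Variables (F : fieldType) (n : nat) (I J : {set 'I_2}) (K : {set 'I_n}).
Let S := segre_face I J K.
Variables (i0 j0 : 'I_2) (k0 : 'I_n).
Hypotheses (i0I : i0 \in I) (j0J : j0 \in J) (k0K : k0 \in K).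

Let S0 : tpos i0 j0 k0 \in S.
Proof. by rewrite tpos_face i0I j0J k0K. Qed.

(* Position of (i, j, k) among the columns of sub_cols; junk off the face. *)
Definition fpos i j k : 'I_#|S| := enum_rank_in S0 (tpos i j k).

Lemma enum_val_fpos i j k : i \in I -> j \in J -> k \in K ->
  enum_val (fpos i j k) = tpos i j k.
Proof. by move=> iI jJ kK; rewrite /fpos enum_rankK_in // tpos_face iI jJ. Qed.

Lemma fpos_inj i i' j j' k k' : i \in I -> i' \in I -> j \in J -> j' \in J ->
  k \in K -> k' \in K -> fpos i j k = fpos i' j' k' -> (i, j, k) = (i', j', k').
Proof.
move=> iI iI' jJ jJ' kK kK' /(congr1 enum_val); rewrite !enum_val_fpos //.
exact: enum_rank_inj.
Qed.

Let idx (m : 'I_#|S|) : tidx n := enum_val (enum_val m).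

Let fpos_idx m : fpos (idx m).1.1 (idx m).1.2 (idx m).2 = m.
Proof.
apply: enum_val_inj; have := enum_valP m; rewrite inE => /and3P[? ? ?].
rewrite enum_val_fpos // /tpos; rewrite -[RHS]enum_valK; congr enum_rank.
by rewrite /idx; case: (enum_val (enum_val m)) => -[].
Qed.

Let idx_fpos i j k : i \in I -> j \in J -> k \in K -> idx (fpos i j k) = (i, j, k).
Proof. by move=> iI jJ kK; rewrite /idx enum_val_fpos // enum_rankK. Qed.

Lemma sum_face (f : 'I_#|S| -> F) :
  \sum_m f m = \sum_(i in I) \sum_(j in J) \sum_(k in K) f (fpos i j k).
Proof.
under [RHS]eq_bigr do rewrite pair_big /=.
rewrite pair_big /= (reindex_onto (fun t : 'I_2 * ('I_2 * 'I_n) => fpos t.1 t.2.1 t.2.2)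
  (fun m => ((idx m).1.1, ((idx m).1.2, (idx m).2)))); last by move=> m _; rewrite fpos_idx.
apply: eq_bigl => -[i [j k]] /=; apply/eqP/and3P => [e|[iI jJ kK]]; last first.
  by rewrite idx_fpos.
have := enum_valP (fpos i j k); rewrite inE -/(idx _).
by case: e => -> -> -> /and3P.
Qed.

Let point (x y : 'I_2 -> F) (z : 'I_n -> F) : 'I_(2 + 2 + n) -> F :=
  fun s => match split s with
           | inl s' => match split s' with inl i => x i | inr j => y j end
           | inr k => z k end.

Let splitl m p (i : 'I_m) : split (lshift p i) = inl i.
Proof. exact: (unsplitK (inl _)). Qed.
Let splitr m p (i : 'I_p) : split (rshift m i) = inr i.
Proof. exact: (unsplitK (inr _)). Qed.

Let point_surj t : t = point (fun i => t (lshift n (lshift 2 i)))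
  (fun j => t (lshift n (rshift 2 j))) (fun k => t (rshift (2 + 2) k)).
Proof.
apply: funext => s; rewrite /point; case: split_ordP => [s' ->|k ->] //.
by case: split_ordP => [i ->|j ->].
Qed.

Let point_torus x y z : torus (point x y z) <->
  [/\ forall i, x i != 0, forall j, y j != 0 & forall k, z k != 0].
Proof.
split=> [t|[x0 y0 z0] s]; last by rewrite /point; case: split => // s'; case: split.
split=> [i|j|k].
- by have := t (lshift n (lshift 2 i)); rewrite /point !splitl.
- by have := t (lshift n (rshift 2 j)); rewrite /point splitl splitr.
- by have := t (rshift (2 + 2) k); rewrite /point splitr.
Qed.

Let colE m s : col m (sub_cols (segre n) S) s 0 = segre_col (idx m) s 0.
Proof. by rewrite 3!mxE. Qed.

Let segre_col1 (t : tidx n) i : segre_col t (lshift n (lshift 2 i)) 0 =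
  (delta_mx t.1.1 0 : 'cV[int]_2) i 0.
Proof. by rewrite /segre_col !col_mxEu. Qed.

Let segre_col2 (t : tidx n) j : segre_col t (lshift n (rshift 2 j)) 0 =
  (delta_mx t.1.2 0 : 'cV[int]_2) j 0.
Proof. by rewrite /segre_col col_mxEu col_mxEd. Qed.

Let segre_col3 (t : tidx n) k : segre_col t (rshift (2 + 2) k) 0 =
  (delta_mx t.2 0 : 'cV[int]_n) k 0.
Proof. by rewrite /segre_col col_mxEd. Qed.

Let monom_segre x y z (m : 'I_#|S|) : monom_val (col m (sub_cols (segre n) S)) (point x y z) =
  x (idx m).1.1 * y (idx m).1.2 * z (idx m).2.
Proof.
rewrite /monom_val !big_split_ord /=; congr (_ * _ * _).
- rewrite -[RHS]prod_pow_delta; apply: eq_bigr => i _.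
  by rewrite /point !splitl colE segre_col1.
- rewrite -[RHS]prod_pow_delta; apply: eq_bigr => i _.
  by rewrite /point splitl splitr colE segre_col2.
- rewrite -[RHS]prod_pow_delta; apply: eq_bigr => i _.
  by rewrite /point splitr colE segre_col3.
Qed.

(** A torus point splits into [x], [y], [z], and a column gives the monomial [x i * y j * z k]. A
    derivative times its own coordinate is the part of the sum containing that coordinate: a slice
    sum on the face, and zero for an index outside it. *)
Lemma nabla0_face (w : 'I_#|S| -> F) : nabla0 F (sub_cols (segre n) S) w <-> torus w /\
  exists (x y : 'I_2 -> F) (z : 'I_n -> F),
    [/\ forall i, x i != 0, forall j, y j != 0, forall k, z k != 0 &
    [/\ forall i, i \in I -> \sum_(j in J) \sum_(k in K) w (fpos i j k) * y j * z k = 0,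
        forall j, j \in J -> \sum_(i in I) \sum_(k in K) w (fpos i j k) * x i * z k = 0 &
        forall k, k \in K -> \sum_(i in I) \sum_(j in J) w (fpos i j k) * x i * y j = 0]].
Proof.
have dval x y z s m : torus (point x y z) ->
    monom_dval s (col m (sub_cols (segre n) S)) (point x y z) * point x y z s =
    (segre_col (idx m) s 0)%:~R * (x (idx m).1.1 * y (idx m).1.2 * z (idx m).2).
  by move=> tp; rewrite monom_dvalE // divfK ?tp // monom_segre colE.
have term x y z s : torus (point x y z) ->
    (\sum_m w m * monom_dval s (col m (sub_cols (segre n) S)) (point x y z)) * point x y z s
    = \sum_(i in I) \sum_(j in J) \sum_(k in K)
        (segre_col (i, j, k) s 0)%:~R * (w (fpos i j k) * (x i * y j * z k)).
  move=> tp; rewrite mulr_suml sum_face.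
  apply: eq_bigr => i iI; apply: eq_bigr => j jJ; apply: eq_bigr => k kK.
  by rewrite -mulrA dval // idx_fpos //= mulrCA.
have select (T : finType) (B : {set T}) b (g : T -> F) : b \in B ->
    \sum_(t in B) (b == t)%:R * g t = g b.
  move=> bB; rewrite (bigD1 b) //= eqxx mul1r big1 ?addr0 // => t /andP[_ tb].
  by rewrite eq_sym (negPf tb) mul0r.
have select0 (T : finType) (B : {set T}) b (g : T -> F) : b \notin B ->
    \sum_(t in B) (b == t)%:R * g t = 0.
  move=> bB; rewrite big1 // => t tB; case: eqP => [e|]; last by rewrite mul0r.
  by rewrite e tB in bB.
pose slice1 (x y : 'I_2 -> F) z i := x i * \sum_(j in J) \sum_(k in K) w (fpos i j k) * y j * z k.
pose slice2 (x y : 'I_2 -> F) z j := y j * \sum_(i in I) \sum_(k in K) w (fpos i j k) * x i * z k.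
pose slice3 (x y : 'I_2 -> F) z k := z k * \sum_(i in I) \sum_(j in J) w (fpos i j k) * x i * y j.
have term1 x y z i : torus (point x y z) ->
    (\sum_m w m * monom_dval (lshift n (lshift 2 i)) (col m (sub_cols (segre n) S))
       (point x y z)) * x i = \sum_(i' in I) (i == i')%:R * slice1 x y z i'.
  move=> tp; have := term x y z (lshift n (lshift 2 i)) tp.
  rewrite /point !splitl => ->; apply: eq_bigr => i' _; rewrite /slice1 !mulr_sumr.
  apply: eq_bigr => j _; rewrite !mulr_sumr; apply: eq_bigr => k _.
  by rewrite segre_col1 mxE andbT mulrz_nat; ring.
have term2 x y z j : torus (point x y z) ->
    (\sum_m w m * monom_dval (lshift n (rshift 2 j)) (col m (sub_cols (segre n) S))
       (point x y z)) * y j = \sum_(j' in J) (j == j')%:R * slice2 x y z j'.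
  move=> tp; have := term x y z (lshift n (rshift 2 j)) tp.
  rewrite /point splitl splitr => ->; rewrite exchange_big; apply: eq_bigr => j' _ /=.
  rewrite /slice2 !mulr_sumr; apply: eq_bigr => i _; rewrite !mulr_sumr.
  by apply: eq_bigr => k _; rewrite segre_col2 mxE andbT mulrz_nat; ring.
have term3 x y z k : torus (point x y z) ->
    (\sum_m w m * monom_dval (rshift (2 + 2) k) (col m (sub_cols (segre n) S))
       (point x y z)) * z k = \sum_(k' in K) (k == k')%:R * slice3 x y z k'.
  move=> tp; have := term x y z (rshift (2 + 2) k) tp.
  rewrite /point splitr => ->; under eq_bigr do rewrite exchange_big /=.
  rewrite exchange_big; apply: eq_bigr => k' _ /=.
  rewrite /slice3 !mulr_sumr; apply: eq_bigr => i _; rewrite !mulr_sumr.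
  by apply: eq_bigr => j _; rewrite segre_col3 mxE andbT mulrz_nat; ring.
split=> [[tw [t [tt _ dt]]]|[tw [x [y [z [x0 y0 z0 [ex ey ez]]]]]]]; split=> //.
  rewrite (point_surj t) in tt dt; move: tt dt; move: (fun _ => t _) (fun _ => t _) (fun _ => t _).
  move=> z y x tt dt; have [x0 y0 z0] := (point_torus x y z).1 tt.
  exists x, y, z; split=> //; split.
  - move=> i iI; have := term1 _ _ _ i tt; rewrite dt mul0r select // => /esym/eqP.
    by rewrite mulf_eq0 (negPf (x0 _)) => /eqP.
  - move=> j jJ; have := term2 _ _ _ j tt; rewrite dt mul0r select // => /esym/eqP.
    by rewrite mulf_eq0 (negPf (y0 _)) => /eqP.
  - move=> k kK; have := term3 _ _ _ k tt; rewrite dt mul0r select // => /esym/eqP.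
    by rewrite mulf_eq0 (negPf (z0 _)) => /eqP.
have tp : torus (point x y z) by apply/point_torus.
exists (point x y z); split=> //.
  (* The polynomial is linear in [x], hence the sum of its slices. *)
  rewrite sum_face big1 // => i iI; transitivity (slice1 x y z i); last first.
    by rewrite /slice1 ex // mulr0.
  rewrite /slice1 mulr_sumr; apply: eq_bigr => j jJ; rewrite mulr_sumr.
  by apply: eq_bigr => k kK; rewrite monom_segre idx_fpos //=; ring.
move=> s; case: (split_ordP s) => [s' ->|k ->].
  case: (split_ordP s') => [i ->|j ->].
    apply: (mulIf (x0 i)); rewrite mul0r term1 //.
    have [iI|iI] := boolP (i \in I); last by rewrite select0.
    by rewrite select // /slice1 ex // mulr0.
  apply: (mulIf (y0 j)); rewrite mul0r term2 //.
  have [jJ|jJ] := boolP (j \in J); last by rewrite select0.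
  by rewrite select // /slice2 ey // mulr0.
apply: (mulIf (z0 k)); rewrite mul0r term3 //.
have [kK|kK] := boolP (k \in K); last by rewrite select0.
by rewrite select // /slice3 ez // mulr0.
Qed.

End SegreFace.

(** * Discriminants of the individual faces *)

Definition proportional (F : fieldType) N (p q : {mpoly F[N]}) : Prop :=
  exists2 c : F, c != 0 & p = c *: q.

Section FaceDiscriminants.
Variables (F : numClosedFieldType) (n : nat).

Definition face_disc (S : {set 'I_#|tidx n|}) : {mpoly F[#|tidx n|]} :=
  Adisc F (sub_cols (segre n) S) \mPo [tuple 'X_(enum_val m) | m < #|S|].

Lemma face_disc1 (S : {set 'I_#|tidx n|}) : Adisc F (sub_cols (segre n) S) = 1 -> face_disc S = 1.
Proof. by rewrite /face_disc => ->; rewrite comp_mpoly1. Qed.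

Lemma comp_enum_val (S : {set 'I_#|tidx n|}) m :
  ('X_m : {mpoly F[#|S|]}) \mPo [tuple 'X_(enum_val m) | m < #|S|] = 'X_(enum_val m).
Proof. by rewrite comp_mpolyXU -tnth_nth tnth_mktuple. Qed.

Lemma face_disc_proportional (S : {set 'I_#|tidx n|}) (H : {mpoly F[#|S|]}) :
  (exists2 c : F, c != 0 & Adisc F (sub_cols (segre n) S) = c *: H) ->
  proportional (face_disc S) (H \mPo [tuple 'X_(enum_val m) | m < #|S|]).
Proof. by move=> [c c0 e]; exists c; rewrite // /face_disc e comp_mpolyZ. Qed.

Lemma sum_setT (T : finType) (f : T -> F) : \sum_(i in [set: T]) f i = \sum_i f i.
Proof. by apply: eq_bigl => i; rewrite finset.in_setT. Qed.

Lemma face_disc_point i j (K : {set 'I_n}) : (0 < #|K|)%N ->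
  face_disc (segre_face [set i] [set j] K) = 1.
Proof.
case/card_gt0P => k kK; apply: face_disc1; apply: Adisc_empty => w.
move/(nabla0_face (finset.set11 i) (finset.set11 j) kK) => [tw [x [y [z [x0 y0 _ [_ _ /(_ k kK)]]]]]].
rewrite !big_set1 => /eqP; apply/negP.
by rewrite !mulf_neq0 // tw.
Qed.

Section Rows.
Variables (j : 'I_2) (K : {set 'I_n}) (k0 : 'I_n).
Hypothesis k0K : k0 \in K.
Let S := segre_face [set: 'I_2] [set j] K.
Let r i k : 'I_#|S| := fpos (finset.in_setT 0) (finset.set11 j) k0K i j k.

Let r_inj i i' k k' : k \in K -> k' \in K -> r i k = r i' k' -> (i, k) = (i', k').
Proof.
move=> kK kK' /fpos_inj; rewrite !finset.in_setT !finset.set11.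
by move=> /(_ isT isT isT isT kK kK') [-> ->].
Qed.

Let nablaP (w : 'I_#|S| -> F) : nabla0 F (sub_cols (segre n) S) w <-> torus w /\
  exists (x : 'I_2 -> F) (z : 'I_n -> F),
    [/\ forall i, x i != 0, forall k, z k != 0,
        forall i, \sum_(k in K) w (r i k) * z k = 0 &
        forall k, k \in K -> \sum_i w (r i k) * x i = 0].
Proof.
rewrite (nabla0_face (finset.in_setT 0) (finset.set11 j) k0K); split=> -[tw]; last first.
  (* The single coordinate [y j] is a common factor and is set to 1; its equation is the sum of the
     equations for [k] weighted by [z k]. *)
  move=> [x [z [x0 z0 ex ez]]]; split=> //; exists x, (fun=> 1), z.
  split=> //; first by move=> _; rewrite oner_neq0.
  split=> [i _|j'|k kK].
  - by rewrite big_set1 -[RHS](ex i); apply: eq_bigr => k _; rewrite mulr1.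
  - rewrite inE => /eqP->; rewrite sum_setT exchange_big big1 // => k kK.
    transitivity (z k * \sum_i w (r i k) * x i); last by rewrite ez // mulr0.
    by rewrite mulr_sumr; apply: eq_bigr => i _; rewrite mulrC.
  - by rewrite sum_setT -[RHS](ez k kK); apply: eq_bigr => i _; rewrite big_set1 mulr1.
move=> [x [y [z [x0 y0 z0 [ex _ ez]]]]]; split=> //; exists x, z; split=> // [i|k kK].
  apply: (mulfI (y0 j)); rewrite mulr0 -[RHS](ex i (finset.in_setT i)) big_set1 mulr_sumr.
  by apply: eq_bigr => k _; rewrite mulrA; congr (_ * _); rewrite mulrC.
apply: (mulfI (y0 j)); rewrite mulr0 -[RHS](ez k kK) sum_setT mulr_sumr.
by apply: eq_bigr => i _; rewrite big_set1 mulrC.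
Qed.

Let X_r i k : k \in K ->
  ('X_(r i k) : {mpoly F[#|S|]}) \mPo [tuple 'X_(enum_val m) | m < #|S|] = wvar F i j k.
Proof. by move=> kK; rewrite comp_enum_val enum_val_fpos ?finset.in_setT ?finset.set11. Qed.

Lemma face_disc_rows k k' : k != k' -> K = [set k; k'] ->
  proportional (face_disc S)
    (det2 (wvar F 0 j k) (wvar F 0 j k') (wvar F 1 j k) (wvar F 1 j k')).
Proof.
move=> nk eK; have [kK kK'] : k \in K /\ k' \in K by rewrite eK !inE !eqxx orbT.
have := face_disc_proportional (Adisc_matrix2 r_inj nablaP nk eK).
by rewrite rmorph_det2 /= !X_r.
Qed.

Lemma face_disc_rows_trivial : #|K| != 2 -> face_disc S = 1.
Proof.
move=> K2; apply: face_disc1; apply: (Adisc_matrix_trivial r_inj nablaP) => //.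
by apply/card_gt0P; exists k0.
Qed.

End Rows.

Section Columns.
Variables (i : 'I_2) (K : {set 'I_n}) (k0 : 'I_n).
Hypothesis k0K : k0 \in K.
Let S := segre_face [set i] [set: 'I_2] K.
Let r j k : 'I_#|S| := fpos (finset.set11 i) (finset.in_setT 0) k0K i j k.

Let r_inj j j' k k' : k \in K -> k' \in K -> r j k = r j' k' -> (j, k) = (j', k').
Proof.
move=> kK kK' /fpos_inj; rewrite !finset.in_setT !finset.set11.
by move=> /(_ isT isT isT isT kK kK') [-> ->].
Qed.

Let nablaP (w : 'I_#|S| -> F) : nabla0 F (sub_cols (segre n) S) w <-> torus w /\
  exists (y : 'I_2 -> F) (z : 'I_n -> F),
    [/\ forall j, y j != 0, forall k, z k != 0,
        forall j, \sum_(k in K) w (r j k) * z k = 0 &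
        forall k, k \in K -> \sum_j w (r j k) * y j = 0].
Proof.
rewrite (nabla0_face (finset.set11 i) (finset.in_setT 0) k0K); split=> -[tw]; last first.
  move=> [y [z [y0 z0 ey ez]]]; split=> //; exists (fun=> 1), y, z.
  split=> //; first by move=> _; rewrite oner_neq0.
  split=> [i'|j _|k kK].
  - rewrite inE => /eqP->; rewrite sum_setT exchange_big big1 // => k kK.
    transitivity (z k * \sum_j w (r j k) * y j); last by rewrite ez // mulr0.
    by rewrite mulr_sumr; apply: eq_bigr => j _; rewrite mulrC.
  - by rewrite big_set1 -[RHS](ey j); apply: eq_bigr => k _; rewrite mulr1.
  - by rewrite big_set1 sum_setT -[RHS](ez k kK); apply: eq_bigr => j _; rewrite mulr1.
move=> [x [y [z [x0 y0 z0 [_ ey ez]]]]]; split=> //; exists y, z; split=> // [j|k kK].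
  apply: (mulfI (x0 i)); rewrite mulr0 -[RHS](ey j (finset.in_setT j)) big_set1 mulr_sumr.
  by apply: eq_bigr => k _; rewrite mulrA; congr (_ * _); rewrite mulrC.
apply: (mulfI (x0 i)); rewrite mulr0 -[RHS](ez k kK) big_set1 sum_setT mulr_sumr.
by apply: eq_bigr => j _; rewrite mulrA; congr (_ * _); rewrite mulrC.
Qed.

Let X_r j k : k \in K ->
  ('X_(r j k) : {mpoly F[#|S|]}) \mPo [tuple 'X_(enum_val m) | m < #|S|] = wvar F i j k.
Proof. by move=> kK; rewrite comp_enum_val enum_val_fpos ?finset.in_setT ?finset.set11. Qed.

Lemma face_disc_columns k k' : k != k' -> K = [set k; k'] ->
  proportional (face_disc S)
    (det2 (wvar F i 0 k) (wvar F i 0 k') (wvar F i 1 k) (wvar F i 1 k')).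
Proof.
move=> nk eK; have [kK kK'] : k \in K /\ k' \in K by rewrite eK !inE !eqxx orbT.
have := face_disc_proportional (Adisc_matrix2 r_inj nablaP nk eK).
by rewrite rmorph_det2 /= !X_r.
Qed.

Lemma face_disc_columns_trivial : #|K| != 2 -> face_disc S = 1.
Proof.
move=> K2; apply: face_disc1; apply: (Adisc_matrix_trivial r_inj nablaP) => //.
by apply/card_gt0P; exists k0.
Qed.

End Columns.

Section Full.
Variables (K : {set 'I_n}) (k0 : 'I_n).
Hypothesis k0K : k0 \in K.
Let S := segre_face [set: 'I_2] [set: 'I_2] K.
Let r i j k : 'I_#|S| := fpos (finset.in_setT 0) (finset.in_setT 0) k0K i j k.

Let r_inj i i' j j' k k' : k \in K -> k' \in K -> r i j k = r i' j' k' ->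
  (i, j, k) = (i', j', k').
Proof.
move=> kK kK' /fpos_inj; rewrite !finset.in_setT.
by move=> /(_ isT isT isT isT kK kK').
Qed.

Let nablaP (w : 'I_#|S| -> F) : nabla0 F (sub_cols (segre n) S) w <-> torus w /\
  exists (x y : 'I_2 -> F) (z : 'I_n -> F),
    [/\ forall i, x i != 0, forall j, y j != 0, forall k, z k != 0 &
    [/\ forall i, \sum_j \sum_(k in K) w (r i j k) * y j * z k = 0,
        forall j, \sum_i \sum_(k in K) w (r i j k) * x i * z k = 0 &
        forall k, k \in K -> \sum_i \sum_j w (r i j k) * x i * y j = 0]].
Proof.
rewrite (nabla0_face (finset.in_setT 0) (finset.in_setT 0) k0K).
split=> -[tw [x [y [z [x0 y0 z0 [ex ey ez]]]]]]; split=> //; exists x, y, z; split=> //.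
  split=> [i|j|k kK].
  - by rewrite -[RHS](ex i (finset.in_setT i)) sum_setT.
  - by rewrite -[RHS](ey j (finset.in_setT j)) sum_setT.
  - by rewrite -[RHS](ez k kK) sum_setT; apply: eq_bigr => i _; rewrite sum_setT.
split=> [i _|j _|k kK].
- by rewrite -[RHS](ex i) sum_setT.
- by rewrite -[RHS](ey j) sum_setT.
- by rewrite -[RHS](ez k kK) sum_setT; apply: eq_bigr => i _; rewrite sum_setT.
Qed.

Let X_r i j k : k \in K ->
  ('X_(r i j k) : {mpoly F[#|S|]}) \mPo [tuple 'X_(enum_val m) | m < #|S|] = wvar F i j k.
Proof. by move=> kK; rewrite comp_enum_val enum_val_fpos ?finset.in_setT. Qed.

(** A single slice is a matrix in [i] and [j], with [j] in the role of the column index. *)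
Lemma face_disc_slice : K = [set k0] -> proportional (face_disc S)
  (det2 (wvar F 0 0 k0) (wvar F 0 1 k0) (wvar F 1 0 k0) (wvar F 1 1 k0)).
Proof.
move=> eK; pose q i j := r i j k0.
have q_inj i i' j j' : j \in [set: 'I_2] -> j' \in [set: 'I_2] -> q i j = q i' j' ->
    (i, j) = (i', j').
  by move=> _ _ /r_inj-/(_ k0K k0K)[-> ->].
have n01 : (0 : 'I_2) != 1 by [].
have eT : [set: 'I_2] = [set 0; 1].
  by apply/setP; apply: forall_I2; rewrite !inE.
have := face_disc_proportional (Adisc_matrix2 q_inj _ n01 eT).
rewrite rmorph_det2 /= !X_r //; apply=> w; rewrite nablaP.
split=> -[tw]; last first.
  move=> [x [y [x0 y0 ex ey]]]; split=> //; exists x, y, (fun=> 1).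
  split=> //; first by move=> _; rewrite oner_neq0.
  split=> [i|j|k].
  - rewrite -[RHS](ex i) sum_setT; apply: eq_bigr => j _.
    by rewrite eK big_set1 mulr1.
  - rewrite -[RHS](ey j (finset.in_setT j)); apply: eq_bigr => i _.
    by rewrite eK big_set1 mulr1.
  - rewrite eK inE => /eqP->; rewrite big1 // => i _.
    transitivity (x i * \sum_(j in [set: 'I_2]) w (q i j) * y j); last by rewrite ex mulr0.
    rewrite sum_setT mulr_sumr; apply: eq_bigr => j _.
    by rewrite mulrA; congr (_ * _); rewrite mulrC.
move=> [x [y [z [x0 y0 z0 [ex ey _]]]]]; split=> //; exists x, y; split=> // [i|j _].
  apply: (mulfI (z0 k0)); rewrite mulr0 -[RHS](ex i) sum_setT mulr_sumr.
  by apply: eq_bigr => j _; rewrite eK big_set1 mulrC.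
apply: (mulfI (z0 k0)); rewrite mulr0 -[RHS](ey j) mulr_sumr.
by apply: eq_bigr => i _; rewrite eK big_set1 mulrC.
Qed.

Lemma face_disc_full_trivial : (3 < #|K|)%N -> face_disc S = 1.
Proof. by move=> K3; apply: face_disc1; apply: (Adisc_tensor_trivial r_inj nablaP K3). Qed.

Lemma sum_enum_val m (e : m = #|K|) (f : 'I_n -> F) :
  \sum_(k in K) f k = \sum_(l < m) f (enum_val (cast_ord e l)).
Proof.
rewrite big_enum_val /=; subst m.
by apply: eq_bigr => l _; rewrite cast_ord_id.
Qed.

Let kappa m (e : m = #|K|) l : 'I_n := enum_val (cast_ord e l).

Let kappa_inj m (e : m = #|K|) : injective (kappa e).
Proof. exact: inj_comp enum_val_inj (@cast_ord_inj _ _ e). Qed.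

Let kappaK m (e : m = #|K|) l : kappa e l \in K.
Proof. exact: enum_valP. Qed.

Let kappaS m (e : m = #|K|) k : k \in K -> exists l, k = kappa e l.
Proof.
move=> kK; exists (cast_ord (esym e) (enum_rank_in kK k)).
by rewrite /kappa cast_ordKV enum_rankK_in.
Qed.

Let wvar_kappa m (e : m = #|K|) i j l :
  ('X_(tpos i j (cast_ord e l)) : {mpoly F[#|tidx #|K| |]}) \mPo
    [tuple (let t : tidx #|K| := enum_val m in
            wvar F t.1.1 t.1.2 (enum_val t.2)) | m < #|tidx #|K| |] = wvar F i j (kappa e l).
Proof. by rewrite comp_mpolyXU -tnth_nth tnth_mktuple /tpos enum_rankK. Qed.

Lemma proportional_trans_sym N (p q s : {mpoly F[N]}) :
  proportional p s -> proportional q s -> proportional p q.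
Proof.
move=> [c c0 ->] [c' c'0 ->]; exists (c / c'); first by rewrite mulf_neq0 ?invr_eq0.
by rewrite scalerA divfK.
Qed.

(** Both sides involve a choice by [xget], so they are compared through the explicit [h222] or
    [h223]. *)
Lemma face_disc_hyperdet : (#|K| == 2)%N || (#|K| == 3)%N ->
  proportional (face_disc S) (sub_hyperdet F K).
Proof.
case/orP => /eqP/esym e.
  pose W i j l := wvar F i j (kappa e l).
  have hyp : proportional (sub_hyperdet F K)
      (h222 (W 0 0 0) (W 0 1 0) (W 1 0 0) (W 1 1 0) (W 0 0 1) (W 0 1 1) (W 1 0 1) (W 1 1 1)).
    have [c c0 h] := hyperdet222 F e.
    by exists c; rewrite // /sub_hyperdet h comp_mpolyZ rmorph_h222 /= !wvar_kappa.
  apply: proportional_trans_sym hyp.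
  have := face_disc_proportional (Adisc_tensor2 r_inj nablaP (@kappa_inj _ e)
    (sum_enum_val e) (@kappaK _ e) (@kappaS _ e)).
  by rewrite rmorph_h222 /= !X_r // kappaK.
have hyp : proportional (sub_hyperdet F K)
    (h223 (fun l => wvar F 0 0 (kappa e l)) (fun l => wvar F 0 1 (kappa e l))
          (fun l => wvar F 1 0 (kappa e l)) (fun l => wvar F 1 1 (kappa e l))).
  have [c c0 h] := hyperdet223 F e.
  exists c; rewrite // /sub_hyperdet h comp_mpolyZ rmorph_h223 /=.
  set Q := comp_mpoly _.
  have ev i j : Q \o (fun l => 'X_(tpos i j (cast_ord e l))) = fun l => wvar F i j (kappa e l).
    by apply: funext => l; rewrite /Q /= wvar_kappa.
  by rewrite !ev.
apply: proportional_trans_sym hyp.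
have := face_disc_proportional (Adisc_tensor3 r_inj nablaP (@kappa_inj _ e)
  (sum_enum_val e) (@kappaK _ e) (@kappaS _ e)).
rewrite rmorph_h223 /=; set Q := comp_mpoly _.
have ev i j : Q \o (fun l => 'X_(r i j (kappa e l))) = fun l => wvar F i j (kappa e l).
  by apply: funext => l; rewrite /Q /= X_r ?kappaK.
by rewrite !ev.
Qed.

End Full.

End FaceDiscriminants.

(** * Faces as products of index sets *)

Section SegreFaces.
Variables (R : realType) (n : nat).

Lemma rcol_conv (d N : nat) (A : 'M[int]_(d, N)) m : conv_cols R A (rcol R A m).
Proof.
exists (fun m' => (m' == m)%:R); split=> [m'||]; first exact: ler0n.
  by rewrite (bigD1 m) //= eqxx big1 ?addr0 // => i /negPf->.
by rewrite (bigD1 m) //= eqxx scale1r big1 ?addr0 // => i /negPf->; rewrite scale0r.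
Qed.

Lemma conv_pairing (d N : nat) (A : 'M[int]_(d, N)) (u : 'rV[R]_d) (l : 'I_N -> R) :
  (u *m (\sum_m l m *: rcol R A m)) 0 0 = \sum_m l m * (u *m rcol R A m) 0 0.
Proof. by rewrite mulmx_sumr summxE; apply: eq_bigr => m _; rewrite -scalemxAr mxE. Qed.

Lemma sum_delta (m : nat) (u : 'I_m -> R) i0 :
  \sum_i u i * ((delta_mx i0 0 : 'cV[int]_m) i 0)%:~R = u i0.
Proof.
rewrite (bigD1 i0) //= mxE !eqxx mulr1 big1 ?addr0 // => i /negPf ne.
by rewrite mxE ne mulr0.
Qed.

Lemma segre_pairing (u : 'rV[R]_(2 + 2 + n)) i j k :
  (u *m rcol R (segre n) (tpos i j k)) 0 0 =
  u 0 (lshift n (lshift 2 i)) + u 0 (lshift n (rshift 2 j)) + u 0 (rshift (2 + 2) k).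
Proof.
have colE s : rcol R (segre n) (tpos i j k) s 0 = (segre_col ((i, j, k) : tidx n) s 0)%:~R.
  by rewrite !mxE /tpos enum_rankK.
rewrite mxE !big_split_ord /=; congr (_ + _ + _).
- rewrite -[RHS](sum_delta (fun i => u 0 (lshift n (lshift 2 i)))).
  by apply: eq_bigr => i' _; rewrite colE /segre_col !col_mxEu.
- rewrite -[RHS](sum_delta (fun j => u 0 (lshift n (rshift 2 j)))).
  by apply: eq_bigr => j' _; rewrite colE /segre_col col_mxEu col_mxEd.
- rewrite -[RHS](sum_delta (fun k => u 0 (rshift (2 + 2) k))).
  by apply: eq_bigr => k' _; rewrite colE /segre_col col_mxEd.
Qed.

Lemma tpos_enum_val (m : 'I_#|tidx n|) :
  m = tpos (enum_val m).1.1 (enum_val m).1.2 (enum_val m).2.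
Proof. by rewrite -[LHS]enum_valK /tpos; case: (enum_val m) => -[]. Qed.

(** On columns a linear functional is a sum [a i + b j + g k], so it is maximal exactly when each
    summand is. *)
Lemma face_colset_segre (S : {set 'I_#|tidx n|}) : face_colset R (segre n) S ->
  exists (I J : {set 'I_2}) (K : {set 'I_n}), [/\ (0 < #|I|)%N, (0 < #|J|)%N, (0 < #|K|)%N & S = segre_face I J K].
Proof.
move=> [G [[[x Gx] [u [c [ule eG]]]] eS]].
pose f m : R := (u *m rcol R (segre n) m) 0 0.
have f_le m : f m <= c by apply: ule; apply: rcol_conv.
have SE m : (m \in S) = (f m == c).
  rewrite eS inE; apply/asboolP/eqP; rewrite eG; first by case.
  by move=> e; split=> //; apply: rcol_conv.
have [m0 m0S] : exists m0, f m0 = c.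
  (* A point of the face has no weight on columns below [c]; if all columns were below, its weights
     would vanish instead of adding up to 1. *)
  apply: contrapT => /forallNP h; move: Gx; rewrite eG => -[[l [l0 l1 ->]]].
  rewrite conv_pairing => e.
  have d0 : \sum_m l m * (c - f m) = 0.
    by under eq_bigr do rewrite mulrBr; rewrite sumrB e -mulr_suml l1 mul1r subrr.
  have l00 m : l m = 0.
    have /(_ m isT)/eqP : forall i, true -> l i * (c - f i) = 0.
      by apply/psumr_eq0P => // i _; rewrite mulr_ge0 // subr_ge0.
    rewrite mulf_eq0 subr_eq0 => /orP[/eqP //|/eqP e']; by case: (h m).
  by move: l1; rewrite big1 // => /esym/eqP; rewrite oner_eq0.
set t0 := (enum_val m0 : tidx n); pose i0 := t0.1.1; pose j0 := t0.1.2; pose k0 := t0.2.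
pose a i := u 0 (lshift n (lshift 2 i)); pose b j := u 0 (lshift n (rshift 2 j)).
pose g k := u 0 (rshift (2 + 2) k).
have fE i j k : f (tpos i j k) = a i + b j + g k by apply: segre_pairing.
have f0 : a i0 + b j0 + g k0 = c by rewrite -fE -m0S (tpos_enum_val m0).
have a_le i : a i <= a i0.
  by have := f_le (tpos i j0 k0); rewrite fE -f0 !lerD2r.
have b_le j : b j <= b j0.
  by have := f_le (tpos i0 j k0); rewrite fE -f0 lerD2r lerD2l.
have g_le k : g k <= g k0.
  by have := f_le (tpos i0 j0 k); rewrite fE -f0 lerD2l.
exists [set i | a i == a i0], [set j | b j == b j0], [set k | g k == g k0].
split; first by apply/card_gt0P; exists i0; rewrite inE.
- by apply/card_gt0P; exists j0; rewrite inE.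
- by apply/card_gt0P; exists k0; rewrite inE.
apply/setP => m; rewrite SE (tpos_enum_val m); set t := (enum_val m : tidx n).
rewrite tpos_face !inE fE -f0; apply/eqP/and3P => [e|[/eqP-> /eqP-> /eqP->]] //.
have := a_le t.1.1; have := b_le t.1.2; have := g_le t.2 => hg hb ha.
by split; rewrite eq_le; apply/andP; split=> //; lra.
Qed.

(** The supporting functional is minus the number of indices lying outside [I], [J], [K];
    nonemptiness makes its maximum 0. *)
Lemma segre_face_colset (I J : {set 'I_2}) (K : {set 'I_n}) : (0 < #|I|)%N -> (0 < #|J|)%N ->
  (0 < #|K|)%N -> face_colset R (segre n) (segre_face I J K).
Proof.
move=> /card_gt0P[i0 iI] /card_gt0P[j0 jJ] /card_gt0P[k0 kK].
pose u : 'rV[R]_(2 + 2 + n) := row_mx (row_mx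
  (\row_i (- (i \notin I)%:R)) (\row_j (- (j \notin J)%:R))) (\row_k (- (k \notin K)%:R)).
have uE i j k : (u *m rcol R (segre n) (tpos i j k)) 0 0 =
    - (i \notin I)%:R - (j \notin J)%:R - (k \notin K)%:R.
  by rewrite segre_pairing /u !row_mxEl !row_mxEr !mxE.
have b0 (b : bool) : 0 <= b%:R :> R by rewrite ler0n.
exists [set x | conv_cols R (segre n) x /\ (u *m x) 0 0 = 0]%classic; split.
  split.
    exists (rcol R (segre n) (tpos i0 j0 k0)); split; first exact: rcol_conv.
    by rewrite uE iI jJ kK /= oppr0 !addr0.
  exists u, 0; split=> // x [l [l0 l1 ->]]; rewrite conv_pairing.
  apply: sumr_le0 => m _; rewrite (tpos_enum_val m) uE mulr_ge0_le0 //.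
  by rewrite -!opprD oppr_le0 !addr_ge0.
apply/setP => m; rewrite [RHS]inE (tpos_enum_val m); set t := (enum_val m : tidx n).
rewrite tpos_face; apply/and3P/asboolP => [[iI' jJ' kK']|[_]].
  by split; [exact: rcol_conv|rewrite uE iI' jJ' kK' /= oppr0 !addr0].
rewrite uE => e; have h1 := b0 (t.1.1 \notin I); have h2 := b0 (t.1.2 \notin J).
have h3 := b0 (t.2 \notin K).
have z (b : bool) : (~~ b)%:R = 0 :> R -> b.
  by case: b => //= /eqP; rewrite oner_eq0.
by split; apply: z; lra.
Qed.

End SegreFaces.

(** * The product over the faces *)

Section SubsetProducts.
Variable R : comNzRingType.

Lemma prod_card1 (T : finType) (G : {set T} -> R) :
  \prod_(A : {set T} | #|A| == 1) G A = \prod_t G [set t].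
Proof.
transitivity (\prod_(A in [set [set t] | t in [set: T]]) G A).
  apply: eq_bigl => A; apply/cards1P/imsetP => [[t ->]|[t _ ->]]; last by exists t.
  by exists t; rewrite ?finset.in_setT.
rewrite big_imset /=; last by move=> t t' _ _ /set1_inj.
by apply: eq_bigl => t; rewrite finset.in_setT.
Qed.

Lemma prod_nonempty_I2 (G : {set 'I_2} -> R) :
  \prod_(A : {set 'I_2} | (0 < #|A|)%N) G A = G [set: 'I_2] * \prod_i G [set i].
Proof.
rewrite (bigD1 [set: 'I_2]) /=; last by rewrite cardsT card_ord.
rewrite -prod_card1; congr (_ * _); apply: eq_bigl => A.
have A2 : (#|A| <= 2)%N by have := max_card A; rewrite card_ord.
rewrite finset.eqEcard finset.subsetT cardsT card_ord /= -ltnNge.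
by case: #|A| A2 => [|[|[|m]]].
Qed.

Lemma prod_card2 n (G : {set 'I_n} -> R) :
  \prod_(A : {set 'I_n} | #|A| == 2) G A =
  \prod_(c < n) \prod_(c' < n | (c < c')%N) G [set c; c'].
Proof.
rewrite pair_big_dep /=.
pose P := [set p : 'I_n * 'I_n | (p.1 < p.2)%N].
transitivity (\prod_(A in [set [set p.1; p.2] | p in P]) G A).
  apply: eq_bigl => A; apply/cards2P/imsetP => [[c [c' [nc eA]]]|[[c c']]]; last first.
    by rewrite inE /= => cc' ->; exists c, c'; rewrite neq_ltn cc'.
  have [cc'|cc'|e] := ltngtP c c'; last by move/eqP: nc => []; apply: val_inj.
    by exists (c, c'); rewrite ?inE ?eA.
  by exists (c', c); rewrite ?inE //= eA finset.setUC.
rewrite big_imset /=; first by apply: eq_bigl => p; rewrite inE.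
move=> [a b] [c d]; rewrite !inE /= => ab cd /setP e.
have := e c; have := e d; rewrite !inE !eqxx orbT /=.
move=> /orP[]/eqP ed /orP[]/eqP ec; subst => //; by [rewrite ltnn in cd|
  move: (ltn_trans ab cd); rewrite ltnn].
Qed.

Lemma prod_I2_lt (f : 'I_2 -> 'I_2 -> R) :
  \prod_(i < 2) \prod_(j < 2 | (i < j)%N) f i j = f 0 1.
Proof.
rewrite !big_ord_recl big_ord0 !big_mkcond !big_ord_recl !big_ord0 /= !mulr1 !mul1r.
rewrite [X in _ * X]big1 ?mulr1; last by case=> [[|[|j]] lj].
by congr (f _ _); apply: val_inj.
Qed.

Lemma prod_2minorsE n (M : 'M[R]_(2, n)) : prod_2minors M =
  \prod_(c < n) \prod_(c' < n | (c < c')%N) det2 (M 0 c) (M 0 c') (M 1 c) (M 1 c').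
Proof. exact: prod_I2_lt. Qed.

Lemma prod_2minors22 (M : 'M[R]_2) : prod_2minors M = det2 (M 0 0) (M 0 1) (M 1 0) (M 1 1).
Proof. by rewrite prod_2minorsE prod_I2_lt. Qed.

End SubsetProducts.

Section PrincipalDeterminant.
Variables (F : fieldType) (N : nat).

Lemma proportional_refl (p : {mpoly F[N]}) : proportional p p.
Proof. by exists 1; rewrite ?oner_eq0 ?scale1r. Qed.

Lemma proportionalM (p p' q q' : {mpoly F[N]}) :
  proportional p p' -> proportional q q' -> proportional (p * q) (p' * q').
Proof.
move=> [c c0 ->] [c' c'0 ->]; exists (c * c'); first exact: mulf_neq0.
by rewrite -scalerAl -scalerAr scalerA.
Qed.

Lemma proportional_prod (T : finType) (P : pred T) (f g : T -> {mpoly F[N]}) :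
  (forall t, P t -> proportional (f t) (g t)) ->
  proportional (\prod_(t | P t) f t) (\prod_(t | P t) g t).
Proof.
move=> h; apply: (big_ind2 (@proportional F N)) => //; first exact: proportional_refl.
by move=> p p' q q'; apply: proportionalM.
Qed.

End PrincipalDeterminant.

Section SegreProduct.
Variables (F : numClosedFieldType) (n : nat).
Local Notation face_disc := (@face_disc F n).

Lemma prod_face_disc_rows j :
  proportional (\prod_(K : {set 'I_n} | (0 < #|K|)%N)
                  face_disc (segre_face [set: 'I_2] [set j] K))
    (prod_2minors (\matrix_(i < 2, k < n) wvar F i j k)).
Proof.
rewrite (bigID (fun K : {set 'I_n} => #|K| == 2)) /= [X in _ * X]big1 ?mulr1; last first.
  by move=> K /andP[/card_gt0P[k0 k0K] K2]; apply: face_disc_rows_trivial k0K K2.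
under eq_bigl => K do rewrite andb_idl => [|/eqP->//].
rewrite prod_card2 prod_2minorsE.
apply: proportional_prod => c _; apply: proportional_prod => c' cc'.
rewrite !mxE; apply: (@face_disc_rows _ _ _ _ c) => //; first by rewrite !inE eqxx.
by rewrite neq_ltn cc'.
Qed.

Lemma prod_face_disc_columns i :
  proportional (\prod_(K : {set 'I_n} | (0 < #|K|)%N)
                  face_disc (segre_face [set i] [set: 'I_2] K))
    (prod_2minors (\matrix_(j < 2, k < n) wvar F i j k)).
Proof.
rewrite (bigID (fun K : {set 'I_n} => #|K| == 2)) /= [X in _ * X]big1 ?mulr1; last first.
  by move=> K /andP[/card_gt0P[k0 k0K] K2]; apply: face_disc_columns_trivial k0K K2.
under eq_bigl => K do rewrite andb_idl => [|/eqP->//].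
rewrite prod_card2 prod_2minorsE.
apply: proportional_prod => c _; apply: proportional_prod => c' cc'.
rewrite !mxE; apply: (@face_disc_columns _ _ _ _ c) => //; first by rewrite !inE eqxx.
by rewrite neq_ltn cc'.
Qed.

Lemma prod_face_disc_full :
  proportional (\prod_(K : {set 'I_n} | (0 < #|K|)%N)
                  face_disc (segre_face [set: 'I_2] [set: 'I_2] K))
    ((\prod_(k < n) prod_2minors (\matrix_(i < 2, j < 2) wvar F i j k)) *
     \prod_(K : {set 'I_n} | (#|K| == 2)%N || (#|K| == 3)%N) sub_hyperdet F K).
Proof.
rewrite (bigID (fun K : {set 'I_n} => #|K| == 1)) /=; apply: proportionalM.
  under eq_bigl => K do rewrite andb_idl => [|/eqP->//].
  rewrite prod_card1; apply: proportional_prod => k _; rewrite prod_2minors22 !mxE.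
  by apply: face_disc_slice => //; rewrite inE.
rewrite (bigID (fun K : {set 'I_n} => (#|K| == 2) || (#|K| == 3))) /=.
rewrite [X in _ * X]big1 ?mulr1; last first.
  move=> K /andP[/andP[K0 K1] K23]; have /card_gt0P[k0 k0K] := K0.
  apply: (face_disc_full_trivial _ k0K).
  by move: K0 K1 K23; case: #|K| => [|[|[|[|m]]]].
rewrite (eq_bigl (fun K : {set 'I_n} => (#|K| == 2) || (#|K| == 3))); last first.
  by move=> K; case: #|K| => [|[|[|[|m]]]].
apply: proportional_prod => K K23.
have /card_gt0P[k0 k0K] : (0 < #|K|)%N by case/orP: K23 => /eqP->.
exact: face_disc_hyperdet k0K K23.
Qed.

Lemma prod_face_disc :
  proportional (\prod_(I : {set 'I_2} | (0 < #|I|)%N) \prod_(J : {set 'I_2} | (0 < #|J|)%N)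
                  \prod_(K : {set 'I_n} | (0 < #|K|)%N) face_disc (segre_face I J K))
    (prod_slice_minors F n *
     \prod_(K : {set 'I_n} | (#|K| == 2)%N || (#|K| == 3)%N) sub_hyperdet F K).
Proof.
rewrite !prod_nonempty_I2; under [X in _ * X]eq_bigr => i _.
  rewrite prod_nonempty_I2 [X in _ * X]big1 ?mulr1; last first.
    by move=> j _; rewrite big1 // => K K0; apply: face_disc_point.
  over.
(* Matches the order of the faces: [I] and [J] full, then [J] a singleton, then [I] a singleton. *)
have reorder (a b c d : {mpoly F[#|tidx n|]}) : a * b * c * d = c * d * b * a by ring.
rewrite /prod_slice_minors [X in proportional _ X]reorder.
apply: proportionalM.
  apply: proportionalM; first exact: prod_face_disc_full.
  by apply: proportional_prod => j _; apply: prod_face_disc_rows.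
by apply: proportional_prod => i _; apply: prod_face_disc_columns.
Qed.

End SegreProduct.

(** A product of nonempty sets determines its factors as its projections, so each face is counted
    once. *)
Lemma prod_faces (R : realType) (T : comNzRingType) n (G : {set 'I_#|tidx n|} -> T) :
  \prod_(S : {set 'I_#|tidx n|} | `[< face_colset R (segre n) S >]) G S =
  \prod_(I : {set 'I_2} | (0 < #|I|)%N) \prod_(J : {set 'I_2} | (0 < #|J|)%N)
    \prod_(K : {set 'I_n} | (0 < #|K|)%N) G (segre_face I J K).
Proof.
under [RHS]eq_bigr do rewrite pair_big /=.
rewrite pair_big /=.
pose proj1 (S : {set 'I_#|tidx n|}) := [set (enum_val m).1.1 | m in S].
pose proj2 (S : {set 'I_#|tidx n|}) := [set (enum_val m).1.2 | m in S].
pose proj3 (S : {set 'I_#|tidx n|}) := [set (enum_val m).2 | m in S].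
have projE (I J : {set 'I_2}) (K : {set 'I_n}) : (0 < #|I|)%N -> (0 < #|J|)%N -> (0 < #|K|)%N ->
    [/\ proj1 (segre_face I J K) = I, proj2 (segre_face I J K) = J &
        proj3 (segre_face I J K) = K].
  move=> /card_gt0P[i0 iI] /card_gt0P[j0 jJ] /card_gt0P[k0 kK].
  have mem i j k : i \in I -> j \in J -> k \in K -> tpos i j k \in segre_face I J K.
    by move=> h1 h2 h3; rewrite tpos_face h1 h2.
  split; apply/setP => t; apply/imsetP/idP => [[m + ->]|tI].
  - by rewrite inE => /and3P[].
  - by exists (tpos t j0 k0); [exact: mem|rewrite /tpos enum_rankK].
  - by rewrite inE => /and3P[].
  - by exists (tpos i0 t k0); [exact: mem|rewrite /tpos enum_rankK].
  - by rewrite inE => /and3P[].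
  - by exists (tpos i0 j0 t); [exact: mem|rewrite /tpos enum_rankK].
rewrite (reindex_onto
  (fun t : {set 'I_2} * ({set 'I_2} * {set 'I_n}) => segre_face t.1 t.2.1 t.2.2)
  (fun S => (proj1 S, (proj2 S, proj3 S)))); last first.
  move=> S /asboolP/face_colset_segre[I [J [K [I0 J0 K0 ->]]]] /=.
  by have [-> -> ->] := projE I J K I0 J0 K0.
apply: eq_bigl => -[I [J K]] /=; apply/andP/and3P => [[/asboolP f /eqP e]|[I0 J0 K0]].
  have [I' [J' [K' [I0 J0 K0 eS]]]] := face_colset_segre f.
  by have [e1 e2 e3] := projE I' J' K' I0 J0 K0; move: e; rewrite eS e1 e2 e3 => -[<- <- <-].
split; first by apply/asboolP; apply: segre_face_colset.
by have [-> -> ->] := projE I J K I0 J0 K0.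
Qed.

Theorem theorem1p5 (R : realType) (n : nat) (hn : (1 <= n)%N) :
  exists c : R[i], c != 0 /\
    principal_Adet R (segre n) =
      c *: (prod_slice_minors R[i] n *
            \prod_(K : {set 'I_n} | (#|K| == 2)%N || (#|K| == 3)%N)
              sub_hyperdet R[i] K).
Proof.
have [c c0 e] := prod_face_disc R[i] n; exists c; split=> //.
by rewrite -e -(prod_faces R).
Qed.
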